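(* Let $p$ be a prime, $n\ge 1$ an integer, and $\Psi$ a fixed nontrivial complex-valued additive character of $\mathbf F_p$. Fix an embedding of the algebraic numbers into $\overline{\mathbf Q}_p$. For every integer $k$ (positive, zero or negative), the unit root zeta function $$L(U_n^{\otimes k},T)=\prod_{\bar y}\frac{1}{1-\alpha_0(\bar y)^k\,T^{\deg(\bar y)}},$$ the product running over the closed points $\bar y$ of the one-dimensional torus $\mathbf G_m/\mathbf F_p$, is a $p$-adic meromorphic function of $T$ on all of $\mathbf C_p$ (i.e. a quotient of two $p$-adic entire power series).
   Context: For a finite field $\mathbf F_q$ of characteristic $p$, $\bar y\in\mathbf F_q^*$ and $m\ge1$, the $n$-dimensional Kloosterman sum is $K_m(\bar y,n)=\sum_{x_1,\dots,x_n\in\mathbf F_{q^m}^*}\Psi\big(\mathrm{Tr}_{\mathbf F_{q^m}/\mathbf F_p}(x_1+\cdots+x_n+\bar y/(x_1\cdots x_n))\big)$, and $L(\bar y,n,T)=\exp\big(\sum_{m\ge1}K_m(\bar y,n)T^m/m\big)$. It is known that $L(\bar y,n,T)^{(-1)^{n-1}}=\prod_{i=0}^n(1-\alpha_i(\bar y)T)$ is a polynomial of degree $n+1$ and that exactly one of its reciprocal roots, denoted $\alpha_0(\bar y)$, is a $p$-adic unit (under the fixed embedding). For a closed point $\bar y$ of $\mathbf G_m/\mathbf F_p$ of degree $d$, $\alpha_0(\bar y)$ is computed by regarding $\bar y$ as an element of $\mathbf F_{p^d}^*$ (i.e. with $q=p^d$); it does not depend on the choice of the conjugate. *)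

(* Defs.v *)
From HB Require Import structures.
From mathcomp Require Import all_boot all_order all_algebra all_field.
From mathcomp Require Import all_classical all_reals all_analysis.

Set Implicit Arguments.
Unset Strict Implicit.
Unset Printing Implicit Defensive.

Import Order.TTheory GRing.Theory Num.Theory.
Import numFieldNormedType.Exports.
Local Open Scope ring_scope.

(** * Formal power series, as sequences of coefficients *)

Section PowerSeries.
Context {R : comNzRingType}.

Definition ps_of_poly (f : {poly R}) : nat -> R := fun N => f`_N.

Definition ps_mul (f g : nat -> R) : nat -> R :=
  fun N => \sum_(i < N.+1) f i * g (N - i)%N.

End PowerSeries.

(* Exponential of a power series without constant term (u 0 is ignored): the
   coefficient of T^N of exp(u) only involves u modulo T^(N+1), and only the
   terms u^j / j! with j <= N. *)
Definition ps_exp {F : fieldType} (u : nat -> F) : nat -> F := fun N =>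
  (\sum_(j < N.+1)
     j`!%:R^-1 *: (\sum_(1 <= i < N.+1) u i *: 'X^i) ^+ j)`_N.

(** * Kloosterman sums *)

Definition nontrivial_additive_character (p : nat) (Psi : 'F_p -> algC) : Prop :=
  [/\ Psi 0 = 1,
      {morph Psi : a b / a + b >-> a * b}
    & exists a, Psi a != 1].

(* The Galois trace of E / F_p lives in the prime subfield 1%VS of E; it is
   identified with the element of 'F_p that it comes from. *)
Definition abs_trace (p : nat) (E : finFieldType) (charE : p \in [pchar E])
    (x : E) : 'F_p :=
  odflt 0 [pick c : 'F_p |
    c%:A == galTrace 1 {: pPrimeCharType charE} (x : pPrimeCharType charE)].

Definition kloosterman_sum (p : nat) (Psi : 'F_p -> algC) (n : nat)
    (E : finFieldType) (charE : p \in [pchar E]) (y : E) : algC :=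
  \sum_(x : {ffun 'I_n -> E} | [forall i, x i != 0])
     Psi (abs_trace charE (\sum_i x i + y / \prod_i x i)).

Lemma Xq_sub_X_neq0 (F : finFieldType) (m : nat) :
  'X^(#|F| ^ m.+1) - 'X != 0 :> {poly F}.
Proof.
have q1 : (1 < #|F| ^ m.+1)%N.
  by rewrite -(exp1n m.+1) ltn_exp2r ?card_finNzRing_gt1.
apply/eqP => /(congr1 (fun f : {poly F} => f`_1)).
rewrite coefB coefXn coefX coef0 eqxx (ltn_eqF q1) sub0r => /eqP.
by rewrite oppr_eq0 oner_eq0.
Qed.

(* The extension of degree m.+1 of the finite field F with q elements: the
   splitting field over F of X^(q^(m.+1)) - X. *)
Definition fin_ext (F : finFieldType) (m : nat) : splittingFieldType F :=
  sval (FinSplittingFieldFor (Xq_sub_X_neq0 F m)).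

Lemma fin_ext_pchar (p : nat) (F : finFieldType) (charF : p \in [pchar F])
  (m : nat) : p \in [pchar (finvect_type (fin_ext F m))].
Proof. exact: (rmorph_pchar (in_alg (fin_ext F m)) charF). Qed.

(* K_(m.+1)(y, n), for y in F *)
Definition kloosterman (p : nat) (Psi : 'F_p -> algC) (n : nat)
    (F : finFieldType) (charF : p \in [pchar F]) (y : F) (m : nat) : algC :=
  kloosterman_sum Psi n (fin_ext_pchar charF m)
    (y%:A : finvect_type (fin_ext F m)).

Definition L_kloosterman (p : nat) (Psi : 'F_p -> algC) (n : nat)
    (F : finFieldType) (charF : p \in [pchar F]) (y : F) : nat -> algC :=
  ps_exp (fun m => kloosterman Psi n charF y m.-1 / m%:R).

(** * Closed points of the torus over the prime field *)

(* A closed point of G_m / F_p is a maximal ideal of F_p[X, 1/X], that is, a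
   monic irreducible f different from 'X.  Its degree is that of f, its residue
   field is F_p[X]/(f), and the class of 'X is the corresponding nonzero element
   of this field with p ^ deg f elements. *)
Definition closed_point_Gm (p : nat) (f : {poly 'F_p}) : bool :=
  [&& irreducibleb f, f \is monic & f != 'X].

Definition point_degree (p : nat) (f : {poly 'F_p}) : nat := (size f).-1.

Lemma closed_point_mi (p : nat) (f : {poly 'F_p}) :
  closed_point_Gm f -> monic_irreducible_poly f.
Proof. by case/and3P => /irreducibleP. Qed.

Definition residue_field (p : nat) (f : {poly 'F_p})
  (hf : closed_point_Gm f) : finFieldType := {poly %/ f with closed_point_mi hf}.

Lemma residue_field_pchar (p : nat) (pr_p : prime p) (f : {poly 'F_p})
  (hf : closed_point_Gm f) : p \in [pchar (residue_field hf)].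
Proof.
exact: (rmorph_pchar (in_alg {poly %/ f with closed_point_mi hf})
  (pchar_Fp pr_p)).
Qed.

Definition point_coord (p : nat) (f : {poly 'F_p})
  (hf : closed_point_Gm f) : residue_field hf := in_qpoly f 'X.

(* Euler product of the 1 / (1 - w_f T^(deg f)) over the closed points f.  Only
   the points of degree at most N contribute to the coefficient of T^N, and each
   factor only matters modulo T^(N+1). *)
Definition euler_product_Gm (p : nat) (F : fieldType) (w : {poly 'F_p} -> F) :
    nat -> F := fun N =>
  (\prod_(f : {poly_(N.+1) 'F_p} | closed_point_Gm f)
     \sum_(j < N.+1) w f ^+ j *: 'X^(j * point_degree (f : {poly 'F_p})))`_N.

(** * The field C_p *)

Section PadicComplex.
Context {R : realType} {C : closedFieldType} (v : C -> R).
Local Open Scope classical_set_scope.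

Definition vcvg (u : nat -> C) (l : C) : Prop :=
  (fun i => v (u i - l)) @ \oo --> (0 : R).

Definition vcauchy (u : nat -> C) : Prop :=
  forall e : R, 0 < e -> exists N : nat,
    forall i j : nat, (N <= i)%N -> (N <= j)%N -> v (u i - u j) < e.

Definition in_Qp (x : C) : Prop :=
  forall e : R, 0 < e -> exists r : rat, v (x - ratr r) < e.

Definition in_Qpbar (x : C) : Prop :=
  exists f : {poly C}, [/\ f != 0, forall i, in_Qp f`_i & root f x].

(* (C, v) is C_p with its p-adic absolute value: C is the completion of an
   algebraic closure of Q_p, where Q_p is the completion of the rationals inside
   C.  The first four fields force v to be the p-adic absolute value on the
   rationals, and (C, v) is determined up to isometric isomorphism. *)
Record is_Cp (p : nat) : Prop := IsCp {
  Cp_norm_eq0 : forall x, (v x == 0) = (x == 0);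
  Cp_normM : {morph v : x y / x * y};
  Cp_ultrametric : forall x y, v (x + y) <= Num.max (v x) (v y);
  Cp_normp : v p%:R = p%:R^-1;
  Cp_complete : forall u, vcauchy u -> exists l, vcvg u l;
  Cp_dense : forall x (e : R), 0 < e -> exists2 y, in_Qpbar y & v (x - y) < e
}.

Definition padic_entire (g : nat -> C) : Prop :=
  forall z : C, exists l : C, vcvg (fun N => \sum_(i < N) g i * z ^+ i) l.

Definition padic_meromorphic (f : nat -> C) : Prop :=
  exists g h : nat -> C,
    [/\ padic_entire g, padic_entire h, exists N, h N != 0
      & ps_mul f h =1 g].

End PadicComplex.

(** * Unit roots of Kloosterman sums *)

(* alpha lists the reciprocal roots of L(y, n, T)^((-1)^(n-1)), and
   alpha ord0 is the only one that is a p-adic unit. *)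
Definition is_unit_root_of {R : realType} {C : closedFieldType} (v : C -> R)
    (iota : algC -> C) (n : nat) (L : nat -> algC) (a : algC) : Prop :=
  exists alpha : 'I_n.+1 -> algC,
    let P := ps_of_poly (\prod_(i < n.+1) (1 - alpha i *: 'X)) in
    [/\ forall i, alpha i != 0,
        if odd n then L =1 P else ps_mul L P =1 ps_of_poly 1,
        forall i, (v (iota (alpha i)) == 1) = (i == ord0)
      & alpha ord0 = a].

Definition is_kloosterman_unit_root {R : realType} {C : closedFieldType}
    (v : C -> R) (iota : algC -> C) (p : nat) (pr_p : prime p)
    (Psi : 'F_p -> algC) (n : nat) (f : {poly 'F_p}) (hf : closed_point_Gm f)
    (a : algC) : Prop :=
  is_unit_root_of v iota n
    (L_kloosterman Psi n (residue_field_pchar pr_p hf) (point_coord hf)) a.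

(* L(U_n^(⊗k), T) for the family alpha0 of unit roots *)
Definition L_unit_root {C : closedFieldType} (iota : algC -> C) (p : nat)
    (alpha0 : {poly 'F_p} -> algC) (k : int) : nat -> C :=
  euler_product_Gm (fun f => iota (alpha0 f ^ k)).

(* Main.v *)
(** Dwork's splitting function theta lifts Psi to a power series with good
    p-adic decay, and his trace formula turns each Kloosterman sum into a trace
    of products of a Frobenius matrix A(y) with entries analytic in the
    Teichmuller representative of the parameter.  For a positive integer k, the
    k-th power sum of the eigenvalues of A is, by Newton-Girard,
    \sum_(i <= k) (-1)^(i-1) i e_i h_(k-i), i.e. a combination of traces of
    Sym^(k-i) A (x) Lambda^i A.  Summing over the points y and applying the trace
    formula once more, the L-function of the k-th powers becomes an alternating
    product of Fredholm determinants, whose coefficients are bounded uniformly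
    in k because high weights contribute high powers of p.
    Following Wan, let k_s tend to infinity while tending p-adically to k: the
    k_s-th powers of the non-unit roots die, those of the unit root (which is 1
    modulo the maximal ideal) tend to alpha_0^k, the determinants converge to
    entire functions, and L(U_n^k, T) is the quotient of the limits. *)

From HB Require Import structures.
Require Import Defs.
From mathcomp Require Import all_boot all_order all_algebra all_field.
From mathcomp Require Import all_fingroup all_solvable.
From mathcomp Require Import zify ring lra.
From mathcomp Require Import boolp.

Set Implicit Arguments.
Unset Strict Implicit.
Unset Printing Implicit Defensive.

Import Order.TTheory GRing.Theory Num.Theory.
Local Open Scope ring_scope.

(** * Exponentials of power series *)

(** The splitting function is cut off at degree [K], so every operator is a finite matrix and both
    uses of the trace formula are exact; only the comparison with character values costs an error,
    [rho ^+ K / v p%:R]. The price is a double limit: the depth [K] is chosen anew for each exponent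
    k_s. Entireness needs bounds uniform in [K] and in k although Sym^(k-i) grows. Matrix indices
    carry weights and a single index has weight zero; hence the number of sorted words of weight at
    most t is bounded independently of their length, and exterior words longer than t + 1 all have
    larger weight. The trace formula on the n-torus divides traces by (q^r - 1)^n, so the limiting
    spectrum of A(y) consists of the roots times powers of q, and alpha_0 stays its only unit. On
    the parameter torus the factor p^m - 1 turns a determinant D(T) into the quotient of D(T) and
    D(pT). Identities between Euler products, exponentials and determinants are all checked on
    logarithmic derivatives, that is on power sums and traces, modulo a power of T. *)

Section LogDerivative.
Context {F : fieldType}.
Implicit Types (f g u w : nat -> F) (P Q : {poly F}).

(* [f] agrees up to degree [N] with exp (\sum_i u_i T^i / i). *)
Definition logder (N : nat) (u f : nat -> F) : Prop :=
  f 0%N = 1 /\ forall M, (M < N)%N ->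
    f M.+1 *+ M.+1 = \sum_(i < M.+1) u i.+1 * f (M - i)%N.

Definition ldser (u : nat -> F) : nat -> F := ps_exp (fun i => u i / i%:R).

Lemma eq_logder N u w f g : (forall i, (0 < i <= N)%N -> u i = w i) ->
  (forall i, (i <= N)%N -> f i = g i) -> logder N u f -> logder N w g.
Proof.
move=> uw fg [f0 fN]; split=> [|M MN]; first by rewrite -fg.
rewrite -fg // fN //; apply: eq_bigr => i _.
by rewrite uw ?fg // ?(leq_trans (leq_subr _ _)) ?(leq_trans (ltn_ord i)) // ltnW.
Qed.

Lemma logder_poly N u P : logder N u (fun i => P`_i) <->
  P`_0 = 1 /\ forall M, (M < N)%N ->
    P^`()`_M = ((\poly_(i < N) u i.+1) * P)`_M.
Proof.
have E M : (M < N)%N -> ((\poly_(i < N) u i.+1) * P)`_M =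
    \sum_(i < M.+1) u i.+1 * P`_(M - i).
  move=> MN; rewrite coefM; apply: eq_bigr => i _.
  by rewrite coef_poly (leq_trans (ltn_ord i)).
by split=> -[P0 PN]; split=> // M MN; have := PN M MN; rewrite coef_deriv E.
Qed.

Lemma logderM N u w P Q : logder N u (fun i => P`_i) ->
  logder N w (fun i => Q`_i) ->
  logder N (fun i => u i + w i) (fun i => (P * Q)`_i).
Proof.
move=> /logder_poly[P0 PN] /logder_poly[Q0 QN]; apply/logder_poly; split.
  by rewrite coefM big_ord1 P0 Q0 mulr1.
move=> M MN; rewrite derivM coefD.
have -> : (\poly_(i < N) (u i.+1 + w i.+1)) =
    (\poly_(i < N) u i.+1) + (\poly_(i < N) w i.+1).
  by apply/polyP => i; rewrite coefD !coef_poly; case: ifP; rewrite ?addr0.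
rewrite mulrDl coefD; congr (_ + _).
  rewrite mulrA !coefM; apply: eq_bigr => i _; rewrite PN //.
  by apply: leq_trans MN; apply: ltn_ord.
rewrite mulrCA !coefM; apply: eq_bigr => i _; rewrite QN //.
by apply: leq_ltn_trans MN; apply: leq_subr.
Qed.

Lemma logder1 N : logder N (fun _ => 0) (fun i => (1 : {poly F})`_i).
Proof.
split=> [|M _]; rewrite coef1 ?eqxx // mul0rn big1 // => i _.
by rewrite mul0r.
Qed.

Lemma logder_prod N (I : Type) (r : seq I) (C : pred I) (u : I -> nat -> F)
    (P : I -> {poly F}) :
  (forall i, C i -> logder N (u i) (fun j => (P i)`_j)) ->
  logder N (fun j => \sum_(i <- r | C i) u i j)
    (fun j => (\prod_(i <- r | C i) P i)`_j).
Proof.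
move=> H; elim: r => [|i r IH].
  by apply: eq_logder (logder1 N) => j; rewrite !big_nil.
case Ci: (C i); last first.
  by apply: eq_logder IH => j _; rewrite !big_cons Ci.
by apply: eq_logder (logderM (H i Ci) IH) => j _; rewrite !big_cons Ci.
Qed.

Lemma logder_prodT N (I : finType) (u : I -> nat -> F) (P : I -> {poly F}) :
  (forall i, logder N (u i) (fun j => (P i)`_j)) ->
  logder N (fun j => \sum_i u i j) (fun j => (\prod_i P i)`_j).
Proof. by move=> H; apply: logder_prod. Qed.

Lemma logderX N u P n : logder N u (fun i => P`_i) ->
  logder N (fun i => u i *+ n) (fun i => (P ^+ n)`_i).
Proof.
move=> H; apply: eq_logder (@logder_prod N _ (iota 0 n) xpredT (fun=> u) (fun=> P) _).
- by move=> i _; rewrite big_const_seq count_predT size_iota iter_addr_0.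
- by move=> i _; rewrite big_const_seq count_predT size_iota iter_mulr_1.
- by [].
Qed.

Lemma logder_sub1X N (a : F) :
  logder N (fun i => - a ^+ i) (fun i => (1 - a *: 'X)`_i).
Proof.
split=> [|M _]; first by rewrite coefB coef1 coefZ coefX mulr0 subr0.
have E j : (1 - a *: 'X : {poly F})`_j = (j == 0%N)%:R - a *+ (j == 1%N).
  by rewrite coefB coef1 coefZ coefX mulr_natr.
case: M => [|M].
  by rewrite big_ord1 !E !mulr1n mulr0n sub0r subr0 expr1 mulr1.
rewrite E mulr0n subr0 mul0rn big_ord_recr big_ord_recr /= big1 ?add0r => [|i _].
  by rewrite !E subnn subSnn !mulr0n !mulr1n subr0 mulr1 sub0r mulrNN -exprSr subrr.
have iM : (i <= M)%N by apply: ltnW.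
by rewrite E !subSn // eqSS subn_eq0 leqNgt ltn_ord mulr0n subr0 mulr0.
Qed.

Lemma logder_geom N (a : F) : logder N (fun i => a ^+ i) (fun i => a ^+ i).
Proof.
split=> // M _; rewrite (eq_bigr (fun _ => a ^+ M.+1)).
  by rewrite sumr_const card_ord.
by move=> i _; rewrite -exprD addSn subnKC // -ltnS.
Qed.

Lemma logder_scale N u f (c : F) : logder N u f ->
  logder N (fun i => c ^+ i * u i) (fun i => c ^+ i * f i).
Proof.
move=> [f0 fN]; split=> [|M MN]; first by rewrite mul1r.
rewrite -mulrnAr fN // mulr_sumr; apply: eq_bigr => i _.
by rewrite mulrACA -exprD addSn subnKC // -ltnS.
Qed.

Hypothesis char0 : forall n, n.+1%:R != 0 :> F.

Lemma logder_uniq N u f g : logder N u f -> logder N u g ->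
  forall i, (i <= N)%N -> f i = g i.
Proof.
move=> [f0 fN] [g0 gN]; elim/ltn_ind => -[_ _|M IH MN]; first by rewrite f0.
apply: (mulIf (char0 M)); rewrite !mulr_natr fN // gN //.
apply: eq_bigr => i _; rewrite IH // ?ltnS ?leq_subr //.
by apply: leq_trans (ltnW MN); apply: leq_subr.
Qed.

Lemma ldserP N u : logder N u (ldser u).
Proof.
pose U M := (\sum_(1 <= i < M.+1) (u i / i%:R) *: 'X^i : {poly F}).
have UE M j : (U M)`_j = if (0 < j <= M)%N then u j / j%:R else 0.
  rewrite coef_sum; under eq_bigr do rewrite coefZ coefXn.
  case: ifP => [/andP[j0 jM]|/negP jM].
    rewrite (big_rem j) /=; last by rewrite mem_index_iota j0.
    rewrite eqxx mulr1 big_seq big1 ?addr0 // => i.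
    rewrite mem_rem_uniq ?iota_uniq // inE => /andP[ij _].
    by rewrite (eq_sym j) (negPf ij) mulr0.
  rewrite big_seq big1 // => i; rewrite mem_index_iota => ij.
  by case: eqVneq jM => [->|]; rewrite ?mulr0.
pose E M := (\sum_(j < M.+1) j`!%:R^-1 *: U M ^+ j : {poly F}).
have ldE M : ldser u M = (E M)`_M by [].
have U0 M : exists V, U M = V * 'X.
  exists (\poly_(i < M) (U M)`_i.+1); apply/polyP => j; rewrite coefMX coef_poly.
  case: j => [|j]; first by rewrite UE.
  by rewrite /=; case: ltnP => // jM; rewrite UE /= ltnNge jM.
have low M K j : (j < M)%N -> (U K ^+ M)`_j = 0.
  by move=> jM; have [V ->] := U0 K; rewrite exprMn coefMXn jM.
have stab M j : (j <= M)%N -> (E M)`_j = (E j)`_j.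
  move=> jM; rewrite !coef_sum.
  rewrite [RHS](big_ord_widen M.+1 (fun i => (i`!%:R^-1 *: U j ^+ i)`_j)) //.
  rewrite [RHS]big_mkcond /=; apply: eq_bigr => i _; rewrite ltnS.
  case: ifP => [ij|/negbT]; last first.
    by rewrite -ltnNge => ji; rewrite coefZ low ?mulr0.
  rewrite !coefZ; congr (_ * _).
  have eqU : forall l, (l <= j)%N -> (U M)`_l = (U j)`_l.
    by move=> l lj; rewrite !UE lj (leq_trans lj jM).
  suff: forall k l, (l <= j)%N -> (U M ^+ k)`_l = (U j ^+ k)`_l by apply.
  elim=> [|k IH] l lj; first by rewrite !expr0.
  rewrite !exprS !coefM; apply: eq_bigr => a _.
  have al : (a <= l)%N by rewrite -ltnS.
  by rewrite eqU ?IH ?(leq_trans _ lj) ?leq_subr.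
(* Differentiating the truncated exponential loses its last term, a multiple of T^(M+1), which does
   not reach the coefficient of T^M. *)
have derE M : (E M.+1)^`() = (U M.+1)^`() * (E M.+1 - (M.+1)`!%:R^-1 *: U M.+1 ^+ M.+1).
  rewrite /E [in RHS]big_ord_recr /= addrK raddf_sum big_ord_recl /=.
  rewrite expr0 derivZ derivC scaler0 add0r mulr_sumr; apply: eq_bigr => i _.
  rewrite /bump leq0n add1n derivZ deriv_exp /= -scalerAr -scaler_nat scalerA.
  by rewrite mulrC [(i.+1)`!]factS natrM invfM mulrA mulfV // mul1r.
split=> [|M MN].
  by rewrite ldE /E big_ord1 fact0 invr1 scale1r expr0 coef1.
rewrite ldE -coef_deriv derE mulrBr coefB -scalerAr coefZ.
rewrite [X in _ - X](_ : _ = 0) ?subr0.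
  rewrite coefM; apply: eq_bigr => i _; rewrite coef_deriv UE /=.
  by rewrite ltn_ord ldE stab ?leqW ?leq_subr // -[X in X * _]mulr_natr mulfVK.
rewrite coefM big1 ?mulr0 // => i _; rewrite low ?mulr0 // ltnS leq_subr //.
Qed.

Lemma ldser_eq N u f : logder N u f -> forall i, (i <= N)%N -> f i = ldser u i.
Proof. by move=> H; apply: logder_uniq H (ldserP N u). Qed.

Lemma eq_ldser N u w : (forall i, (0 < i <= N)%N -> u i = w i) ->
  ldser u N = ldser w N.
Proof.
by move=> uw; apply: (@ldser_eq N) => //; apply: eq_logder (ldserP N u).
Qed.

Lemma ldser_mul u w N :
  ldser (fun i => u i + w i) N = ps_mul (ldser u) (ldser w) N.
Proof.
pose T f := \poly_(i < N.+1) (f i : F).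
have TE f i : (i <= N)%N -> (T f)`_i = f i by rewrite coef_poly ltnS => ->.
have HT w' : logder N w' (fun i => (T (ldser w'))`_i).
  by apply: eq_logder (ldserP N w') => // i /TE ->.
have H := ldser_eq (logderM (HT u) (HT w)).
rewrite -H // coefM /ps_mul; apply: eq_bigr => i _.
by rewrite !TE ?leq_subr // -ltnS.
Qed.

Lemma ldser0 N : ldser (fun=> 0) N = (N == 0%N)%:R.
Proof. by rewrite -(ldser_eq (logder1 N)) // coef1. Qed.

(** With E = exp(- \sum u_j T^j / j) and H its inverse, the identity says T E' H = - \sum u_j T^j.
    When u lists power sums, E and H generate the signed elementary and the complete symmetric
    functions. *)
Lemma newton_girard u k : (0 < k)%N ->
  u k = - \sum_(i < k.+1) ldser (fun j => - u j) i *+ i * ldser u (k - i)%N.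
Proof.
case: k => // k _; rewrite big_ord_recl mulr0n mul0r add0r.
set E := ldser (fun j => - u j).
under eq_bigr => i _.
  rewrite lift0 subSS (ldserP i.+1 _).2 // mulr_suml.
  under eq_bigr do rewrite mulNr.
over.
have EH M : \sum_(i < M.+1) E i * ldser u (M - i)%N = (M == 0%N)%:R.
  rewrite -ldser0 (@eq_ldser M _ (fun j => - u j + u j)) ?ldser_mul //.
  by move=> i _; rewrite addNr.
rewrite (eq_bigr (fun i : 'I_k.+1 => \sum_(j < k.+1 | (j <= i)%N)
    - (u j.+1 * (E (i - j)%N * ldser u (k - i)%N)))); last first.
  move=> i _; rewrite (big_ord_widen k.+1
   (fun j => - (u j.+1 * E (i - j)%N) * ldser u (k - i)%N)) //=.
  by apply: eq_big => // j _; rewrite mulNr mulrA.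
rewrite (exchange_big_dep xpredT) //=.
rewrite (eq_bigr (fun j : 'I_k.+1 => - (u j.+1 * (j == k :> nat)%:R))).
  rewrite sumrN opprK big_ord_recr /= eqxx mulr1 big1 ?add0r // => i _.
  by rewrite ltn_eqF ?mulr0 //; apply: ltn_ord.
move=> j _; rewrite sumrN -mulr_sumr; congr (- (_ * _)).
have jk : (j <= k)%N by rewrite -ltnS.
have -> : (j == k :> nat) = (k - j == 0)%N by rewrite subn_eq0 eqn_leq jk.
rewrite -EH.
pose G (i : nat) := E (i - j)%N * ldser u (k - i)%N.
transitivity (\sum_(j <= i < k.+1) G i).
  rewrite big_geq_mkord /=; exact: eq_bigr.
rewrite -{1}[nat_of_ord j]add0n big_addn big_mkord subSn //.
by apply: eq_bigr => i _; rewrite /G addnK addnC subnDA.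
Qed.

Lemma ldser_scale u (c : F) N :
  ldser (fun i => c ^+ i * u i) N = c ^+ N * ldser u N.
Proof. by rewrite -(ldser_eq (logder_scale c (ldserP N u)) (leqnn N)). Qed.

End LogDerivative.

(** * Symmetric and exterior powers of a matrix *)

Section Words.
Variables (N j : nat).
Implicit Types (w s t : j.-tuple 'I_N) (g : 'S_j).

Definition ole : rel 'I_N := fun x y => (x <= y)%N.
Lemma ole_total : total ole. Proof. by move=> x y; apply: leq_total. Qed.
Lemma ole_trans : transitive ole. Proof. by move=> x y z; apply: leq_trans. Qed.
Lemma ole_anti : antisymmetric ole.
Proof. by move=> x y /anti_leq /val_inj. Qed.

Definition wsort w : j.-tuple 'I_N := [tuple of sort ole w].
Definition wact w g : j.-tuple 'I_N := [tuple tnth w (g l) | l < j].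

Lemma wactE w g l : tnth (wact w g) l = tnth w (g l).
Proof. by rewrite tnth_mktuple. Qed.

Lemma wact_perm w g : perm_eq (wact w g) w.
Proof.
by apply/tuple_permP; exists g; congr val; apply: eq_from_tnth => l;
  rewrite !tnth_mktuple.
Qed.

Lemma wact_bij g : bijective (wact ^~ g).
Proof.
exists (wact ^~ g^-1%g) => w; apply: eq_from_tnth => l; rewrite !wactE.
  by rewrite permKV.
by rewrite permK.
Qed.

Lemma wsort_eq w s : (wsort w == wsort s) = perm_eq w s.
Proof.
by rewrite -val_eqE; apply/eqP/idP => /(perm_sortP ole_total ole_trans ole_anti).
Qed.

Lemma wsort_act w g : wsort (wact w g) = wsort w.
Proof. by apply/eqP; rewrite wsort_eq wact_perm. Qed.

Lemma wsort_sorted w : sorted ole (wsort w).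
Proof. exact: sort_sorted ole_total _. Qed.

Lemma wsort_id s : sorted ole s -> wsort s = s.
Proof. by move=> ss; apply/val_inj; rewrite /= (sorted_sort ole_trans ss). Qed.

Lemma wsort_perm w : perm_eq (wsort w) w.
Proof. by rewrite /= perm_sort. Qed.

Lemma wsortP w : exists g, w = wact (wsort w) g.
Proof.
have /tuple_permP[g E] : perm_eq w (wsort w) by rewrite perm_sym wsort_perm.
by exists g; apply/val_inj; rewrite [LHS]E.
Qed.

(** The sign of the Vandermonde determinant of the letters: the sign of the permutation that sorts
    w, or 0 if a letter repeats. Through the determinant, the behaviour under permutations is
    multiplicativity. *)
Definition vsgn w : int :=
  Num.sg (\det (\matrix_(l < j, m < j) ((tnth w l : nat)%:Z ^+ m))).

Lemma vsgn_act w g : vsgn (wact w g) = (-1) ^+ g * vsgn w.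
Proof.
rewrite /vsgn -[X in X * _](_ : Num.sg ((-1) ^+ g) = _); last first.
  by rewrite sgrX sgrN1.
rewrite -sgrM -det_perm -det_mulmx.
rewrite -row_permE; congr (Num.sg (\det _)).
by apply/matrixP => a b; rewrite !mxE wactE.
Qed.

Lemma vsgn_prod w : vsgn w = Num.sg (\prod_(l < j) \prod_(m < j | (l < m)%N)
   ((tnth w m : nat)%:Z - (tnth w l : nat)%:Z)).
Proof.
rewrite /vsgn -det_tr; congr (Num.sg _).
have := det_Vandermonde (\row_(l < j) (tnth w l : nat)%:Z).
under [X in _ = X -> _]eq_bigr do under eq_bigr do rewrite !mxE.
move=> <-; congr (\det _); by apply/matrixP => a b; rewrite !mxE.
Qed.

Lemma nuniqP w : ~~ uniq w -> exists l m, l != m /\ tnth w l = tnth w m.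
Proof.
move=> nu; have /injectivePn[l [m lm E]] : ~~ injectiveb (tnth w).
  by apply: contra nu => /injectiveP/tuple_uniqP.
by exists l, m.
Qed.

Lemma vsgn_sorted s : sorted ole s -> uniq s -> vsgn s = 1.
Proof.
move=> ss us; apply/eqP; rewrite vsgn_prod sgr_cp0.
apply: prodr_gt0 => l _; apply: prodr_gt0 => m lm; rewrite subr_gt0 ltz_nat.
have sl : sorted ltn (map val s).
  by rewrite ltn_sorted_uniq_leq map_inj_uniq ?us ?sorted_map //; apply: val_inj.
have := sorted_ltn_nth ltn_trans 0%N sl.
rewrite /prop_in2 => /(_ l m); rewrite !inE size_map size_tuple !ltn_ord.
move=> /(_ isT isT lm); rewrite !(nth_map (tnth_default s l)) ?size_tuple //.
by rewrite -!tnth_nth.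
Qed.

Variable e : bool.
(** The boolean [e] selects the functor: [false] for symmetric powers, [true] for exterior
    powers. *)
Definition wsgn (K : pzRingType) w : K := if e then (vsgn w)%:~R else 1.
Definition psgn (K : pzRingType) g : K := if e then (-1) ^+ g else 1.
Definition wgood s := sorted ole s && (e ==> uniq s).
Definition widx := {s : j.-tuple 'I_N | wgood s}.

Section Functor.
Variable K : idomainType.
Hypothesis two_neq0 : 2%:R != 0 :> K.
Implicit Types A B : 'M[K]_N.

Lemma wsgn_act w g : wsgn K (wact w g) = psgn K g * wsgn K w.
Proof.
rewrite /wsgn /psgn; case: e; rewrite ?mulr1 // vsgn_act rmorphM /=.
by rewrite rmorphXn /= rmorphN1.
Qed.

Lemma wsgn_good s : wgood s -> wsgn K s = 1.
Proof.
by rewrite /wgood /wsgn; case: e => // /andP[H1 H2]; rewrite vsgn_sorted.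
Qed.

(** The entry of Sym^j A or Lambda^j A at the basis words s and t: expanding the product of the rows
    s_l, all words with the letters of t are collected with their signs. It makes sense for
    arbitrary words, which composition needs. *)
Definition wkerf A s t : K :=
  \sum_(w | wsort w == t) wsgn K w * \prod_l A (tnth s l) (tnth w l).

Lemma wkerf_act A s t g : wkerf A (wact s g) t = psgn K g * wkerf A s t.
Proof.
rewrite /wkerf mulr_sumr (reindex _ (onW_bij _ (wact_bij g))) /=.
apply: eq_big => [w|w _]; first by rewrite wsort_act.
rewrite wsgn_act mulrA; congr (_ * _).
rewrite [RHS](reindex_inj (@perm_inj _ g)); apply: eq_bigr => l _.
by rewrite !wactE.
Qed.

(** Exchanging two positions that hold the same letter fixes s and changes the sign, so the value is
    its own opposite. *)
Lemma wkerf_bad A s t : e -> ~~ uniq s -> wkerf A s t = 0.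
Proof.
move=> He nu.
have [l [m [lm E]]] := nuniqP nu.
have Es : wact s (tperm l m) = s.
  apply: eq_from_tnth => a; rewrite wactE; case: tpermP => [->|->|] //.
have := wkerf_act A s t (tperm l m).
rewrite Es /psgn He odd_tperm lm expr1 mulN1r => /eqP.
by rewrite -addr_eq0 -mulr2n -mulr_natl mulf_eq0 (negPf two_neq0) => /eqP.
Qed.

Lemma sum_widx (G : j.-tuple 'I_N -> K) :
  (forall s : j.-tuple 'I_N, sorted ole s -> ~~ wgood s -> G s = 0) ->
  \sum_(s : j.-tuple 'I_N | sorted ole s) G s = \sum_(s : widx) G (val s).
Proof.
move=> H; rewrite (bigID wgood) /= [X in _ + X]big1 ?addr0; last first.
  by move=> s /andP[]; apply: H.
rewrite (reindex_omap (val : widx -> _) insub) /= => [|s /andP[_ gs]]; last first.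
  by rewrite insubT.
by apply: eq_bigl => s; rewrite valK eqxx andbT andbC; case: s => s /= gs;
  rewrite gs; case/andP: gs.
Qed.

(** Functoriality. Intermediate words w are grouped by their sorted form t: permuting w into t
    multiplies [wsgn] and [wkerf B] by the same sign, and in the exterior case the classes with a
    repeated letter contribute zero. *)
Lemma wkerfM A B s r :
  \sum_(t : widx) wkerf A s (val t) * wkerf B (val t) r = wkerf (A *m B) s r.
Proof.
rewrite -(sum_widx (G := fun t => wkerf A s t * wkerf B t r)); last first.
  move=> t st; rewrite /wgood st /=; case He: e => // nu.
  by rewrite (@wkerf_bad B t r) ?mulr0 ?He.
transitivity (\sum_w (\prod_l A (tnth s l) (tnth w l)) * wkerf B w r).
  rewrite [RHS](partition_big wsort (sorted ole)) /= => [|w _]; last first.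
    exact: wsort_sorted.
  apply: eq_bigr => t st; rewrite mulr_suml; apply: eq_bigr => w /eqP wt.
  have [g wE] := wsortP w; rewrite wt in wE.
  rewrite [wsgn K w * _]mulrC -mulrA; congr (_ * _).
  rewrite {1 2}wE wkerf_act wsgn_act.
  have [gt|/negPf bt] := boolP (wgood t); first by rewrite wsgn_good // mulr1.
  have [He nu] : e /\ ~~ uniq t.
    by move: bt; rewrite /wgood st /=; case: e => //= ->.
  by rewrite wkerf_bad // !mulr0.
under eq_bigr => w _ do rewrite /wkerf mulr_sumr.
rewrite exchange_big /=; apply: eq_bigr => x _.
under eq_bigr => w _ do rewrite mulrCA -big_split /=.
rewrite -mulr_sumr; congr (_ * _).
under [RHS]eq_bigr => l _ do rewrite mxE.
rewrite bigA_distr_bigA /=.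
rewrite (reindex (fun f : {ffun 'I_j -> 'I_N} => [tuple f l | l < j])) /=.
  by apply: eq_bigr => f _; apply: eq_bigr => l _; rewrite tnth_mktuple.
exists (fun w => [ffun l => tnth w l]) => [f _|w _].
  by apply/ffunP => l; rewrite ffunE tnth_mktuple.
by apply: eq_from_tnth => l; rewrite tnth_mktuple ffunE.
Qed.

Lemma wkerf1 (s t : widx) : wkerf 1%:M (val s) (val t) = (s == t)%:R.
Proof.
rewrite /wkerf (bigID (pred1 (val s))) /= [X in _ + X]big1 ?addr0.
  rewrite (eq_bigl (fun w => (w == val s) && (s == t))).
    case: (s == t); last by rewrite big_pred0 // => w; rewrite andbF.
    rewrite (big_pred1 (val s)) => [|w]; last by rewrite andbT.
    rewrite (wsgn_good (valP s)) mul1r big1 // => l _.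
    by rewrite mxE eqxx.
  move=> w /=; rewrite andbC; case: eqVneq => [->|] //=.
  by have /andP[ss _] := valP s; rewrite wsort_id.
move=> w /andP[_ ws]; have [l ne] : exists l, tnth (val s) l != tnth w l.
  apply/existsP; rewrite -negb_forall; apply: contraNN ws => /forallP H.
  by apply/eqP/eq_from_tnth => l; apply/eqP; rewrite eq_sym H.
by rewrite (bigD1 l) //= mxE (negPf ne) mul0r mulr0.
Qed.

Definition wmx A : 'M[K]_#|{: widx}| :=
  \matrix_(a, b) wkerf A (val (enum_val a)) (val (enum_val b)).

Lemma wmxM A B : wmx (A *m B) = wmx A *m wmx B.
Proof.
apply/matrixP => a b; rewrite !mxE -wkerfM.
rewrite (reindex (@enum_val widx predT)) /=; last exact/onW_bij/enum_val_bij.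
by apply: eq_bigr => i _; rewrite !mxE.
Qed.

Lemma wmx1 : wmx 1%:M = 1%:M.
Proof.
by apply/matrixP => a b; rewrite !mxE wkerf1 (inj_eq enum_val_inj).
Qed.

Lemma tr_wmx A : \tr (wmx A) = \sum_(s : widx) wkerf A (val s) (val s).
Proof.
rewrite /mxtrace [RHS](reindex (@enum_val widx predT)) /=; last exact/onW_bij/enum_val_bij.
by apply: eq_bigr => i _; rewrite mxE.
Qed.

(** A word w contributes only if no factor vanishes, which for triangular A forces w_l <= s_l at
    every position; since w permutes s, the sums of letters agree and w = s. *)
Lemma wkerf_trig A (s : widx) : is_trig_mx A ->
  wkerf A (val s) (val s) = \prod_l A (tnth (val s) l) (tnth (val s) l).
Proof.
move=> /is_trig_mxP trA; have /andP[ss _] := valP s.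
rewrite /wkerf (bigD1 (val s)) /=; last by rewrite wsort_id.
rewrite (wsgn_good (valP s)) mul1r [X in _ + X]big1 ?addr0 // => w /andP[/eqP ws wns].
apply/eqP; rewrite mulf_eq0; apply/orP; right; apply/negPn/negP => /prodf_neq0 H.
have le l : (tnth w l <= tnth (val s) l)%N.
  rewrite leqNgt; apply/negP => lt; have := H l isT.
  by rewrite (trA _ _ lt) eqxx.
have sumE : (\sum_l tnth w l = \sum_l tnth (val s) l)%N.
  rewrite -(big_tuple _ _ w xpredT (fun x : 'I_N => x : nat)).
  rewrite -(big_tuple _ _ (val s) xpredT (fun x : 'I_N => x : nat)).
  by apply: perm_big; rewrite -wsort_eq ws wsort_id.
move/eqP: wns; apply; apply: eq_from_tnth => l; apply: val_inj => /=.
apply/eqP; rewrite eqn_leq le /= -subn_eq0; apply/eqP.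
have /eqP := @sumnB _ (index_enum _) xpredT _ _ (fun l _ => le l).
by rewrite sumE subnn sum_nat_eq0 => /forallP/(_ l)/eqP.
Qed.

End Functor.
End Words.

Lemma prod_count (K : comPzRingType) (T : finType) (d : T -> K) (s : seq T) :
  \prod_(x <- s) d x = \prod_x d x ^+ count_mem x s.
Proof.
elim: s => [|y s IH]; first by rewrite big_nil big1 // => x _; rewrite expr0.
rewrite big_cons IH [RHS](bigD1 y) //= [in LHS](bigD1 y) //= eqxx exprS mulrA.
by congr (_ * _); apply: eq_bigr => x xy; rewrite eq_sym (negPf xy) add0n.
Qed.

Lemma perm_count (T : eqType) (s t : seq T) :
  (forall x, count_mem x s = count_mem x t) -> perm_eq s t.
Proof. by move=> H; apply/allP => x _ /=; rewrite H. Qed.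

Lemma sum_count_mem (T : finType) (s : seq T) : (\sum_x count_mem x s = size s)%N.
Proof.
elim: s => [|y s IH] /=; first by rewrite big1.
by rewrite big_split IH /= (bigD1 y) //= eqxx big1 // => x; rewrite eq_sym => /negPf->.
Qed.

(** A sorted word amounts to the multiplicities of its letters: they add up to j and are at most 1
    in the exterior case. *)
Lemma sum_widx_gen (K : comNzRingType) N j e (d : 'I_N -> K) :
  \sum_(s : widx N j e) \prod_l d (tnth (val s) l) =
  (\prod_(i < N) \sum_(a < (if e then 1 else j).+1) (d i) ^+ a *: 'X^a)`_j.
Proof.
set b := (if e then _ else _).
have be : e -> b = 1%N by rewrite /b => ->.
have bne : ~~ e -> b = j by rewrite /b => /negPf ->.
rewrite bigA_distr_bigA coef_sum /=.
have -> : \sum_(f : {ffun 'I_N -> 'I_b.+1}) (\prod_i ((d i) ^+ f i *: 'X^(f i)))`_j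
   = \sum_(f : {ffun 'I_N -> 'I_b.+1} | (\sum_i f i == j)%N) \prod_i d i ^+ f i.
  rewrite [RHS]big_mkcond; apply: eq_bigr => f _.
  rewrite scaler_prod prodrXr coefZ coefXn eq_sym.
  by case: eqP; rewrite ?mulr1 ?mulr0.
pose phi (s : widx N j e) : {ffun 'I_N -> 'I_b.+1} :=
  [ffun i => inord (count_mem i (val s))].
have phiE s i : phi s i = count_mem i (val s) :> nat.
  rewrite ffunE inordK // ltnS.
  have [He|He] := orP (orbN e).
    by have /andP[_ /implyP us] := valP s; rewrite (be He) count_uniq_mem ?us ?leq_b1.
  by rewrite (bne He) -[X in (_ <= X)%N](size_tuple (val s)) count_size.
have phi_inj : injective phi.
  move=> s t E; apply: val_inj; apply: val_inj.
  have /andP[ss _] := valP s; have /andP[st _] := valP t.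
  apply: (sorted_eq (@ole_trans N) (@ole_anti N) ss st).
  by apply: perm_count => i; rewrite -!phiE E.
transitivity (\sum_(s : widx N j e) \prod_i d i ^+ phi s i).
  apply: eq_bigr => s _; rewrite -(big_tuple _ _ (val s) xpredT d) prod_count.
  by apply: eq_bigr => i _; rewrite phiE.
transitivity (\sum_(f in phi @: [set: widx N j e]) \prod_i d i ^+ f i).
  rewrite big_imset /=; last by move=> x y _ _; apply: phi_inj.
  by apply: eq_bigl => s; rewrite inE.
apply: eq_bigl => f; apply/imsetP/eqP => [[s _ ->]|sf].
  under eq_bigr do rewrite phiE.
  by rewrite sum_count_mem size_tuple.
pose w := sort (@ole N) (flatten [seq nseq (f i) i | i <- enum 'I_N]).
have cw i : count_mem i w = f i.
  rewrite /w count_sort count_flatten -map_comp sumnE big_map big_enum /=.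
  rewrite (bigD1 i) //= count_nseq /= eqxx mul1n big1 ?addn0 // => l li.
  by rewrite count_nseq /= (negPf li).
have sw : size w == j.
  rewrite /w size_sort size_flatten /shape -map_comp sumnE big_map big_enum /=.
  by rewrite -sf; apply/eqP; apply: eq_bigr => i _; rewrite size_nseq.
have gw : wgood e (Tuple sw).
  rewrite /wgood; apply/andP; split; first exact: sort_sorted (@ole_total N) _.
  apply/implyP => He; apply: count_mem_uniq => i.
  have f1 : (f i <= 1)%N by rewrite -(be He) -ltnS.
  by rewrite -has_pred1 has_count cw; case: (f i : nat) f1 => [|[]].
exists (exist _ (Tuple sw) gw) => //; apply/ffunP => i; apply: val_inj.
exact: etrans (esym (cw i)) (esym (phiE (exist _ (Tuple sw) gw) i)).
Qed.

(** * Traces of symmetric and exterior powers by triangularisation *)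

Section Trigonal.
Variable C : closedFieldType.

(** Induction on n: a row eigenvector is completed to a basis by [row_ebase], so the first row of
    the conjugate is a multiple of the first unit vector, and the remaining block is treated by
    induction. *)
Lemma trigonalize n (A : 'M[C]_n) :
  exists P R : 'M[C]_n, [/\ P *m R = 1%:M, R *m P = 1%:M & is_trig_mx (P *m A *m R)].
Proof.
elim: n A => [|n IH] A.
  by exists 1%:M, 1%:M; rewrite mulmx1; split=> //; apply/is_trig_mxP => -[].
have [a] : exists a, root (char_poly A) a.
  by apply/closed_rootP; rewrite size_char_poly.
rewrite -eigenvalue_root_char => /eigenvalueP[v vA vn0].
set Q := row_ebase v; have uQ : Q \in unitmx := row_ebase_unit v.
pose B : 'M[C]_(1 + n) := Q *m A *m invmx Q.
have [c cn0 vE] : exists2 c, c != 0 & v = c *: row 0 Q.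
  exists (col_ebase v 0 0).
    have := col_ebase_unit v; rewrite unitmxE det_mx11.
    by apply: contraTneq => ->; rewrite unitr0.
  rewrite -{1}(mulmx_ebase v) rank_rV vn0 [col_ebase v]mx11_scalar mul_scalar_mx.
  rewrite -scalemxAl; congr (_ *: _); first by rewrite [RHS]mxE eqxx mulr1n.
  rewrite rowE; congr (_ *m _); apply/matrixP => i k; rewrite !mxE (ord1 i) eqxx /=.
  by rewrite andbT eq_sym.
have rB : row 0 B = a *: delta_mx 0 0.
  have -> : row 0 B = row 0 Q *m A *m invmx Q by rewrite !rowE !mulmxA.
  have -> : row 0 Q *m A = a *: row 0 Q.
    apply: (scalerI cn0); rewrite scalemxAl -vE vA vE scalerA mulrC -scalerA //.
  by rewrite -scalemxAl rowE -mulmxA mulmxV // mulmx1.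
have BE : B = Q *m A *m invmx Q by [].
clearbody B; have [P [S [PS SP tD]]] := IH (drsubmx B).
pose P1 : 'M[C]_(1 + n) := block_mx 1%:M 0 0 P.
pose S1 : 'M[C]_(1 + n) := block_mx 1%:M 0 0 S.
have PS1 : P1 *m S1 = 1%:M.
  by rewrite mulmx_block PS !(mul0mx, mulmx0, mulmx1, addr0, add0r) -scalar_mx_block.
exists (P1 *m Q), (invmx Q *m S1).
have E1 : P1 *m Q *m (invmx Q *m S1) = 1%:M.
  by rewrite mulmxA -(mulmxA P1) mulmxV // mulmx1.
split=> //; first exact: mulmx1C.
have -> : P1 *m Q *m A *m (invmx Q *m S1) = P1 *m B *m S1 by rewrite BE !mulmxA.
rewrite -(submxK B) !mulmx_block !(mul0mx, mulmx0, mulmx1, mul1mx, addr0, add0r).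
rewrite (is_trig_block_mx _ _ _ _ (erefl 1%N)) tD andbT.
have -> : ursubmx B = 0.
  apply/matrixP => i k; rewrite (ord1 i) !mxE.
  have := congr1 (fun M : 'rV_(1 + n) => M 0 (rshift 1 k)) rB.
  by rewrite !mxE /= mulr0 => <-; congr (B _ _); apply: val_inj.
by rewrite mul0mx eqxx /=; apply/is_trig_mxP => i k; rewrite (ord1 i) (ord1 k).
Qed.

Lemma trig_mul n (A B : 'M[C]_n) : is_trig_mx A -> is_trig_mx B ->
  is_trig_mx (A *m B) /\ forall i, (A *m B) i i = A i i * B i i.
Proof.
move=> /is_trig_mxP tA /is_trig_mxP tB; split.
  apply/is_trig_mxP => i k ik; rewrite mxE big1 // => l _.
  have [il|li] := ltnP i l; first by rewrite tA ?mul0r.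
  by rewrite tB ?mulr0 // (leq_ltn_trans li).
move=> i; rewrite mxE (bigD1 i) //= big1 ?addr0 // => l li.
have [il|il] := ltnP i l; first by rewrite tA ?mul0r.
by rewrite tB ?mulr0 // ltn_neqAle il andbT; apply: contra li => /eqP/val_inj->.
Qed.

Lemma trig_exp n (A : 'M[C]_n) r : is_trig_mx A ->
  is_trig_mx (A ^+ r) /\ forall i, (A ^+ r) i i = A i i ^+ r.
Proof.
move=> tA; elim: r => [|r [tr dr]].
  by rewrite expr0; split=> [|i]; [apply: scalar_mx_is_trig | rewrite mxE eqxx].
rewrite exprS; have [t d] := trig_mul tA tr; split=> // i.
by rewrite [LHS]d dr exprS.
Qed.

Lemma conj_exp n (A P R : 'M[C]_n) r : R *m P = 1%:M -> P *m R = 1%:M ->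
  (P *m A *m R) ^+ r = P *m A ^+ r *m R.
Proof.
move=> RP PR; elim: r => [|r IH]; first by rewrite !expr0 mulmx1 PR.
rewrite !exprS IH; change (P *m A *m R *m (P *m A ^+ r *m R) = P *m (A *m A ^+ r) *m R).
by rewrite !mulmxA -(mulmxA _ R P) RP mulmx1.
Qed.

Lemma tr_conj n (A P R : 'M[C]_n) : R *m P = 1%:M -> \tr (P *m A *m R) = \tr A.
Proof. by move=> RP; rewrite mxtrace_mulC mulmxA RP mul1mx. Qed.

(** Read off a triangular conjugate with diagonal t_i: the determinant is the product of the 1 - t_i
    X, and the trace of A^r is the sum of the t_i^r. *)
Lemma logder_det n (A : 'M[C]_n) M :
  logder M (fun r => - \tr (A ^+ r))
    (fun i => (\det (1%:M - 'X *: map_mx polyC A))`_i).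
Proof.
have [P [R [PR RP tT]]] := trigonalize A.
have {tT}[T TE tT] : exists2 T, T = P *m A *m R & is_trig_mx T.
  by exists (P *m A *m R).
have -> : \det (1%:M - 'X *: map_mx polyC A) = \prod_i (1 - T i i *: 'X).
  have -> : \prod_i (1 - T i i *: 'X) = \det (1%:M - 'X *: map_mx polyC T).
    rewrite det_trig; last first.
      apply/is_trig_mxP => i k ik; rewrite !mxE (is_trig_mxP tT) // polyC0 mulr0.
      by rewrite -val_eqE /= (ltn_eqF ik) subr0.
    by apply: eq_bigr => i _; rewrite !mxE eqxx -mul_polyC mulrC.
  have PRp : map_mx polyC P *m map_mx polyC R = 1%:M by rewrite -map_mxM PR map_mx1.
  transitivity (\det (map_mx polyC P) *
    \det (1%:M - 'X *: map_mx polyC A) * \det (map_mx polyC R)).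
    by rewrite mulrAC -det_mulmx PRp det1 mul1r.
  rewrite -!det_mulmx; congr (\det _).
  rewrite mulmxBr mulmxBl mulmx1 PRp -scalemxAr -scalemxAl TE.
  by rewrite !map_mxM.
have trE r : \tr (A ^+ r) = \sum_i T i i ^+ r.
  rewrite -(tr_conj (A ^+ r) RP) -conj_exp // -TE /mxtrace.
  by apply: eq_bigr => i _; rewrite (trig_exp r tT).2.
apply: eq_logder (logder_prodT (fun i => logder_sub1X M (T i i))) => // r _.
by rewrite trE sumrN.
Qed.

Hypothesis char0 : forall n, n.+1%:R != 0 :> C.

(** By functoriality [wmx] respects conjugation, so its trace may be computed for a triangular
    matrix, where only the diagonal enters. *)
Lemma tr_wmxE n j e (A : 'M[C]_n) :
  exists2 d : 'I_n -> C, forall r, \tr (A ^+ r) = \sum_i d i ^+ r &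
  \tr (@wmx n j e C A) =
  (\prod_(i < n) \sum_(a < (if e then 1 else j).+1) (d i) ^+ a *: 'X^a)`_j.
Proof.
have two0 : 2%:R != 0 :> C by apply: char0 1%N.
have [P [R [PR RP tT]]] := trigonalize A.
exists (fun i => (P *m A *m R) i i) => [r|].
  rewrite -(tr_conj (A ^+ r) RP) -conj_exp // /mxtrace.
  by apply: eq_bigr => i _; rewrite (trig_exp r tT).2.
have -> : \tr (@wmx n j e C A) = \tr (@wmx n j e C (P *m A *m R)).
  rewrite !wmxM // mxtrace_mulC mulmxA -wmxM // RP wmx1 // mul1mx //.
rewrite tr_wmx -sum_widx_gen; apply: eq_bigr => s _.
exact: wkerf_trig.
Qed.

Lemma tr_wmx_sym n j (A : 'M[C]_n) :
  \tr (@wmx n j false C A) = ldser (fun r => \tr (A ^+ r)) j.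
Proof.
have [d trE ->] := tr_wmxE j false A.
set q := \prod_i _.
  apply: (@ldser_eq _ char0 j _ (fun i => q`_i)) => //.
apply: (eq_logder (u := fun r => \sum_i d i ^+ r) (f := fun r => q`_r)) => //.
apply: logder_prodT => i; apply: eq_logder (logder_geom j (d i)) => // r rj.
rewrite coef_sum (bigD1 (inord r)) //= coefZ coefXn inordK // eqxx mulr1.
rewrite big1 ?addr0 // => a ar; rewrite coefZ coefXn; case: eqP => E.
  by move: ar; rewrite -val_eqE /= E inordK // eqxx.
by rewrite mulr0.
Qed.

Lemma tr_wmx_ext n j (A : 'M[C]_n) :
  (-1) ^+ j * \tr (@wmx n j true C A) = ldser (fun r => - \tr (A ^+ r)) j.
Proof.
have [d trE ->] := tr_wmxE j true A.
rewrite (_ : _ * _ = (\prod_i (1 - d i *: 'X))`_j).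
  set q := \prod_i _.
  apply: (@ldser_eq _ char0 j _ (fun i => q`_i)) => //.
  apply: eq_logder (logder_prodT (fun i => logder_sub1X j (d i))) => // r _.
  by rewrite trE sumrN.
have -> : \prod_i (1 - d i *: 'X) =
    (\prod_(i < n) \sum_(a < 2) (d i) ^+ a *: 'X^a) \Po (- 'X).
  rewrite rmorph_prod; apply: eq_bigr => i _ /=.
  rewrite big_ord_recl big_ord1 /= expr0 scale1r expr0 expr1 expr1.
  by rewrite rmorphD /= comp_polyZ comp_polyX comp_polyC scalerN.
elim/poly_ind: (\prod_i _) j => [|q c IH] j; first by rewrite comp_poly0 !coef0 mulr0.
rewrite comp_polyD comp_polyM comp_polyX comp_polyC !coefD !coefC mulrN coefN !coefMX.
case: j => [|j]; first by rewrite mul1r oppr0.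
by rewrite !addr0 /= -IH exprS mulN1r mulNr.
Qed.

End Trigonal.

(** * Nonarchimedean absolute values *)

Section Kernels.
Variables (K : pzRingType) (T : finType).
Implicit Types k l : T -> T -> K.

Definition kmx k : 'M[K]_#|{: T}| := \matrix_(i, j) k (enum_val i) (enum_val j).

Lemma sum_enum_val (V : nmodType) (F : T -> V) :
  \sum_t F t = \sum_(i < #|{: T}|) F (enum_val i).
Proof.
rewrite (reindex (@enum_val T predT)) //=.
exact/onW_bij/enum_val_bij.
Qed.

Lemma kmxM k l : kmx k *m kmx l = kmx (fun s t => \sum_u k s u * l u t).
Proof.
apply/matrixP => i j; rewrite !mxE sum_enum_val.
by apply: eq_bigr => u _; rewrite !mxE.
Qed.

Lemma tr_kmx k : \tr (kmx k) = \sum_t k t t.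
Proof. by rewrite sum_enum_val; apply: eq_bigr => i _; rewrite mxE. Qed.

Lemma eq_kmx k l : (forall s t, k s t = l s t) -> kmx k = kmx l.
Proof. by move=> E; apply/matrixP => i j; rewrite !mxE E. Qed.

End Kernels.

Record nonarch (R : realDomainType) (K : fieldType) (v : K -> R) : Prop := Nonarch {
  na_eq0 : forall x, (v x == 0) = (x == 0);
  naM : {morph v : x y / x * y};
  na_ultra : forall x y, v (x + y) <= Num.max (v x) (v y);
  na_ge0 : forall x, 0 <= v x }.

Section Nonarch.
Variables (R : realFieldType) (K : fieldType) (v : K -> R).
Hypothesis na : nonarch v.

Lemma na0 : v 0 = 0. Proof. by apply/eqP; rewrite (na_eq0 na). Qed.

Lemma na_gt0 x : (0 < v x) = (x != 0).
Proof. by rewrite lt_neqAle (na_ge0 na) andbT eq_sym (na_eq0 na). Qed.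

Lemma na1 : v 1 = 1.
Proof.
have v1 : v 1 != 0 by rewrite (na_eq0 na) oner_eq0.
by apply: (mulIf v1); rewrite -(naM na) !mul1r.
Qed.

Lemma naX x n : v (x ^+ n) = v x ^+ n.
Proof. by elim: n => [|n IH]; rewrite ?expr0 ?na1 // !exprS (naM na) IH. Qed.

Lemma naV x : v x^-1 = (v x)^-1.
Proof.
have [->|x0] := eqVneq x 0; first by rewrite invr0 na0 invr0.
have vx0 : v x != 0 by rewrite (na_eq0 na).
by apply: (mulIf vx0); rewrite -(naM na) !mulVf // na1.
Qed.

Lemma naN1 : v (-1) = 1.
Proof.
apply/eqP; rewrite -(@eqrXn2 _ 2) ?(na_ge0 na) //.
by rewrite -naX sqrrN !expr1n na1.
Qed.

Lemma naN x : v (- x) = v x.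
Proof. by rewrite -mulN1r (naM na) naN1 mul1r. Qed.

Lemma naB x y : v (x - y) = v (y - x).
Proof. by rewrite -naN opprB. Qed.

Lemma naD_le b x y : v x <= b -> v y <= b -> v (x + y) <= b.
Proof. by move=> xb yb; rewrite (le_trans (na_ultra na x y)) // ge_max xb. Qed.

Lemma naB_le b x y : v x <= b -> v y <= b -> v (x - y) <= b.
Proof. by move=> xb yb; apply: naD_le; rewrite ?naN. Qed.

Lemma naD_lt b x y : v x < b -> v y < b -> v (x + y) < b.
Proof. by move=> xb yb; rewrite (le_lt_trans (na_ultra na x y)) // gt_max xb. Qed.

Lemma naB_lt b x y : v x < b -> v y < b -> v (x - y) < b.
Proof. by move=> xb yb; apply: naD_lt; rewrite ?naN. Qed.

Lemma na_sum_le (I : Type) (r : seq I) (P : pred I) (F : I -> K) b :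
  0 <= b -> (forall i, P i -> v (F i) <= b) -> v (\sum_(i <- r | P i) F i) <= b.
Proof.
move=> b0 H; elim/big_rec: _ => [|i x Pi IH]; first by rewrite na0.
by apply: naD_le => //; apply: H.
Qed.

Lemma na_sum_lt (I : Type) (r : seq I) (P : pred I) (F : I -> K) b :
  0 < b -> (forall i, P i -> v (F i) < b) -> v (\sum_(i <- r | P i) F i) < b.
Proof.
move=> b0 H; elim/big_rec: _ => [|i x Pi IH]; first by rewrite na0.
by apply: naD_lt => //; apply: H.
Qed.

Lemma na_prod (I : Type) (r : seq I) (P : pred I) (F : I -> K) :
  v (\prod_(i <- r | P i) F i) = \prod_(i <- r | P i) v (F i).
Proof. by apply: big_morph; [apply: naM | apply: na1]. Qed.

Lemma na_nat n : v n%:R <= 1.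
Proof.
elim: n => [|n IH]; first by rewrite na0 ler01.
by rewrite -natr1; apply: naD_le; rewrite ?na1.
Qed.

Lemma na_int (z : int) : v z%:~R <= 1.
Proof. by case: z => n; rewrite ?NegzE ?mulrNz ?naN; apply: na_nat. Qed.

Lemma na_mulrn x n : v (x *+ n) <= v x.
Proof. by rewrite -mulr_natr (naM na) ler_piMr ?(na_ge0 na) ?na_nat. Qed.

Lemma na_isosceles x y : v x < v y -> v (x + y) = v y.
Proof.
move=> xy; apply/eqP; rewrite eq_le naD_le ?(ltW xy) //= leNgt; apply/negP => xyy.
by have := naB_lt xyy xy; rewrite addrC addKr ltxx.
Qed.

Lemma na_addr1 x y : v (x - y) < v y -> v x = v y.
Proof. by move=> xy; rewrite -[in LHS](subrK y x) na_isosceles. Qed.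

Lemma na_exp_sub b x y n : v x <= 1 -> v y <= 1 -> v (x - y) <= b ->
  v (x ^+ n - y ^+ n) <= b.
Proof.
move=> x1 y1 xy; rewrite subrXX (naM na) -[b]mulr1.
apply: ler_pM; rewrite ?(na_ge0 na) //; apply: na_sum_le => // i _.
by rewrite (naM na) !naX mulr_ile1 ?exprn_ge0 ?(na_ge0 na) // exprn_ile1 ?(na_ge0 na).
Qed.

Lemma na_prod_sub (I : eqType) (r : seq I) (F G : I -> K) b : 0 <= b ->
  (forall i, i \in r -> v (F i) <= 1) -> (forall i, i \in r -> v (G i) <= 1) ->
  (forall i, i \in r -> v (F i - G i) <= b) ->
  v (\prod_(i <- r) F i - \prod_(i <- r) G i) <= b.
Proof.
move=> b0; elim: r => [|i r IH] F1 G1 FG; first by rewrite !big_nil subrr na0.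
rewrite !big_cons.
have -> : F i * \prod_(j <- r) F j - G i * \prod_(j <- r) G j =
   F i * (\prod_(j <- r) F j - \prod_(j <- r) G j) + (F i - G i) * \prod_(j <- r) G j.
  by ring.
have ir : i \in i :: r by rewrite mem_head.
have sub j : j \in r -> j \in i :: r by rewrite inE orbC => ->.
apply: naD_le; rewrite (naM na).
  rewrite -[b]mul1r; apply: ler_pM; rewrite ?(na_ge0 na) ?F1 //.
  by apply: IH => j /sub; [apply: F1 | apply: G1 | apply: FG].
rewrite -[b]mulr1; apply: ler_pM; rewrite ?(na_ge0 na) ?FG // na_prod.
rewrite big_seq; apply: prodr_ile1 => j /sub jr.
by rewrite (na_ge0 na) G1.
Qed.

Section Determinant.
Variable r : R.
Hypothesis r01 : 0 < r <= 1.

(** Decay at rate r that sets in only after degree c: the subtraction truncates, so up to degree c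
    the bound is just s. *)
Definition pbound (s : R) (c : nat) (P : {poly K}) : Prop :=
  forall N, v P`_N <= s * r ^+ (N - c).

Let r0 : 0 <= r. Proof. by case/andP: r01 => /ltW. Qed.
Let r1 : r <= 1. Proof. by case/andP: r01. Qed.

Lemma pboundM s s' c c' P Q : 0 <= s -> 0 <= s' ->
  pbound s c P -> pbound s' c' Q -> pbound (s * s') (c + c') (P * Q).
Proof.
move=> s0 s0' bP bQ N; rewrite coefM; apply: na_sum_le => [|i _].
  by rewrite !mulr_ge0 ?exprn_ge0.
rewrite (naM na); apply: le_trans (_ : (s * r ^+ (i - c)) * (s' * r ^+ (N - i - c')) <= _).
  by apply: ler_pM; rewrite ?(na_ge0 na).
rewrite mulrACA -exprD ler_wpM2l ?mulr_ge0 //.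
apply: ler_wiXn2l => //; have := ltn_ord i; lia.
Qed.

Lemma pbound1 : pbound 1 0 1.
Proof.
move=> N; rewrite coef1 mul1r subn0; case: eqP => [->|_]; first by rewrite na1.
by rewrite na0 exprn_ge0.
Qed.

Lemma pbound_prod (I : finType) (s : I -> R) (c : I -> nat) (P : I -> {poly K}) :
  (forall i, 0 <= s i) -> (forall i, pbound (s i) (c i) (P i)) ->
  pbound (\prod_i s i) (\sum_i c i) (\prod_i P i).
Proof.
move=> s0 bP; suff [] : 0 <= \prod_i s i /\
  pbound (\prod_i s i) (\sum_i c i) (\prod_i P i) by [].
apply: (big_ind3 (fun a b Q => 0 <= a /\ pbound a b Q)) => [|a b Q a' b' Q'|//].
  by split; [exact: ler01 | exact: pbound1].
by move=> [a0 bQ] [a0' bQ']; split; [apply: mulr_ge0 | apply: pboundM].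
Qed.

Lemma pboundX s c P n : 0 <= s -> pbound s c P -> pbound (s ^+ n) (c * n) (P ^+ n).
Proof.
move=> s0 bP; elim: n => [|n IH]; first by rewrite !expr0 muln0; apply: pbound1.
by rewrite !exprS mulnS; apply: pboundM => //; apply: exprn_ge0.
Qed.

Lemma pboundW s c c' P : 0 <= s -> (c <= c')%N -> pbound s c P -> pbound s c' P.
Proof.
move=> s0 cc bP N; apply: le_trans (bP N) _; rewrite ler_wpM2l //.
by apply: ler_wiXn2l => //; lia.
Qed.

(* The weights [W] do not matter: they cancel in each product over a permutation. *)
Lemma pbound_det n (X : 'M[K]_n) (W : 'I_n -> R) (good : pred 'I_n) :
  (forall i, 0 < W i) ->
  (forall i j, v (X i j) <= W i / W j) ->
  (forall i j, good i -> v (X i j) <= r * (W i / W j)) ->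
  pbound 1 #|[set i | ~~ good i]| (\det (1%:M - 'X *: map_mx polyC X)).
Proof.
move=> W0 bX gX N; rewrite coef_sum; apply: na_sum_le => [|s _].
  by rewrite mulr_ge0 ?exprn_ge0.
rewrite (_ : (-1) ^+ s = ((-1) ^+ s : K)%:P); last by rewrite rmorphXn rmorphN1.
rewrite coefCM (naM na) naX naN1 expr1n [X in X <= _]mul1r.
have WW i j : 0 <= W i / W j by rewrite divr_ge0 ?ltW.
(* A good row gains a factor r when it contributes an X; a bad row spends one degree without gain,
   which is what [~~ good i] counts. *)
have := @pbound_prod _ (fun i => W i / W (s i)) (fun i => (~~ good i : nat))
  (fun i => (1%:M - 'X *: map_mx polyC X) i (s i)) (fun i => WW i (s i)).
have -> : \prod_i (W i / W (s i)) = 1.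
  rewrite big_split /= prodfV [X in X / _](reindex_inj (@perm_inj _ s)) /=.
  by rewrite mulfV //; apply/prodf_neq0 => i _; rewrite gt_eqF.
have -> : (\sum_i ~~ good i)%N = #|[set i | ~~ good i]|.
  by rewrite -sum1dep_card [RHS]big_mkcond; apply: eq_bigr => i _; case: (good i).
apply=> i M; rewrite !mxE coefB coefXM coefMn coef1 coefC.
case: M => [|[|M]] /=.
- rewrite subr0 mulr1; case: eqP => [<-|_]; rewrite ?mulr1n ?mulr0n ?na1 ?na0 //.
  by rewrite divff // gt_eqF.
- rewrite mul0rn sub0r naN; case gi: (good i) => /=.
    by rewrite subn0 expr1 mulrC gX.
  by rewrite subnn expr0 mulr1.
- by rewrite mul0rn subrr na0 mulr_ge0 ?exprn_ge0.
Qed.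

End Determinant.
End Nonarch.

(** * Dwork's trace formula *)

Section TraceFormula.
Variables (C : fieldType) (p d D M : nat).
Hypothesis p_gt1 : (1 < p)%N.

Definition expo := {ffun 'I_d -> int}.
Definition box := {ffun 'I_d -> 'I_(D.*2.+1)}.
Definition pos (a : box) : expo := [ffun i => (a i)%:Z - D%:Z].
Definition bounded (L : nat) (w : expo) : bool := [forall i, (`|w i|%N <= L)%N].

Lemma posP a : bounded D (pos a).
Proof. by apply/forallP => i; rewrite ffunE; have := ltn_ord (a i); lia. Qed.

Lemma pos_inj : injective pos.
Proof.
move=> a b /ffunP E; apply/ffunP => i; apply: val_inj => /=.
by have := E i; rewrite !ffunE; lia.
Qed.

Lemma pos_surj w : bounded D w -> exists a, pos a = w.
Proof.
move=> /forallP bw; exists [ffun i => inord `|(w i + D%:Z)%R|%N].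
apply/ffunP => i; rewrite !ffunE; have := bw i => {}bw.
rewrite inordK; first by move: (w i) bw => z; lia.
by move: (w i) bw => z; lia.
Qed.

Lemma sum_pos (V : nmodType) (F : expo -> V) w :
  (~~ bounded D w -> F w = 0) -> \sum_(a : box | pos a == w) F (pos a) = F w.
Proof.
move=> Fw; have [bw|nb] := boolP (bounded D w).
  have [a aw] := pos_surj bw; rewrite (big_pred1 a) ?aw // => b.
  by rewrite -aw (inj_eq pos_inj).
rewrite Fw // big_pred0 // => a; apply: contraNF nb => /eqP <-; exact: posP.
Qed.

Lemma expoD (w u : expo) i : (w + u) i = w i + u i.
Proof. by rewrite ffunE. Qed.

Lemma expoB (w u : expo) i : (w - u) i = w i - u i.
Proof. by rewrite !ffunE. Qed.

Lemma expoMn (w : expo) q i : (w *+ q) i = w i * q%:Z.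
Proof. by rewrite ffunMnE -mulr_natr natz. Qed.

Lemma expo_mulrnI q : (0 < q)%N -> injective (fun w : expo => w *+ q).
Proof.
move=> q0 x y /ffunP E; apply/ffunP => i; have := E i.
by rewrite !ffunMnE => /eqP; rewrite eqr_pMn2r // => /eqP.
Qed.

Definition monom (x : 'I_d -> C) (w : expo) : C := \prod_i x i ^ w i.

Variable c : nat -> expo -> 'M[C]_M.
Hypothesis c_bounded : forall t e, ~~ bounded D e -> c t e = 0.

Definition laurent (t : nat) (x : 'I_d -> C) : 'M[C]_M :=
  \sum_(e : box) monom x (pos e) *: c t (pos e).

Fixpoint laurent_prod (m : nat) (x : 'I_d -> C) : 'M[C]_M :=
  if m is m'.+1 then
    laurent m' (fun i => x i ^+ (p ^ m')) *m laurent_prod m' x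
  else 1%:M.

(** Dwork's operator in the monomials of the box: multiply x^b by the Laurent polynomial, keep the
    exponents divisible by p and divide them by p. The coefficient of x^a is then that of index p a
    - b. *)
Definition psi (t : nat) : 'M[C]_#|{: box * 'I_M}| :=
  kmx (fun a b : box * 'I_M => c t (pos a.1 *+ p - pos b.1) a.2 b.2).

Fixpoint psi_prod (m : nat) : 'M[C]_#|{: box * 'I_M}| :=
  if m is m'.+1 then psi m' *m psi_prod m' else 1%:M.

(* The expansion of the product of the [laurent t], as a list of monomials. *)
Fixpoint terms (m : nat) : seq (expo * 'M[C]_M) :=
  if m is m'.+1 then
    [seq (pos e *+ p ^ m' + wA.1, c m' (pos e) *m wA.2) | e <- enum box, wA <- terms m']
  else [:: (0, 1%:M)].

(** The exponents are at most D(1 + p + ... + p^(m-1)), hence at most D(p^m - 1). This is what keeps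
    the intermediate exponents in the box. *)
Lemma terms_bounded m wA : wA \in terms m -> bounded (D * (p ^ m - 1)) wA.1.
Proof.
elim: m wA => [|m IH] wA /=.
  by rewrite inE => /eqP ->; apply/forallP => i; rewrite ffunE.
case/allpairsP => -[e wA'] /= [_ /IH /forallP bw ->] /=; apply/forallP => i.
have := bw i; have /forallP/(_ i) := posP e.
have : (0 < p ^ m)%N by rewrite expn_gt0; lia.
have : (p ^ m * 2 <= p ^ m.+1)%N by rewrite expnS mulnC leq_mul2r; lia.
move: (p ^ m.+1)%N (p ^ m)%N => q' q qq q0.
rewrite expoD expoMn; move: (pos e i) (wA'.1 i) => z w zD wD.
by have [zE|zE] : z = `|z|%N%:Z \/ z = - `|z|%N%:Z by [lia]; rewrite zE; move: `|z|%N zD => k; nia.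
Qed.

Lemma monom_add x w w' : (forall i, x i != 0) ->
  monom x (w + w') = monom x w * monom x w'.
Proof.
move=> x0; rewrite /monom -big_split /=; apply: eq_bigr => i _.
by rewrite ffunE expfzDr.
Qed.

Lemma monom_pow x w q : monom (fun i => x i ^+ q) w = monom x (w *+ q).
Proof.
by apply: eq_bigr => i _; rewrite ffunMnE -mulr_natl natz -exprz_exp.
Qed.

Lemma laurent_prodE m x : (forall i, x i != 0) ->
  laurent_prod m x = \sum_(wA <- terms m) monom x wA.1 *: wA.2.
Proof.
move=> x0; elim: m => [|m IH] /=.
  rewrite big_seq1 /= /monom big1 ?scale1r // => i _; by rewrite ffunE expr0z.
rewrite big_allpairs_dep IH /laurent mulmx_suml big_enum; apply: eq_bigr => e _.
rewrite mulmx_sumr; apply: eq_bigr => wA _ /=.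
by rewrite monom_add // monom_pow -scalemxAl -scalemxAr scalerA.
Qed.

(** Truncation to the box is compatible with products: if w = u p^m - b with |w| <= D(p^m - 1) and
    |b| <= D, then |u| <= D, so no intermediate index is lost. *)
Lemma psi_prodE m : psi_prod m = kmx (fun a b : box * 'I_M =>
  (\sum_(wA <- terms m | wA.1 == pos a.1 *+ p ^ m - pos b.1) wA.2) a.2 b.2).
Proof.
elim: m => [|m IH] /=.
  apply/matrixP => i j; rewrite !mxE.
  rewrite big_cons big_nil /= mulr1n.
  rewrite [0 == _]eq_sym subr_eq0 (inj_eq pos_inj).
  have -> : (i == j) = ((enum_val i).1 == (enum_val j).1) && ((enum_val i).2 == (enum_val j).2).
    by rewrite -(inj_eq enum_val_inj); case: (enum_val i) (enum_val j) => a s [b t].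
  by case: eqP => _; rewrite ?addr0 !mxE.
rewrite IH kmxM; apply: eq_kmx => a b /=.
set bb := pos b.1; set aa := pos a.1.
pose F (u : box) : 'M[C]_M := \sum_(wA <- terms m | wA.1 == pos u *+ p ^ m - bb)
   c m (aa *+ p - pos u) *m wA.2.
transitivity ((\sum_u F u) a.2 b.2).
  rewrite summxE [RHS](eq_bigr (fun u => \sum_s c m (aa *+ p - pos u) a.2 s *
    (\sum_(wA <- terms m | wA.1 == pos u *+ p ^ m - bb) wA.2) s b.2)).
    by rewrite pair_bigA.
  by move=> u _; rewrite /F -mulmx_sumr mxE.
congr (fun_of_matrix _ a.2 b.2).
rewrite [RHS]big_mkcond big_allpairs_dep big_enum /= /F.
under [RHS]eq_bigr do rewrite -big_mkcond.
rewrite (exchange_big_dep xpredT) //= [RHS](exchange_big_dep xpredT) //=.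
rewrite big_seq [RHS]big_seq; apply: eq_bigr => -[w A] wAt /=.
have bw := terms_bounded wAt; rewrite /= in bw.
have q0 : (0 < p ^ m)%N by rewrite expn_gt0; lia.
(* On both sides w contributes only if w + b is divisible by p^m, and then through a single
   index. *)
have [[u0 u0E]|no] := pselect (exists u0, w = u0 *+ p ^ m - bb).
  rewrite (eq_bigl (fun u => pos u == u0)) => [|u]; last first.
    by rewrite u0E (inj_eq (addIr _)) eq_sym (inj_eq (expo_mulrnI q0)).
  rewrite (sum_pos (F := fun e => c m (aa *+ p - e) *m A)); last first.
    move=> /negP[]; apply/forallP => i.
    have /forallP/(_ i) := bw; have /forallP/(_ i) := posP b.1.
    rewrite u0E expoB expoMn -/bb; move: (u0 i) (bb i) => z y.
    move: (p ^ m)%N q0 => q q0; nia.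
  rewrite (eq_bigl (fun e => pos e == aa *+ p - u0)) => [|e]; last first.
    rewrite u0E addrA (inj_eq (addIr _)) -mulrnDl expnS mulrnA.
    by rewrite (inj_eq (expo_mulrnI q0)) [RHS]eq_sym subr_eq eq_sym.
  rewrite (sum_pos (F := fun e => c m e *m A)) // => nb.
  by rewrite c_bounded ?mul0mx.
rewrite big1 => [|u /eqP wE]; last by case: no; exists (pos u).
rewrite big1 => // e /eqP wE; case: no; exists (aa *+ p - pos e).
apply: (addrI (pos e *+ p ^ m)); rewrite wE mulrnBl -mulrnA -expnS.
by rewrite [RHS]addrA [X in _ = X - _]addrC subrK.
Qed.

Variables (Z : finType) (tau : Z -> C) .
Hypothesis tau_neq0 : forall z, tau z != 0.

(** Orthogonality keeps exactly the exponents of the form u(p^m - 1) = u p^m - u, and these are the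
    diagonal positions of [psi_prod]. *)
Lemma trace_formula m : (0 < m)%N ->
  (forall w : int, \sum_z tau z ^ w =
     if ((p ^ m - 1)%N %| w)%Z then (p ^ m - 1)%:R else 0) ->
  \sum_(x : {ffun 'I_d -> Z}) \tr (laurent_prod m (fun i => tau (x i))) =
  (p ^ m - 1)%:R ^+ d * \tr (psi_prod m).
Proof.
move=> m0 orth; set q1 := (p ^ m - 1)%N.
have q10 : (0 < q1)%N.
  by rewrite subn_gt0 -(exp1n m) ltn_exp2r.
under eq_bigr => x _.
  rewrite laurent_prodE; last by move=> i; apply: tau_neq0.
  rewrite raddf_sum /=.
  under eq_bigr do rewrite mxtraceZ.
over.
rewrite exchange_big /=.
rewrite (eq_big_seq (fun wA => q1%:R ^+ d *
   \sum_(a : box | wA.1 == pos a *+ q1) \tr wA.2)).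
  rewrite -mulr_sumr; congr (_ * _); rewrite psi_prodE tr_kmx.
  rewrite (exchange_big_dep xpredT) //=.
  rewrite -(pair_bigA _ (fun a s => (\sum_(wA <- terms m | wA.1 == pos a *+ p ^ m - pos a) wA.2) s s)) /=.
  apply: eq_bigr => a _; rewrite /mxtrace.
  rewrite exchange_big /=; apply: eq_bigr => s _; rewrite summxE.
  apply: eq_bigl => wA; congr (_ == _).
  by rewrite /q1 mulrnBr ?expn_gt0 ?mulr1n //; lia.
move=> [w A] wAt /=; rewrite -mulr_suml.
have -> : \sum_(x : {ffun 'I_d -> Z}) monom (fun i => tau (x i)) w =
    \prod_i \sum_z tau z ^ w i by rewrite bigA_distr_bigA.
have bw := terms_bounded wAt; rewrite /= in bw.
have [[u uE]|no] := pselect (exists u : expo, w = u *+ q1).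
  rewrite (eq_bigl (fun a => pos a == u)) => [|a]; last first.
    by rewrite uE eq_sym (inj_eq (expo_mulrnI q10)).
  rewrite (sum_pos (F := fun=> \tr A)).
    congr (_ * _); rewrite (eq_bigr (fun=> q1%:R)) => [|i _].
      by rewrite prodr_const card_ord.
    by rewrite orth uE expoMn dvdz_mull.
  move=> /negP[]; apply/forallP => i; have /forallP/(_ i) := bw.
  rewrite uE expoMn abszM absz_nat -/q1.
  by rewrite leq_pmul2r.
rewrite [in RHS]big_pred0 ?mulr0 => [|a]; last first.
  by apply/eqP => wE; apply: no; exists (pos a).
have [/forallP dv|/forallPn[i ndv]] := boolP [forall i, (q1 %| w i)%Z].
  case: no; exists [ffun i => (w i %/ q1)%Z]; apply/ffunP => i.
  by rewrite expoMn ffunE divzK.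
by rewrite (bigD1 i) //= orth (negPf ndv) !mul0r.
Qed.

End TraceFormula.

(** * Dwork's splitting function *)

Lemma logder_comp_Xn (F : fieldType) N (u : nat -> F) (P : {poly F}) q : (0 < q)%N ->
  logder N u (fun i => P`_i) ->
  logder N (fun i => if (q %| i)%N then q%:R * u (i %/ q)%N else 0)
    (fun i => (P \Po 'X^q)`_i).
Proof.
move=> q0 /logder_poly[P0 PN].
have cE i : (P \Po 'X^q)`_i = if (q %| i)%N then P`_(i %/ q) else 0.
  by rewrite coef_comp_poly_Xn.
apply/logder_poly; split; first by rewrite cE dvdn0 div0n.
pose w i := if (q %| i)%N then q%:R * u (i %/ q)%N else 0 : F.
move=> M MN; rewrite -[\poly_(i < N) _]/(\poly_(i < N) w i.+1).
pose U := \poly_(i < N) u i.+1.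
have eqW i : (i < N)%N -> (\poly_(i < N) w i.+1)`_i = ((U \Po 'X^q) * ('X^q)^`())`_i.
  move=> iN; rewrite coef_poly iN derivXn mulrnAr coefMn coefMXn /w.
  case: ltnP => [iq|qi].
    by rewrite mul0rn; case: ifP => // /dvdn_leq; lia.
  have E : i.+1 = (i - q.-1 + q)%N by lia.
  rewrite coef_comp_poly_Xn // E dvdn_addl // divnDr // divnn q0 addn1.
  case: ifP => _; rewrite ?mul0rn // coef_poly mulr_natl.
  by rewrite (leq_ltn_trans (leq_div _ _)) // (leq_ltn_trans (leq_subr _ _)).
have eqP' i : (i < N)%N -> (P^`() \Po 'X^q)`_i = ((U * P) \Po 'X^q)`_i.
  move=> iN; rewrite !coef_comp_poly_Xn //; case: ifP => // _.
  by apply: PN; apply: leq_ltn_trans (leq_div _ _) iN.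
rewrite deriv_comp.
transitivity (((U * P) \Po 'X^q) * ('X^q)^`())`_M.
  rewrite !coefM; apply: eq_bigr => i _; rewrite eqP' //.
  by apply: leq_ltn_trans MN; rewrite -ltnS.
rewrite comp_polyM mulrAC !coefM; apply: eq_bigr => i _; rewrite eqW //.
by apply: leq_ltn_trans MN; rewrite -ltnS.
Qed.

Section ValuationNat.
Variables (R : realFieldType) (C : fieldType) (v : C -> R) (p : nat).
Hypotheses (na : nonarch v) (pr_p : prime p) (vp : v p%:R = p%:R^-1).
Let p_gt1 := prime_gt1 pr_p.
Let p_gt0 := prime_gt0 pr_p.

Lemma vp_lt1 : v p%:R < 1.
Proof. by rewrite vp invf_lt1 ?ltr1n ?ltr0n. Qed.

Lemma vp_gt0 : 0 < v p%:R.
Proof. by rewrite vp invr_gt0 ltr0n. Qed.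

Lemma p_neq0 : p%:R != 0 :> C.
Proof. by rewrite -(na_gt0 na) vp_gt0. Qed.

Lemma v_dvdn n : (p %| n)%N -> v n%:R <= v p%:R.
Proof.
by case/dvdnP => k ->; rewrite natrM (naM na) ler_piMl ?(na_ge0 na) ?na_nat.
Qed.

Lemma v_coprime n : ~~ (p %| n)%N -> v n%:R = 1.
Proof.
move=> pn; apply/eqP; rewrite eq_le na_nat //= leNgt; apply/negP => vn1.
have n0 : (0 < n)%N by case: n pn {vn1}; rewrite ?dvdn0.
have : coprime n p by rewrite coprime_sym prime_coprime.
case: (egcdnP p n0) => a b E _; rewrite /coprime => /eqP g1; rewrite g1 in E.
have : v (a%:R * n%:R - b%:R * p%:R) < 1.
  apply: naB_lt => //; rewrite (naM na).
    by apply: le_lt_trans vn1; rewrite ler_piMl ?(na_ge0 na) ?na_nat.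
  by apply: le_lt_trans vp_lt1; rewrite ler_piMl ?(na_ge0 na) ?na_nat.
by rewrite -!natrM E natrD addrAC subrr add0r (na1 na) ltxx.
Qed.

Lemma v_natE n : (0 < n)%N -> v n%:R = v p%:R ^+ logn p n.
Proof.
move=> n0; have [m pm {1}->] := pfactor_coprime pr_p n0.
rewrite natrM natrX (naM na) naX // v_coprime ?mul1r //.
by rewrite -prime_coprime // coprime_sym.
Qed.

Lemma natr_neq0 n : n.+1%:R != 0 :> C.
Proof. by rewrite -(na_gt0 na) v_natE // exprn_gt0 ?vp_gt0. Qed.

Lemma v_modn m n : m = n %[mod p] -> v (m%:R - n%:R) <= v p%:R.
Proof.
wlog nm : m n / (n <= m)%N => [H E|/eqP].
  by case: (leqP n m) => [|/ltnW] nm; [apply: H | rewrite (naB na); apply: H].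
by rewrite eqn_mod_dvd // -natrB // => /v_dvdn.
Qed.

(** Legendre's formula: (p - 1) times the sum of the n / p^k for k <= m is at most n - n / p^m, and
    the largest m with p^m <= n makes the subtracted quotient at least 1. *)
Lemma logn_fact_le n : (0 < n)%N -> (p.-1 * logn p n`! <= n.-1)%N.
Proof.
move=> n0.
have H m : (p.-1 * (\sum_(1 <= k < m.+1) n %/ p ^ k) <= n - n %/ p ^ m)%N.
  elim: m => [|m IH]; first by rewrite big_geq // muln0.
  rewrite big_nat_recr //= mulnDr.
  have : (p * (n %/ p ^ m.+1) <= n %/ p ^ m)%N.
    by rewrite expnSr divnMA mulnC leq_trunc_div.
  have : (n %/ p ^ m <= n)%N by exact: leq_div.
  have : p = p.-1.+1 by rewrite prednK.
  move: (n %/ p ^ m.+1)%N (n %/ p ^ m)%N IH => x y IH pE; nia.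
have := H (trunc_log p n).
have lt1 : (0 < n %/ p ^ trunc_log p n)%N.
  by rewrite divn_gt0 ?expn_gt0 ?p_gt0 // trunc_logP.
have E : (logn p n`! = \sum_(1 <= k < (trunc_log p n).+1) n %/ p ^ k)%N.
  rewrite logn_fact //; set t := trunc_log p n.
  have tn : (t <= n)%N.
    by apply: leq_trans (trunc_logP p_gt1 n0); apply/ltnW/ltn_expl.
  rewrite (big_cat_nat _ (n := t.+1)) //= [X in (_ + X)%N]big_nat [X in (_ + X)%N]big1 ?addn0 //.
  move=> k /andP[tk _]; rewrite divn_small //.
  by apply: leq_trans (trunc_log_ltn n p_gt1) _; rewrite leq_exp2l.
rewrite -E; lia.
Qed.

(** Fermat's little theorem for a rational number integral at p, written as a quotient from which
    the powers of p are cancelled first. *)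
Lemma v_exp_prime x : v x <= 1 ->
  (exists z c : nat, (0 < c)%N /\ c%:R * x = z%:R) -> v (x ^+ p - x) <= v p%:R.
Proof.
move=> x1 [z [c [c0 cx]]].
have [c' pc' cE] := pfactor_coprime pr_p c0; set e := logn p c in cE.
have c'0 : (0 < c')%N by move: c0; rewrite cE muln_gt0 => /andP[].
have vc' : v c'%:R = 1 by rewrite v_coprime // -prime_coprime.
have [z' zE] : exists z', z = (z' * p ^ e)%N.
  have [->|z0] := posnP z; first by exists 0%N.
  suff : (p ^ e %| z)%N by case/dvdnP => k ->; exists k.
  rewrite pfactor_dvdn //.
  have : v z%:R <= v c%:R by rewrite -cx (naM na) ler_piMr ?(na_ge0 na).
  by rewrite (v_natE z0) (v_natE c0) ler_iXn2l ?vp_gt0 ?vp_lt1.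
have c'x : c'%:R * x = z'%:R.
  apply: (mulIf (expf_neq0 e p_neq0)); rewrite mulrAC -natrX -!natrM -cE cx -zE //.
have c'n0 : c'%:R != 0 :> C by case: c' c'0 {vc' c'x cE pc'} => // k _; apply: natr_neq0.
have -> : x ^+ p - x = ((z' ^ p * c')%:R - (z' * c' ^ p)%:R) / c'%:R ^+ p.+1.
  have -> : x = z'%:R / c'%:R by rewrite -c'x mulrAC mulfV ?mul1r.
  rewrite !natrM !natrX exprMn exprVn exprS.
  have := expf_neq0 p c'n0; move: (_ ^+ p) (_ ^+ p) => cp zp cp0; field.
  by rewrite cp0 c'n0.
rewrite (naM na) naV // naX // vc' expr1n invr1 mulr1; apply: v_modn.
by rewrite -modnMml fermat_little // modnMml -[RHS]modnMmr fermat_little // modnMmr.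
Qed.

End ValuationNat.

Section CoefBound.
Variables (R : realFieldType) (C : fieldType) (v : C -> R).
Hypothesis na : nonarch v.
Implicit Types P Q : {poly C}.

Definition cbound (c r : R) P := forall j, v P`_j <= c * r ^+ j.

Lemma cboundM c c' r P Q : 0 <= c -> 0 <= c' -> 0 <= r ->
  cbound c r P -> cbound c' r Q -> cbound (c * c') r (P * Q).
Proof.
move=> c0 c0' r0 bP bQ j; rewrite coefM; apply: na_sum_le => // [|i _].
  by rewrite !mulr_ge0 ?exprn_ge0.
have ij : (i <= j)%N by rewrite -ltnS.
have -> : r ^+ j = r ^+ i * r ^+ (j - i) by rewrite -exprD subnKC.
rewrite (naM na) mulrACA; by apply: ler_pM; rewrite ?(na_ge0 na).
Qed.

Lemma cboundD c r P Q : cbound c r P -> cbound c r Q -> cbound c r (P + Q).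
Proof. by move=> bP bQ j; rewrite coefD naD_le. Qed.

Lemma cboundB c r P Q : cbound c r P -> cbound c r Q -> cbound c r (P - Q).
Proof. by move=> bP bQ j; rewrite coefB naB_le. Qed.

Lemma cbound0 c r : 0 <= c -> 0 <= r -> cbound c r 0.
Proof. by move=> c0 r0 j; rewrite coef0 na0 // mulr_ge0 ?exprn_ge0. Qed.

Lemma cbound1 r : 0 <= r -> cbound 1 r 1.
Proof.
move=> r0 j; rewrite coef1 mul1r; case: eqP => [->|_]; first by rewrite na1.
by rewrite na0 ?exprn_ge0.
Qed.

Lemma cboundX r P n : 0 <= r -> cbound 1 r P -> cbound 1 r (P ^+ n).
Proof.
move=> r0 bP; elim: n => [|n IH]; first exact: cbound1.
by rewrite exprS -[1]mulr1; apply: cboundM.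
Qed.

Lemma cbound_sum (I : Type) (s : seq I) (A : pred I) (F : I -> {poly C}) c r :
  0 <= c -> 0 <= r -> (forall i, A i -> cbound c r (F i)) ->
  cbound c r (\sum_(i <- s | A i) F i).
Proof.
move=> c0 r0 H; elim/big_rec: _ => [|i P Ai bP]; first exact: cbound0.
by apply: cboundD => //; apply: H.
Qed.

Lemma cbound_comp c r P q : (0 < q)%N -> 0 <= c -> 0 <= r -> cbound c (r ^+ q) P ->
  cbound c r (P \Po 'X^q).
Proof.
move=> q0 c0 r0 bP j; rewrite coef_comp_poly_Xn //; case: ifP => [/dvdnP[k ->]|_].
  by rewrite mulnK // mulnC exprM.
by rewrite na0 ?mulr_ge0 ?exprn_ge0.
Qed.

Lemma cboundW c c' r r' P : 0 <= r -> c <= c' -> r <= r' -> cbound c r P ->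
  0 <= c' -> cbound c' r' P.
Proof.
move=> r0 cc rr bP c'0 j; apply: le_trans (bP j) _.
apply: le_trans (_ : c' * r ^+ j <= _).
  by rewrite ler_wpM2r ?exprn_ge0.
by rewrite ler_wpM2l // lerXn2r // nnegrE // (le_trans r0).
Qed.

Lemma cbound_horner c r P K x : 0 <= c -> 0 <= r <= 1 -> cbound c r P -> v x <= 1 ->
  (forall j, (j < K)%N -> P`_j = 0) -> v P.[x] <= c * r ^+ K.
Proof.
move=> c0 /andP[r0 r1] bP x1 lowP; rewrite horner_coef.
have cr0 : 0 <= c * r ^+ K by rewrite mulr_ge0 ?exprn_ge0.
apply: na_sum_le => // i _; have [iK|Ki] := ltnP i K.
  by rewrite lowP // mul0r na0.
rewrite (naM na) naX //; apply: le_trans (_ : c * r ^+ i * 1 <= _).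
  by apply: ler_pM; rewrite ?exprn_ge0 ?(na_ge0 na) ?exprn_ile1 ?(na_ge0 na).
by rewrite mulr1 ler_wpM2l // ler_wiXn2l.
Qed.

End CoefBound.

(** * Integrality of the Artin-Hasse exponential *)

Section ArtinHasse.
Variables (R : realFieldType) (C : fieldType) (v : C -> R) (p : nat).
Hypotheses (na : nonarch v) (pr_p : prime p) (vp : v p%:R = p%:R^-1).
Let p_gt1 := prime_gt1 pr_p.
Let p_gt0 := prime_gt0 pr_p.
Let char0 := natr_neq0 na pr_p vp.

Definition ppow (i : nat) : bool := i == (p ^ logn p i)%N.

Lemma ppow_mul i : (0 < i)%N -> ppow (p * i) = ppow i.
Proof.
move=> i0; rewrite /ppow lognM // logn_prime // eqxx expnD expn1.
by rewrite eqn_pmul2l.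
Qed.

Lemma ppowP i : ppow i -> i != 1%N -> (p %| i)%N.
Proof.
rewrite /ppow; case: (logn p i) => [/eqP ->|k /eqP -> _]; first by rewrite expn0 eqxx.
by rewrite expnS dvdn_mulr.
Qed.

(** The Artin-Hasse exponential exp(T + T^p / p + T^(p^2) / p^2 + ...): [ldser] divides the i-th
    entry by i. *)
Definition ahser : nat -> C := ldser (fun i => (ppow i)%:R).

Lemma ahser_rat N : exists z c : nat, (0 < c)%N /\ c%:R * ahser N = z%:R.
Proof.
elim/ltn_ind: N => -[_|N IH].
  by exists 1%N, 1%N; rewrite /ahser (ldserP char0 0 _).1 mulr1.
have [z [c [c0 E]]] : exists z c : nat, (0 < c)%N /\
    c%:R * (ahser N.+1 *+ N.+1) = z%:R.
  rewrite /ahser (ldserP char0 N.+1 _).2 // -/ahser.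
  elim: (index_enum _) => [|i s [z [c [c0 E]]]].
    by exists 0%N, 1%N; rewrite big_nil mulr0.
  have [] := IH (N - i)%N; first by rewrite ltnS leq_subr.
  move=> z' [c' [c'0 E']].
  exists (c' * z + c * (ppow i.+1 * z'))%N, (c' * c)%N; rewrite muln_gt0 c0 c'0; split=> //.
  rewrite big_cons mulrDr natrD addrC natrM -[in X in X + _]mulrA E natrM; congr (_ + _).
  by rewrite natrM (natrM _ (ppow _)) -E'; ring.
exists z, (c * N.+1)%N; rewrite muln_gt0 c0; split=> //.
by rewrite natrM -E -(mulr_natl (ahser _)) mulrA.
Qed.

Lemma expserE (c : C) N : ldser (fun i => c *+ (i == 1)%N) N * N`!%:R = c ^+ N.
Proof.
elim: N => [|N IH]; first by rewrite (ldserP char0 0 _).1 mulr1.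
rewrite factS natrM mulrA [ldser _ _ * _]mulr_natr (ldserP char0 N.+1 _).2 //.
rewrite big_ord_recl big1 ?addr0 => [|i _]; last by rewrite mulr0n mul0r.
by rewrite eqxx mulr1n subn0 -mulrA IH exprS.
Qed.

Lemma expser_bound N : (0 < N)%N ->
  v (ldser (fun i => p%:R *+ (i == 1)%N) N) <= v p%:R.
Proof.
move=> N0; have := congr1 v (expserE p%:R N).
rewrite (naM na) naX // (v_natE na pr_p vp (fact_gt0 N)) => E.
have vl := vp_gt0 pr_p vp; have v1 := ltW (vp_lt1 pr_p vp).
have lN : (logn p N`! <= N.-1)%N.
  apply: leq_trans (logn_fact_le pr_p N0); rewrite leq_pmull //.
  by rewrite -ltnS prednK.
move: E vl v1; move: (v p%:R) => y E y0 y1.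
have yl : 0 < y ^+ logn p N`! by rewrite exprn_gt0.
rewrite -(ler_pM2r yl) E -exprS; apply: ler_wiXn2l; rewrite ?(ltW y0) //; lia.
Qed.

Lemma frobenius_add (A B : {poly C}) : cbound v 1 1 A -> cbound v 1 1 B ->
  cbound v (v p%:R) 1 ((A + B) ^+ p - A ^+ p - B ^+ p).
Proof.
move=> bA bB; case: p pr_p vp => // q pr_q vq.
rewrite exprDn big_ord_recl big_ord_recr /= subn0 expr0 mulr1 bin0 mulr1n.
rewrite /bump !leq0n !add1n subnn expr0 mul1r binn mulr1n.
have -> (a b c : {poly C}) : a + (b + c) - a - c = b by ring.
apply: cbound_sum => // [|i _]; first exact: (na_ge0 na).
rewrite /bump leq0n add1n; move=> j; rewrite coefMn -(mulr_natr (_`_j)) (naM na) [X in X <= _]mulrC.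
apply: ler_pM; rewrite ?(na_ge0 na) //.
  by apply: v_dvdn => //; apply: prime_dvd_bin => //=; have := ltn_ord i; lia.
by have := @cboundM _ _ _ na 1 1 1 _ _ ler01 ler01 ler01
  (cboundX na (q.+1 - i.+1) ler01 bA) (cboundX na i.+1 ler01 bB) j; rewrite !mul1r.
Qed.

Lemma frobenius_poly (P : {poly C}) : cbound v 1 1 P ->
  (forall j, v (P`_j ^+ p - P`_j) <= v p%:R) ->
  cbound v (v p%:R) 1 ((P \Po 'X^p) - P ^+ p).
Proof.
move=> bP fP; have vp0 := na_ge0 na p%:R.
suff [] : cbound v 1 1 P /\ cbound v (v p%:R) 1 ((P \Po 'X^p) - P ^+ p) by [].
rewrite -[P]coefK poly_def.
apply: (big_ind (fun Q => cbound v 1 1 Q /\ cbound v (v p%:R) 1 ((Q \Po 'X^p) - Q ^+ p))).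
- split; first exact: cbound0.
  by rewrite comp_poly0 expr0n gtn_eqF // subrr; apply: cbound0.
- move=> A B [bA fA] [bB fB]; split; first exact: cboundD.
  have -> : ((A + B) \Po 'X^p) - (A + B) ^+ p = ((A \Po 'X^p) - A ^+ p) +
     ((B \Po 'X^p) - B ^+ p) - ((A + B) ^+ p - A ^+ p - B ^+ p).
    by rewrite comp_polyD; ring.
  by apply: cboundB => //; [apply: cboundD | apply: frobenius_add].
- move=> i _; split=> j.
    rewrite coefZ coefXn (naM na) expr1n mulr1; have := bP i; rewrite expr1n mulr1 => Pi.
    by rewrite mulr_ile1 ?(na_ge0 na) ?na_nat.
  rewrite comp_polyZ comp_Xn_poly exprZn -exprM -exprM mulnC -scalerBl coefZ coefXn.
  rewrite (naM na) expr1n; apply: ler_pM; rewrite ?(na_ge0 na) ?na_nat //.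
  by rewrite naB.
Qed.

(** Dwork's criterion: the series satisfies S(T)^p = S(T^p) exp(pT). In degree M the new coefficient
    enters the left side as p a_M and is absent on the right; the lower coefficients agree modulo p
    by the Frobenius congruence, so p a_M is divisible by p. *)
Lemma ahser_integral N : v (ahser N) <= 1.
Proof.
elim/ltn_ind: N => -[_|N IH]; first by rewrite /ahser (ldserP char0 0 _).1 na1.
set a := ahser; set M := N.+1 in IH *.
have vp0 := na_ge0 na p%:R; have v1 := ltW (vp_lt1 pr_p vp).
pose P : {poly C} := \poly_(j < M) a j.
pose S : {poly C} := P + a M *: 'X^M.
have PE j : P`_j = if (j < M)%N then a j else 0 by rewrite coef_poly.
have SE j : (j <= M)%N -> S`_j = a j.
  move=> jM; rewrite coefD coefZ coefXn PE; case: ltngtP jM => // [jM _|-> _].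
    by rewrite mulr0 addr0.
  by rewrite add0r mulr1.
have lS : logder M (fun i => (ppow i)%:R) (fun i => S`_i).
  by apply: eq_logder (ldserP char0 M _) => // i iM; rewrite SE.
pose G : {poly C} := \poly_(j < M.+1) ldser (fun i => p%:R *+ (i == 1)%N) j.
have lG : logder M (fun i => p%:R *+ (i == 1)%N) (fun i => G`_i).
  by apply: eq_logder (ldserP char0 M _) => // i iM; rewrite coef_poly ltnS iM.
have bP : cbound v 1 1 P.
  move=> j; rewrite PE expr1n mulr1; case: ifP => [jM|_]; first exact: IH.
  by rewrite na0.
have fP j : v (P`_j ^+ p - P`_j) <= v p%:R.
  rewrite PE; case: ifP => jM.
    by apply: v_exp_prime => //; [apply: IH | apply: ahser_rat].
  by rewrite expr0n gtn_eqF // subrr na0.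
have E : (S ^+ p)`_M = ((S \Po 'X^p) * G)`_M.
  apply: (logder_uniq char0 (logderX p lS)) (leqnn M).
  apply: eq_logder (logderM (logder_comp_Xn p_gt0 lS) lG) => // i /andP[i0 _].
  case: ifP => [/dvdnP[k kE]|ndv].
    have k0 : (0 < k)%N by move: i0; rewrite kE muln_gt0 => /andP[].
    rewrite kE mulnK // mulnC ppow_mul // (_ : (p * k == 1)%N = false) ?addr0.
      by rewrite mulr_natl.
    by rewrite muln_eq1 gtn_eqF.
  have [->|i1] := eqVneq i 1%N.
    by rewrite /ppow logn1 expn0 eqxx add0r.
  case pi : (ppow i); last by rewrite mulr0n mul0rn addr0.
  by rewrite (ppowP pi i1) in ndv.
have Sp : (S ^+ p)`_M = (P ^+ p)`_M + p%:R * a M.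
  rewrite -[LHS](subrK (P ^+ p)`_M) addrC; congr (_ + _).
  rewrite -coefB subrXX addrC addKr -scalerAl coefZ coefXnM ltnn subnn mulrC.
  congr (_ * _); rewrite coef_sum (eq_bigr (fun=> 1)) ?sumr_const ?card_ord //.
  have c0X (Q : {poly C}) n : Q`_0 = 1 -> (Q ^+ n)`_0 = 1.
    by move=> Q0; rewrite -horner_coef0 hornerE horner_coef0 Q0 expr1n.
  have a0 : a 0%N = 1 by rewrite /a /ahser (ldserP char0 0 _).1.
  move=> i _; rewrite coefM big_ord1 !c0X ?mulr1 // ?SE // ?PE //.
have SP : ((S \Po 'X^p) * G)`_M = ((P \Po 'X^p) * G)`_M.
  rewrite !coefM; apply: eq_bigr => i _; congr (_ * _).
  rewrite comp_polyD coefD comp_polyZ comp_Xn_poly -exprM coefZ coefXn.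
  rewrite (_ : _ == _ = false) ?mulr0 ?addr0 //.
  by apply/eqP => iE; have := ltn_ord i; rewrite iE mulnC; nia.
have bG : cbound v (v p%:R) 1 (G - 1).
  move=> j; rewrite expr1n mulr1 coefB coef_poly coef1; case: j => [|j].
    by rewrite (ldserP char0 0 _).1 subrr na0.
  by rewrite subr0; case: ifP => _; [apply: expser_bound | rewrite na0].
have key : p%:R * a M = ((P \Po 'X^p) * (G - 1) + ((P \Po 'X^p) - P ^+ p))`_M.
  rewrite mulrBr mulr1 addrA addrNK coefB -SP -E Sp addrC addKr //.
have := vp_gt0 pr_p vp; rewrite -(ler_pM2l (vp_gt0 pr_p vp)) mulr1 -(naM na) key => _.
have := (_ : cbound v (v p%:R) 1 ((P \Po 'X^p) * (G - 1) + ((P \Po 'X^p) - P ^+ p))) M.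
rewrite expr1n mulr1; apply; apply: cboundD => //; last exact: frobenius_poly.
rewrite -[v p%:R]mul1r; apply: cboundM => //.
by apply: cbound_comp => //; rewrite expr1n.
Qed.

End ArtinHasse.

(** * The splitting function exp(pi (T - T^p)) and its values at Teichmuller points *)

Section Theta.
Variables (R : realFieldType) (C : fieldType) (v : C -> R) (p : nat).
Hypotheses (na : nonarch v) (pr_p : prime p) (vp : v p%:R = p%:R^-1).
Variables (pi : C) (rho : R).
Hypotheses (piE : pi ^+ p.-1 = - p%:R) (rho_gt0 : 0 < rho) (rhoE : rho ^+ (p ^ 2) = v pi).
Let p_gt1 := prime_gt1 pr_p.
Let p_gt0 := prime_gt0 pr_p.
Let char0 := natr_neq0 na pr_p vp.

Lemma v_piE : v pi ^+ p.-1 = v p%:R.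
Proof. by rewrite -naX // piE naN. Qed.

Lemma v_pi_gt0 : 0 < v pi. Proof. by rewrite -rhoE exprn_gt0. Qed.

Lemma v_pi_lt1 : v pi < 1.
Proof.
rewrite ltNge; apply/negP => H; have := vp_lt1 pr_p vp.
by rewrite -v_piE ltNge exprn_ege1.
Qed.

Lemma rho_lt1 : rho < 1.
Proof.
rewrite ltNge; apply/negP => H; have := v_pi_lt1.
by rewrite -rhoE ltNge exprn_ege1.
Qed.

Let rho01 : 0 <= rho <= 1. Proof. by rewrite !ltW ?rho_lt1. Qed.
Let rho0 : 0 <= rho. Proof. exact: ltW. Qed.

(** The exponential of minus the sum of (pi T)^(p^j) / p^j over j >= 2, which cancels the tail of
    the Artin-Hasse exponent at pi T. *)
Definition mser : nat -> C :=
  ldser (fun i => if ppow p i && (p ^ 2 %| i)%N then - pi ^+ i else 0).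

(** The recursion divides by p^2 n at each step in degree p^2 n; the factor (p^2)^n n! absorbs all
    these divisions. *)
Lemma mser_rec N : (~~ (p ^ 2 %| N)%N -> mser N = 0) /\
  forall n, N = (p ^ 2 * n)%N -> v (mser N) * v ((p ^ 2) ^ n * n`!)%:R <= v pi ^+ N.
Proof.
elim/ltn_ind: N => -[_|N IH].
  split=> [|n]; first by rewrite dvdn0.
  move/esym/eqP; rewrite muln_eq0 expn_eq0 andbT gtn_eqF //= => /eqP ->.
  by rewrite /mser (ldserP char0 0 _).1 (na1 na) mulr1.
have rec : mser N.+1 *+ N.+1 = \sum_(i < N.+1)
   (if ppow p i.+1 && (p ^ 2 %| i.+1)%N then - pi ^+ i.+1 else 0) * mser (N - i)%N.
  by rewrite /mser (ldserP char0 N.+1 _).2.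
split=> [ndv|n nE].
  apply/eqP; have : mser N.+1 *+ N.+1 == 0.
    rewrite rec big1 // => i _; case: ifP => [/andP[_ dv]|_]; last by rewrite mul0r.
    have iN : (i <= N)%N by rewrite -ltnS.
    rewrite (IH (N - i)%N _).1 ?mulr0 // ?ltnS ?leq_subr //.
    by apply: contra ndv => dv'; rewrite -(subnKC iN) -addSn dvdn_add.
  by rewrite -mulr_natl mulf_eq0 (negPf (char0 _)).
case: n => [|n] in nE *; first by rewrite muln0 in nE.
have -> : ((p ^ 2) ^ n.+1 * n.+1`! = N.+1 * ((p ^ 2) ^ n * n`!))%N.
  by rewrite nE factS expnS; lia.
rewrite natrM (naM na) mulrA -(naM na) mulr_natr rec.
rewrite -(naM na) mulr_suml; apply: na_sum_le => // [|i _].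
  by rewrite exprn_ge0 ?(na_ge0 na).
case: ifP => [/andP[_ dv]|_]; last first.
  by rewrite !mul0r (na0 na) exprn_ge0 ?(na_ge0 na).
have iN : (i <= N)%N by rewrite -ltnS.
have [k kE] : exists k, (N - i = p ^ 2 * k)%N.
  have : (p ^ 2 %| N.+1 - i.+1)%N by rewrite dvdn_sub // nE dvdn_mulr.
  by rewrite subSS => /dvdnP[k ->]; exists k; rewrite mulnC.
have kn : (k <= n)%N.
  have : (p ^ 2 * k < p ^ 2 * n.+1)%N by rewrite -kE -nE ltnS leq_subr.
  by rewrite ltn_pmul2l ?expn_gt0 ?p_gt0.
have NE : N.+1 = (i.+1 + (N - i))%N by rewrite addSn subnKC.
rewrite [in leRHS]NE exprD -mulrA (naM na) naN // naX // ler_wpM2l ?exprn_ge0 ?(na_ge0 na) //.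
rewrite (naM na); apply: le_trans ((IH (N - i)%N _).2 k kE); last by rewrite ltnS leq_subr.
rewrite ler_wpM2l ?(na_ge0 na) //.
have [c ->] : exists c, ((p ^ 2) ^ n * n`! = c * ((p ^ 2) ^ k * k`!))%N.
  exists ((p ^ 2) ^ (n - k) * (n ^_ (n - k)))%N.
  have := ffact_fact (leq_subr k n); rewrite subKn // => <-.
  by rewrite -{1}(subnK kn) expnD; lia.
by rewrite natrM (naM na) ler_piMl ?(na_ge0 na) ?na_nat.
Qed.

(** Measured in powers of v pi, (p^2)^n n! costs at most 2n(p - 1) + n - 1 out of the available p^2
    n. What remains is n(p - 1)^2 + 1, at least n + 1. *)
Lemma mser_bound n : (0 < n)%N -> v (mser (p ^ 2 * n)%N) <= v pi ^+ n.+1.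
Proof.
move=> n0; have := (mser_rec (p ^ 2 * n)).2 n erefl.
set N := (p ^ 2 * n)%N.
rewrite natrM !natrX (naM na) !naX // (v_natE na pr_p vp (fact_gt0 n)) -v_piE.
rewrite -!exprM -exprD; set e := (_ + _)%N => H.
have le : (e + n.+1 <= N)%N.
  have := logn_fact_le pr_p n0; rewrite /e /N => Hl.
  have pE : p = p.-1.+1 by rewrite prednK.
  move: Hl; set l := logn _ _; set q := p.-1 in pE *; rewrite pE => Hl.
  have : ((q.+1 ^ 2 * n) = q * q * n + 2 * (q * n) + n)%N by nia.
  have : (q * n <= q * q * n)%N by rewrite leq_pmul2r // leq_pmulr // /q -ltnS prednK.
  have : (0 < q)%N by rewrite /q -ltnS prednK.
  nia.
have ve : 0 < v pi ^+ e by rewrite exprn_gt0 ?v_pi_gt0.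
rewrite -(ler_pM2r ve) (le_trans H) // -exprD ler_wiXn2l ?ltW ?v_pi_gt0 ?v_pi_lt1 //.
by rewrite addnC.
Qed.

(** The rate [rho], with rho^(p^2) = v pi, originates here: [mser] lives in degrees p^2 n, with size
    at most (v pi)^n there. The Artin-Hasse factor decays at the better rate v pi. *)
Lemma mser_rho N : v (mser N) <= rho ^+ N.
Proof.
have [/dvdnP[n]|ndv] := boolP (p ^ 2 %| N)%N; last first.
  by rewrite (mser_rec N).1 // (na0 na) exprn_ge0.
rewrite mulnC => ->; have [->|n0] := posnP n.
  by rewrite muln0 /mser (ldserP char0 0 _).1 (na1 na).
rewrite exprM rhoE; apply: le_trans (mser_bound n0) _.
by rewrite ler_wiXn2l ?ltW ?v_pi_gt0 ?v_pi_lt1.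
Qed.

Lemma mser_pi2 N : (0 < N)%N -> v (mser N) <= v pi ^+ 2.
Proof.
move=> N0; have [/dvdnP[n]|ndv] := boolP (p ^ 2 %| N)%N; last first.
  by rewrite (mser_rec N).1 // (na0 na) exprn_ge0 ?(na_ge0 na).
rewrite mulnC => NE; have n0 : (0 < n)%N by move: N0; rewrite NE muln_gt0 => /andP[].
rewrite NE; apply: le_trans (mser_bound n0) _.
by rewrite ler_wiXn2l ?ltW ?v_pi_gt0 ?v_pi_lt1.
Qed.

(** Dwork's splitting function exp(pi T - pi T^p): the entry - p pi at index p is divided by p. *)
Definition dwork : nat -> C := ldser (fun i => pi *+ (i == 1)%N - (p%:R * pi) *+ (i == p)).

(** Since pi^(p-1) = - p, the term (pi T)^p / p equals - pi T^p. So the Artin-Hasse exponent at pi T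
    begins with the two terms of [dwork], and [mser] removes the others. *)
Lemma dworkE N : dwork N = \sum_(i < N.+1) pi ^+ i * ahser C p i * mser (N - i)%N.
Proof.
rewrite /dwork (@eq_ldser _ char0 N _ (fun i => pi ^+ i * (ppow p i)%:R +
   (if ppow p i && (p ^ 2 %| i)%N then - pi ^+ i else 0))).
  rewrite ldser_mul //; apply: eq_bigr => i _; congr (_ * _).
  by rewrite ldser_scale.
move=> i /andP[i0 _]; have [/eqP|npp] := boolP (ppow p i); last first.
  rewrite mulr0 addr0; have [iE|_] := eqVneq i 1%N.
    by case/negP: npp; rewrite iE /ppow logn1 expn0.
  have [iE|_] := eqVneq i p; last by rewrite !mulr0n subrr.
  by case/negP: npp; rewrite iE /ppow logn_prime // eqxx expn1.
case: (logn p i) => [->|[->|k ->]].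
- rewrite expn0 eqxx (_ : (1 == p)%N = false) ?ltn_eqF // mulr1n mulr0n subr0.
  by rewrite dvdn1 (_ : (p ^ 2 == 1)%N = false) ?addr0 ?mulr1 ?expr1 // gtn_eqF // (ltn_exp2l 0).
- rewrite expn1 eqxx mulr1n (_ : (p == 1)%N = false) ?gtn_eqF // mulr0n sub0r mulr1.
  rewrite (_ : (p ^ 2 %| p)%N = false) ?addr0; last first.
    by rewrite -{2}(expn1 p) dvdn_Pexp2l.
  by rewrite -{2}(prednK p_gt0) exprS piE mulrN mulrC.
have n1 : (p ^ k.+2 == 1)%N = false by rewrite gtn_eqF // (ltn_exp2l 0).
have np : (p ^ k.+2 == p)%N = false by rewrite -{2}(expn1 p) eqn_exp2l.
by rewrite dvdn_exp2l // mulr1 subrr n1 np subrr.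
Qed.

Lemma v_pi_rho : v pi <= rho.
Proof.
rewrite -rhoE -{2}(expr1 rho); apply: ler_wiXn2l; case/andP: rho01 => //.
by rewrite expn_gt0 p_gt0.
Qed.

Lemma v_pi_ah i : v (pi ^+ i * ahser C p i) <= v pi ^+ i.
Proof.
rewrite (naM na) naX // ler_piMr ?exprn_ge0 ?(na_ge0 na) //.
exact: ahser_integral.
Qed.

Lemma dwork_bound N : v (dwork N) <= rho ^+ N.
Proof.
rewrite dworkE; apply: na_sum_le => // [|i _]; first exact: exprn_ge0.
have iN : (i <= N)%N by rewrite -ltnS.
have -> : rho ^+ N = rho ^+ i * rho ^+ (N - i) by rewrite -exprD subnKC.
rewrite (naM na); apply: ler_pM; rewrite ?(na_ge0 na) ?mser_rho //.
apply: le_trans (v_pi_ah i) _.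
by rewrite lerXn2r // ?nnegrE ?(na_ge0 na) ?v_pi_rho.
Qed.

Lemma dwork0 : dwork 0 = 1. Proof. exact: (ldserP char0 0 _).1. Qed.

Lemma dwork1 : dwork 1 = pi.
Proof.
have := (ldserP char0 1 (fun i => pi *+ (i == 1)%N - (p%:R * pi) *+ (i == p))).2 0%N isT.
rewrite -/dwork mulr1n big_ord1 dwork0 mulr1 => ->.
by rewrite mulr1n (_ : (1 == p)%N = false) ?ltn_eqF // mulr0n subr0.
Qed.

Lemma dwork_pi2 N : (1 < N)%N -> v (dwork N) <= v pi ^+ 2.
Proof.
move=> N1; rewrite dworkE; apply: na_sum_le => // [|i _].
  by rewrite exprn_ge0 ?(na_ge0 na).
rewrite (naM na) -[leRHS]mul1r -[X in _ <= X](mulrC _ 1).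
have [i1|i1] := ltnP 1 i.
  apply: ler_pM; rewrite ?(na_ge0 na) //.
    by apply: le_trans (v_pi_ah i) _; rewrite ler_wiXn2l ?ltW ?v_pi_gt0 ?v_pi_lt1.
  by apply: le_trans (mser_rho _) _; rewrite exprn_ile1 ?ltW ?rho_lt1.
rewrite mulrC [leRHS]mulrC mulrC [leRHS]mulrC; rewrite [leRHS]mulrC; apply: ler_pM; rewrite ?(na_ge0 na) //.
  by apply: le_trans (v_pi_ah i) _; rewrite exprn_ile1 ?(na_ge0 na) ?ltW ?v_pi_lt1.
by apply: mser_pi2; lia.
Qed.

Definition theta K : {poly C} := \poly_(j < K) dwork j.
Definition expp K : {poly C} := \poly_(j < K) ldser (fun i => (p%:R * pi) *+ (i == 1)%N) j.

Lemma theta_cbound K : cbound v 1 rho (theta K).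
Proof.
move=> j; rewrite coef_poly mul1r; case: ifP => _; first exact: dwork_bound.
by rewrite (na0 na) exprn_ge0.
Qed.

Lemma expp_cbound K : cbound v 1 (v p%:R) (expp K).
Proof.
move=> j; rewrite coef_poly mul1r; case: ifP => _; last first.
  by rewrite (na0 na) exprn_ge0 ?(na_ge0 na).
have := congr1 v (expserE na pr_p vp (p%:R * pi) j).
rewrite (naM na) (naX na) (naM na) exprMn (v_natE na pr_p vp (fact_gt0 j)) -{1}v_piE -exprM => E.
have vl : 0 < v pi ^+ (p.-1 * logn p j`!) by rewrite exprn_gt0 ?v_pi_gt0.
rewrite -(ler_pM2r vl) E ler_wpM2l ?exprn_ge0 ?(na_ge0 na) //.
rewrite ler_wiXn2l ?ltW ?v_pi_gt0 ?v_pi_lt1 //.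
have [->|j0] := posnP j; first by rewrite fact0 logn1 muln0.
by apply: leq_trans (logn_fact_le pr_p j0) _; apply: leq_pred.
Qed.

Lemma vp_rho : v p%:R <= rho ^+ p.
Proof.
rewrite -v_piE -rhoE -exprM ler_wiXn2l ?ltW ?rho_lt1 //.
by rewrite expnS -mulnA leq_pmulr // muln_gt0 expn1 p_gt0 -ltnS prednK.
Qed.

(** As formal series theta^p = exp(p pi T) / exp(p pi T^p). The truncations therefore agree below
    degree K, and from there on the coefficients are at most rho^j. *)
Lemma theta_exp K x : v x <= 1 ->
  v ((theta K).[x] ^+ p * (expp K).[x ^+ p] - (expp K).[x]) <= rho ^+ K.
Proof.
move=> x1.
have -> : (theta K).[x] ^+ p * (expp K).[x ^+ p] - (expp K).[x] =
   ((theta K) ^+ p * (expp K \Po 'X^p) - expp K).[x].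
  by rewrite !hornerE horner_comp !hornerE.
have bp : cbound v 1 (rho ^+ p) (expp K).
  by apply: (cboundW _ _ _ (expp_cbound K)); rewrite ?(na_ge0 na) ?vp_rho.
rewrite -[leRHS]mul1r; apply: cbound_horner => // [|j jK].
  apply: cboundB => //.
    by rewrite -[1]mulr1; apply: cboundM => //; [apply: cboundX => //; apply: theta_cbound|apply: cbound_comp].
  apply: (cboundW _ _ _ bp); rewrite ?exprn_ge0 //.
  by rewrite -[leRHS]expr1 ler_wiXn2l ?ltW ?rho_lt1.
case: K jK {bp} => // K jK; rewrite coefB; apply/eqP; rewrite subr_eq0; apply/eqP.
have lt : logder K (fun i => pi *+ (i == 1)%N - (p%:R * pi) *+ (i == p)) (fun i => (theta K.+1)`_i).
  by apply: eq_logder (ldserP char0 K _) => // i iK; rewrite coef_poly ltnS iK.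
have lg : logder K (fun i => (p%:R * pi) *+ (i == 1)%N) (fun i => (expp K.+1)`_i).
  by apply: eq_logder (ldserP char0 K _) => // i iK; rewrite coef_poly ltnS iK.
apply: (logder_uniq char0 (logderM (logderX p lt) (logder_comp_Xn p_gt0 lg))); last by rewrite -ltnS.
apply: eq_logder lg => // i /andP[i0 _].
have [->|i1] := eqVneq i 1%N.
  rewrite (ltn_eqF p_gt1) dvdn1 (gtn_eqF p_gt1).
  by rewrite !mulr1n mulr0n subr0 addr0 mulr_natl.
have [->|ip] := eqVneq i p.
  by rewrite dvdnn divnn p_gt0 !mulr1n !mulr0n sub0r mulNrn !mulr_natl addNr.
rewrite !mulr0n subrr mul0rn add0r; case: ifP => // /dvdnP[k kE].
rewrite kE mulnK // (_ : (k == 1)%N = false) ?mulr0n ?mulr0 //.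
by apply: contraNF ip => /eqP k1; rewrite kE k1 mul1n.
Qed.

Lemma expp_unit K x : (0 < K)%N -> v x <= 1 -> v (expp K).[x] = 1.
Proof.
move=> K0 x1; have -> : (expp K).[x] = ((expp K).[x] - 1) + 1 by rewrite subrK.
have lt : v ((expp K).[x] - 1) < v 1.
  rewrite (na1 na); apply: le_lt_trans (vp_lt1 pr_p vp).
  have -> : (expp K).[x] - 1 = (expp K - 1).[x] by rewrite !hornerE.
  rewrite -[leRHS]mul1r -[v p%:R]expr1; apply: cbound_horner => //.
  - by rewrite !ltW ?vp_gt0 ?vp_lt1.
  - apply: cboundB => //; first exact: expp_cbound.
    by apply: cbound1; rewrite ?(na_ge0 na).
  case=> // _; rewrite coefB coef_poly K0 coef1 (ldserP char0 0 _).1 subrr //.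
by rewrite (na_isosceles na lt) (na1 na).
Qed.

Lemma theta_le1 K x : v x <= 1 -> v (theta K).[x] <= 1.
Proof.
move=> x1; rewrite -[leRHS](mulr1 1) -[X in _ <= _ * X](expr0 rho).
by apply: cbound_horner => //; apply: theta_cbound.
Qed.

Lemma theta_lin K x : (1 < K)%N -> v x <= 1 ->
  v ((theta K).[x] - (1 + pi * x)) <= v pi ^+ 2.
Proof.
move=> K1 x1.
have -> : (theta K).[x] - (1 + pi * x) = (theta K - (1 + pi *: 'X)).[x].
  by rewrite !hornerE.
rewrite -[leRHS]mulr1 -[X in _ <= _ * X](expr1n _ 0%N); apply: cbound_horner => //.
- by rewrite exprn_ge0 ?(na_ge0 na).
- by rewrite ler01 lexx.
move=> j; rewrite expr1n mulr1 coefB coef_poly coefD coef1 coefZ coefX.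
case: j => [|[|j]].
- by rewrite (ltnW K1) dwork0 mulr0 addr0 subrr (na0 na) exprn_ge0 ?(na_ge0 na).
- by rewrite K1 dwork1 mulr1 add0r subrr (na0 na) exprn_ge0 ?(na_ge0 na).
rewrite mulr0 addr0 subr0; case: ifP => _; first exact: dwork_pi2.
by rewrite (na0 na) exprn_ge0 ?(na_ge0 na).
Qed.

Variable xi : C.
Hypotheses (xiP : xi ^+ p = 1) (xi_pi : v (xi - (1 + pi)) < v pi).

Lemma xi_exp a : v (xi ^+ a - (1 + a%:R * pi)) < v pi.
Proof.
have vxi : v xi = 1.
  by apply/eqP; rewrite -(@eqrXn2 _ p) ?(na_ge0 na) // -naX // xiP (na1 na) expr1n.
elim: a => [|a IH]; first by rewrite expr0 mul0r addr0 subrr (na0 na) v_pi_gt0.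
have -> : xi ^+ a.+1 - (1 + a.+1%:R * pi) = xi * (xi ^+ a - (1 + a%:R * pi)) +
   (xi - (1 + pi)) * (1 + a%:R * pi) + a%:R * pi * pi.
  by rewrite exprS -natr1; ring.
apply: naD_lt => //; first apply: naD_lt => //; rewrite (naM na).
- by rewrite vxi mul1r.
- apply: le_lt_trans xi_pi; rewrite ler_piMr ?(na_ge0 na) //.
  apply: naD_le => //; rewrite ?(na1 na) // (naM na) mulr_ile1 ?(na_ge0 na) ?na_nat //.
  by rewrite ltW ?v_pi_lt1.
- rewrite gtr_pMl ?v_pi_gt0 // (naM na); apply: le_lt_trans v_pi_lt1.
  by rewrite ler_piMl ?(na_ge0 na) ?na_nat.
Qed.

Lemma xi_roots : 'X^p - 1 = \prod_(b < p) ('X - (xi ^+ b)%:P).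
Proof.
have inj : injective (fun b : 'I_p => xi ^+ b).
  move=> a b E; apply/val_inj/eqP; apply/negPn/negP => ab.
  wlog ltab : a b E ab / (a < b)%N.
    by case: (ltngtP a b) => [lt|lt|eq] H; [exact: (H a b) | apply: (H b a) => //; rewrite eq_sym | by case/eqP: ab].
  have : v ((b - a)%:R * pi) < v pi.
    have -> : (b - a)%:R * pi = (xi ^+ a - (1 + a%:R * pi)) - (xi ^+ b - (1 + b%:R * pi)).
      by rewrite E natrB ?(ltnW ltab) //; ring.
    by apply: naB_lt => //; apply: xi_exp.
  rewrite (naM na) (v_coprime na pr_p vp) ?mul1r ?ltxx // gtnNdvd ?subn_gt0 //.
  by apply: leq_ltn_trans (leq_subr _ _) _.
have := @all_roots_prod_XsubC _ ('X^p - 1 : {poly C}) [seq xi ^+ b | b : 'I_p].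
rewrite size_XnsubC // size_map size_enum_ord lead_coefE size_XnsubC //= coefB coefXn eqxx.
rewrite coef1 gtn_eqF // subr0 scale1r big_map big_enum; apply=> //.
  apply/allP => _ /mapP[b _ ->]; rewrite rootE !hornerE.
  by rewrite exprAC xiP expr1n subrr.
by rewrite uniq_rootsE map_inj_uniq ?enum_uniq.
Qed.

(** The p-th power of the product T telescopes cyclically because x^(p^L) = x, so T^p is close to 1.
    As T = 1 + a pi up to smaller terms, each factor T - xi^b of T^p - 1 with b different from a
    modulo p has absolute value v pi; these p - 1 factors together have v p, which is the
    denominator of the bound. *)
Lemma theta_char K L x a : (1 < K)%N -> x ^+ (p ^ L) = x -> v x <= 1 ->
  v (\sum_(t < L) x ^+ (p ^ t) - a%:R) < 1 ->
  v (\prod_(t < L) (theta K).[x ^+ (p ^ t)] - xi ^+ a) <= rho ^+ K / v p%:R.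
Proof.
move=> K1 xL x1 tr.
have vxt t : v (x ^+ (p ^ t)) <= 1 by rewrite naX // exprn_ile1 ?(na_ge0 na).
set T := \prod_(t < L) _.
have T1 : v T <= 1.
  by rewrite na_prod //; apply: prodr_ile1 => t _; rewrite (na_ge0 na) theta_le1.
have Tp : v (T ^+ p - 1) <= rho ^+ K.
  pose G := \prod_(t < L) (expp K).[x ^+ (p ^ t)].
  (* The shift t -> t + 1 permutes the Frobenius orbit of x, its last power being x itself. *)
  have GE : \prod_(t < L) (expp K).[x ^+ (p ^ t) ^+ p] = G.
    rewrite /G; case: L xL {tr T T1 G} => [|L] xL; first by rewrite !big_ord0.
    rewrite [LHS]big_ord_recr [RHS]big_ord_recl /= mulrC; congr (_ * _).
      by rewrite -exprM -expnSr xL expn0 expr1.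
    by apply: eq_bigr => t _; rewrite -exprM -expnSr.
  have vG : v G = 1 by rewrite na_prod // big1 // => t _; apply: expp_unit => //; apply: ltnW.
  have -> : v (T ^+ p - 1) = v ((T ^+ p - 1) * G) by rewrite (naM na) vG mulr1.
  rewrite mulrBl mul1r -{1}GE /T -prodrXl -big_split /=.
  apply: na_prod_sub; rewrite ?exprn_ge0 // => t _.
  - rewrite (naM na) naX // expp_unit ?mulr1 ?exprn_ile1 ?(na_ge0 na) ?theta_le1 ?(ltnW K1) //.
    by rewrite naX // exprn_ile1 ?(na_ge0 na).
  - by rewrite expp_unit // ltnW.
  - exact: theta_exp.
have Tlin : v (T - (1 + a%:R * pi)) < v pi.
  have -> : T - (1 + a%:R * pi) = (T - (1 + pi * \sum_(t < L) x ^+ (p ^ t))) +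
     pi * (\sum_(t < L) x ^+ (p ^ t) - a%:R) by ring.
  apply: naD_lt => //; last by rewrite (naM na) gtr_pMr ?v_pi_gt0.
  apply: (@le_lt_trans _ _ (v pi ^+ 2)); last by rewrite expr2 gtr_pMr ?v_pi_gt0 ?v_pi_lt1.
  rewrite /T -(big_mkord xpredT (fun t => (theta K).[x ^+ (p ^ t)])) -(big_mkord xpredT (fun t => x ^+ (p ^ t))).
  elim: (index_iota 0 L) => [|t s IH].
    by rewrite !big_nil mulr0 addr0 subrr (na0 na) exprn_ge0 ?(na_ge0 na).
  rewrite !big_cons; set A := (theta K).[_]; set B := \prod_(j <- s) _ in IH *.
  set y := x ^+ _; set S := \sum_(j <- s) _ in IH *.
  have vS : v S <= 1 by apply: na_sum_le.
  have -> : A * B - (1 + pi * (y + S)) = A * (B - (1 + pi * S)) +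
     (A - (1 + pi * y)) * (1 + pi * S) + pi ^+ 2 * (y * S) by ring.
  apply: naD_le => //; first apply: naD_le => //; rewrite (naM na).
  - by rewrite -[leRHS]mul1r; apply: ler_pM; rewrite ?(na_ge0 na) ?theta_le1.
  - rewrite -[leRHS]mulr1; apply: ler_pM; rewrite ?(na_ge0 na) ?theta_lin //.
    apply: naD_le => //; rewrite ?(na1 na) // (naM na) mulr_ile1 ?(na_ge0 na) //.
    by rewrite ltW ?v_pi_lt1.
  - rewrite naX // ler_piMr ?exprn_ge0 ?(na_ge0 na) // (naM na) mulr_ile1 ?(na_ge0 na) //.
    exact: vxt.
have b0 : (a %% p < p)%N by rewrite ltn_mod.
have xia : xi ^+ a = xi ^+ Ordinal b0.
  by rewrite /= [in LHS](divn_eq a p) exprD mulnC exprM xiP expr1n mul1r.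
have := congr1 (fun P : {poly C} => v P.[T]) xi_roots; rewrite !hornerE /= horner_prod.
rewrite (bigD1 (Ordinal b0)) //= (naM na) na_prod //.
rewrite (eq_bigr (fun=> v pi)) => [|b ba]; last first.
  rewrite !hornerE.
  have -> : T - xi ^+ b = ((T - (1 + a%:R * pi)) - (xi ^+ b - (1 + b%:R * pi))) + (a%:R - b%:R) * pi.
    by ring.
  have vab : v ((a%:R - b%:R) * pi) = v pi.
    rewrite (naM na) -[RHS]mul1r; congr (_ * _).
    have neq : (a %% p != b %% p)%N.
      by rewrite (modn_small (ltn_ord b)); apply: contraNneq ba => E; apply/eqP/val_inj.
    case: (leqP b a) => [lba|/ltnW lab].
      by rewrite -natrB // (v_coprime na pr_p vp) // -eqn_mod_dvd.
    by rewrite (naB na) -natrB // (v_coprime na pr_p vp) // -eqn_mod_dvd // eq_sym.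
  rewrite na_isosceles // vab; apply: naB_lt => //; exact: xi_exp.
rewrite prodr_const cardC1 card_ord v_piE !hornerE -xia => E.
by rewrite ler_pdivlMr ?vp_gt0 // -E.
Qed.

End Theta.

Section DworkConstant.
Variables (R : realFieldType) (C : closedFieldType) (v : C -> R) (p : nat).
Hypotheses (na : nonarch v) (pr_p : prime p) (vp : v p%:R = p%:R^-1).
Let p_gt1 := prime_gt1 pr_p.
Let p_gt0 := prime_gt0 pr_p.

Lemma nth_root (x : C) n : (0 < n)%N -> exists y, y ^+ n = x.
Proof.
move=> n0; have /closed_rootP[y] : size ('X^n - x%:P : {poly C}) != 1%N.
  by rewrite size_XnsubC // eqSS -lt0n.
by rewrite rootE !hornerE subr_eq0 => /eqP <-; exists y.
Qed.

(** For x = xi - 1, expanding (x + 1)^p = 1 gives x^(p-1) = - p up to smaller terms. If every root z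
    of X^(p-1) + p had distance at least v z from x, the product of these distances would be at
    least v p; so some root is closer, and it is pi. Writing it as w^(n p^2) prepares a p^2-th root
    for the rate of theta and an n-th root to be shared among the variables. *)
Lemma exists_pi xi n : xi ^+ p = 1 -> xi != 1 -> (0 < n)%N ->
  exists w : C, let pi := w ^+ (n * p ^ 2) in
    pi ^+ p.-1 = - p%:R /\ v (xi - (1 + pi)) < v pi.
Proof.
move=> xiP xi1 n0; pose x := xi - 1.
have x0 : x != 0 by rewrite subr_eq0.
have vp0 := vp_gt0 pr_p vp; have vp1 := vp_lt1 pr_p vp.
have vxi : v xi = 1.
  by apply/eqP; rewrite -(@eqrXn2 _ p) ?(na_ge0 na) // -naX // xiP (na1 na) expr1n.
have vx : v x <= 1 by apply: naB_le => //; rewrite ?vxi ?(na1 na).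
have key : v (x ^+ p.-1 + p%:R) <= v p%:R * v x.
  rewrite -(@ler_pM2l _ (v x)) ?(na_gt0 na) // -(naM na) mulrDr -exprS prednK //.
  have -> : x ^+ p + x * p%:R = - \sum_(2 <= i < p) x ^+ i *+ 'C(p, i).
    apply/eqP; rewrite -addr_eq0; apply/eqP.
    have : (x + 1) ^+ p = 1 by rewrite subrK.
    rewrite exprD1n -(big_mkord xpredT (fun i => x ^+ i *+ 'C(p, i))).
    rewrite big_nat_recr // big_ltn // big_ltn //= bin0 bin1 binn expr0 expr1 !mulr1n.
    rewrite -!addrA => E; have {}E : x *+ p + (\sum_(2 <= i < p) x ^+ i *+ 'C(p, i) + x ^+ p) = 0.
      by apply: (addrI 1); rewrite E addr0.
    by rewrite mulr_natr -[RHS]E; ring.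
  rewrite naN // big_seq; apply: na_sum_le => // [|i]; first by rewrite !mulr_ge0 ?(na_ge0 na).
  rewrite mem_index_iota => /andP[i2 ip].
  rewrite -mulr_natl (naM na) mulrCA; apply: ler_pM; rewrite ?(na_ge0 na) //.
    by apply: v_dvdn => //; apply: prime_dvd_bin => //; rewrite (ltnW i2).
  rewrite naX // -expr2; apply: ler_wiXn2l; rewrite ?(na_ge0 na) //.
have vx1 : v x < 1.
  rewrite lt_neqAle vx andbT; apply: contraTneq key => E.
  rewrite E mulr1 -ltNge addrC na_isosceles // naX // E expr1n //.
have lt : v (x ^+ p.-1 + p%:R) < v p%:R by apply: le_lt_trans key _; rewrite gtr_pMr.
pose P : {poly C} := 'X^(p.-1) - (- p%:R)%:P.
have p10 : (0 < p.-1)%N by rewrite -ltnS prednK.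
have [r Pr] := closed_field_poly_normal P.
rewrite lead_coefE size_XnsubC //= coefB coefXn eqxx coefC gtn_eqF // subr0 scale1r in Pr.
have [z zr zx] : exists2 z, z \in r & v (x - z) < v z.
  apply/hasP; apply/negPn/negP => /hasPn H.
  have Px : v P.[x] = v (x ^+ p.-1 + p%:R) by rewrite !hornerE opprK.
  have P0 : v P.[0] = v p%:R by rewrite !hornerE expr0n gtn_eqF // sub0r opprK.
  move: lt; rewrite -Px -P0 Pr !horner_prod !na_prod // ltNge => /negP[].
  rewrite big_seq [leRHS]big_seq; apply: ler_prod => y yr.
  by rewrite !hornerE (na_ge0 na) naN // leNgt H.
have zP : z ^+ p.-1 = - p%:R.
  have : root P z by rewrite Pr root_prod_XsubC.
  by rewrite rootE !hornerE subr_eq0 => /eqP.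
have np0 : (0 < n * p ^ 2)%N by rewrite muln_gt0 n0 expn_gt0 p_gt0.
have [w wE] := nth_root z np0.
by exists w; rewrite wE; split=> //; rewrite opprD addrA.
Qed.

End DworkConstant.

(** * Limits *)

Section Limits.
Variables (R : archiRealFieldType) (C : fieldType) (v : C -> R).
Hypothesis na : nonarch v.

Definition eventually (P : nat -> Prop) := exists N, forall i, (N <= i)%N -> P i.

Definition tends (u : nat -> C) (l : C) : Prop :=
  forall e, 0 < e -> eventually (fun i => v (u i - l) < e).

Definition null (r : nat -> R) : Prop := forall e, 0 < e -> eventually (fun i => r i < e).

Lemma eventuallyI P Q : eventually P -> eventually Q -> eventually (fun i => P i /\ Q i).
Proof.
move=> [M HM] [N HN]; exists (maxn M N) => i; rewrite geq_max => /andP[Mi Ni].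
by split; [apply: HM | apply: HN].
Qed.

Lemma eventuallyW (P Q : nat -> Prop) : (forall i, P i -> Q i) -> eventually P -> eventually Q.
Proof. by move=> PQ [N HN]; exists N => i /HN /PQ. Qed.

Lemma eventually_all (P : nat -> nat -> Prop) M :
  (forall j, (j < M)%N -> eventually (P j)) ->
  eventually (fun i => forall j, (j < M)%N -> P j i).
Proof.
elim: M => [|M IH] H; first by exists 0%N.
have [j jM|N1 H1] := IH _; first by apply: H; apply: ltnW.
have [N2 H2] := H M (ltnSn M); exists (maxn N1 N2) => i.
rewrite geq_max => /andP[i1 i2] j; rewrite ltnS leq_eqVlt => /predU1P[->|jM].
  exact: H2.
exact: H1.
Qed.

Lemma null_exp (r : R) : 0 <= r < 1 -> null (fun i => r ^+ i).
Proof.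
move=> /andP[r0 r1] e e0; have [r00|rn0] := eqVneq r 0.
  by exists 1%N => -[//|i] _; rewrite r00 exprS mul0r.
have rp : 0 < r by rewrite lt_neqAle eq_sym rn0.
pose h := r^-1 - 1; have h0 : 0 < h by rewrite subr_gt0 invf_gt1.
have bern i : 1 + i%:R * h <= r^-1 ^+ i.
  elim: i => [|i IH]; first by rewrite mul0r addr0.
  rewrite exprS (_ : r^-1 = 1 + h); last by rewrite addrC subrK.
  rewrite (_ : r^-1 = 1 + h) in IH; last by rewrite addrC subrK.
  have ih : 0 <= i%:R * h by rewrite mulr_ge0 ?ler0n ?ltW.
  apply: le_trans (_ : (1 + h) * (1 + i%:R * h) <= _); last first.
    by rewrite ler_wpM2l // addr_ge0 ?ltW.
  rewrite -natr1; nra.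
pose N := Num.bound ((e * h)^-1); exists N => i Ni.
have N1 : (e * h)^-1 < N%:R.
  by have := archi_boundP (ltW (_ : 0 < (e * h)^-1)); apply; rewrite invr_gt0 mulr_gt0.
have : e^-1 < r^-1 ^+ i.
  apply: lt_le_trans (bern i); apply: (@lt_le_trans _ _ (N%:R * h)).
    rewrite -ltr_pdivrMr //; by rewrite invfM in N1.
  apply: le_trans (_ : i%:R * h <= _); first by rewrite ler_wpM2r ?ler_nat ?ltW.
  by rewrite lerDr.
by rewrite exprVn ltf_pV2 ?posrE ?exprn_gt0.
Qed.

Lemma tends_cst l : tends (fun=> l) l.
Proof. by move=> e e0; exists 0%N => i _; rewrite subrr na0. Qed.

Lemma eq_tends u w l : eventually (fun i => u i = w i) -> tends u l -> tends w l.
Proof.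
by move=> uw ul e /ul H; apply: eventuallyW (eventuallyI uw H) => i [<-].
Qed.

Lemma tends_null u l r : null r -> (forall i, v (u i - l) <= r i) -> tends u l.
Proof.
by move=> nr H e /nr; apply: eventuallyW => i; apply: le_lt_trans.
Qed.

Lemma tendsD u w l m : tends u l -> tends w m -> tends (fun i => u i + w i) (l + m).
Proof.
move=> ul wm e e0; apply: eventuallyW (eventuallyI (ul e e0) (wm e e0)) => i [H1 H2].
by rewrite opprD addrACA naD_lt.
Qed.

Lemma tendsN u l : tends u l -> tends (fun i => - u i) (- l).
Proof. by move=> ul e /ul; apply: eventuallyW => i; rewrite -opprD (naN na). Qed.

Lemma tends_bounded u l : tends u l -> exists2 b, 0 < b &
  eventually (fun i => v (u i) <= b) /\ v l <= b.
Proof.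
move=> ul; exists (v l + 1); first by rewrite ltr_wpDl ?(na_ge0 na).
split; last by rewrite lerDl.
apply: eventuallyW (ul 1 ltr01) => i H.
rewrite -(subrK l (u i)); apply: naD_le => //; last by rewrite lerDl.
by rewrite (le_trans (ltW H)) // lerDr (na_ge0 na).
Qed.

Lemma tendsM u w l m : tends u l -> tends w m -> tends (fun i => u i * w i) (l * m).
Proof.
move=> ul wm e e0; have [b b0 [ub lb]] := tends_bounded ul.
have [c c0 [wb mb]] := tends_bounded wm.
have eb : 0 < e / (b + c) by rewrite divr_gt0 ?addr_gt0.
apply: eventuallyW (eventuallyI ub (eventuallyI (ul _ eb) (wm _ eb))) => i [ui [H1 H2]].
have -> : u i * w i - l * m = u i * (w i - m) + (u i - l) * m by ring.
have le : e / (b + c) * (b + c) = e by rewrite divfK // gt_eqF ?addr_gt0.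
apply: naD_lt => //; rewrite (naM na) -le.
  rewrite mulrC; apply: le_lt_trans (_ : v (w i - m) * (b + c) < _).
    by rewrite ler_wpM2l ?(na_ge0 na) // (le_trans ui) // lerDl ltW.
  by rewrite ltr_pM2r ?addr_gt0.
apply: le_lt_trans (_ : v (u i - l) * (b + c) < _).
  by rewrite ler_wpM2l ?(na_ge0 na) // (le_trans mb) // lerDr ltW.
by rewrite ltr_pM2r ?addr_gt0.
Qed.

Lemma tends_sum (I : Type) (s : seq I) (P : pred I) (u : I -> nat -> C) (l : I -> C) :
  (forall j, P j -> tends (u j) (l j)) ->
  tends (fun i => \sum_(j <- s | P j) u j i) (\sum_(j <- s | P j) l j).
Proof.
move=> H; elim: s => [|j s IH].
  by rewrite big_nil; apply: eq_tends (tends_cst 0); exists 0%N => i _; rewrite big_nil.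
rewrite big_cons; case: ifP => Pj.
  apply: eq_tends (tendsD (H j Pj) IH); exists 0%N => i _; by rewrite big_cons Pj.
by apply: eq_tends IH; exists 0%N => i _; rewrite big_cons Pj.
Qed.

Lemma tends_uniq u l m : tends u l -> tends u m -> l = m.
Proof.
move=> ul um; apply/eqP; rewrite -subr_eq0 -(na_eq0 na) eq_le (na_ge0 na) andbT.
rewrite leNgt; apply/negP => lm0.
have [N HN] := eventuallyI (ul _ lm0) (um _ lm0).
have [H1 H2] := HN N (leqnn N); have : v (l - m) < v (l - m).
  rewrite [X in v X < _](_ : _ = (u N - m) - (u N - l)); last by ring.
  exact: naB_lt.
by rewrite ltxx.
Qed.

Lemma tends_le u l b : tends u l -> eventually (fun i => v (u i) <= b) -> v l <= b.
Proof.
move=> ul ub; rewrite leNgt; apply/negP => lb.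
have b0 : 0 <= b by have [N HN] := ub; apply: le_trans (HN N (leqnn N)); exact: na_ge0.
have l0 : 0 < v l by apply: le_lt_trans lb.
have [N HN] := eventuallyI (ul _ l0) ub; have [H1 H2] := HN N (leqnn N).
have : v l < v l.
  rewrite -{1}(subKr (u N) l); apply: naB_lt => //.
  exact: le_lt_trans H2 lb.
by rewrite ltxx.
Qed.

Lemma tends_sub u l (phi : nat -> nat) : (forall i, (i <= phi i)%N) ->
  tends u l -> tends (fun i => u (phi i)) l.
Proof.
by move=> hphi ul e /ul[N HN]; exists N => i Ni; apply: HN; apply: leq_trans (hphi i).
Qed.

Lemma ldser_tends (char0 : forall n, n.+1%:R != 0 :> C) (u : nat -> nat -> C) (w : nat -> C) :
  (forall m, (0 < m)%N -> tends (fun s => u s m) (w m)) ->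
  forall N, tends (fun s => ldser (u s) N) (ldser w N).
Proof.
move=> H; elim/ltn_ind => -[_|N IH].
  rewrite (ldserP char0 0 _).1; apply: eq_tends (tends_cst 1); exists 0%N => i _.
  by rewrite (ldserP char0 0 _).1.
have E (x : nat -> C) : ldser x N.+1 = (\sum_(i < N.+1) x i.+1 * ldser x (N - i)%N) * N.+1%:R^-1.
  by rewrite -(ldserP char0 N.+1 x).2 // -[_ *+ _]mulr_natr mulfK.
rewrite E; apply: eq_tends (_ : tends (fun s => (\sum_(i < N.+1) u s i.+1 * ldser (u s) (N - i)%N) * N.+1%:R^-1) _).
  by exists 0%N => i _; rewrite E.
apply: tendsM (tends_cst _); apply: tends_sum => i _; apply: tendsM; first exact: H.
by apply: IH; rewrite ltnS leq_subr.
Qed.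

Hypothesis complete : forall u : nat -> C,
  (forall e, 0 < e -> exists N, forall i j, (N <= i)%N -> (N <= j)%N -> v (u i - u j) < e) ->
  exists l, tends u l.

Lemma series_cvg (u : nat -> C) (b : nat -> R) : null b -> (forall i, v (u i) <= b i) ->
  exists l, tends (fun n => \sum_(i < n) u i) l.
Proof.
move=> b0 ub; apply: complete => e e0; have [N HN] := b0 e e0; exists N.
suff H i j : (N <= i)%N -> (i <= j)%N -> v (\sum_(k < i) u k - \sum_(k < j) u k) < e.
  move=> i j Ni Nj; case: (leqP i j) => [ij|/ltnW ji]; first exact: H.
  by rewrite naB //; apply: H.
move=> Ni ij; rewrite naB //.
rewrite -(big_mkord xpredT u) -(big_mkord xpredT u) (big_cat_nat _ ij) //= addrAC subrr add0r.
rewrite big_seq; apply: na_sum_lt => // k; rewrite mem_index_iota => /andP[ik _].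
by apply: le_lt_trans (ub k) _; apply: HN; apply: leq_trans ik.
Qed.

(** A nonarchimedean tail is small as soon as its terms are, so a common bound b disposes of the
    indices beyond some n, and termwise convergence of the first n terms suffices even though the
    length [k s] grows. *)
Lemma dominated_cvg (f : nat -> nat -> C) (b : nat -> R) (k : nat -> nat) :
  null b -> (forall s, (s <= k s)%N) ->
  (forall s i, (i < k s)%N -> v (f s i) <= b i) -> (forall i, exists l, tends (fun s => f s i) l) ->
  exists l, tends (fun s => \sum_(i < k s) f s i) l.
Proof.
move=> b0 sk fb fl; have [g fg] := choice fl.
have gb i : v (g i) <= b i.
  apply: tends_le (fg i) _; exists i.+1 => s si; apply: fb; exact: leq_trans (sk s).
have [G gG] := series_cvg b0 gb.
exists G => e e0; have [N HN] := b0 e e0.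
have [M1 H1] := gG e e0.
pose n := maxn N M1.
have := eventually_all (M := n) (P := fun i s => v (f s i - g i) < e) (fun i _ => fg i e e0).
move=> [M2 H2]; exists (maxn n M2) => s; rewrite geq_max => /andP[ns M2s].
have nk : (n <= k s)%N by apply: leq_trans (sk s).
have -> : \sum_(i < k s) f s i - G = (\sum_(i < n) g i - G) + \sum_(i < n) (f s i - g i) +
    \sum_(n <= i < k s) f s i.
  rewrite -(big_mkord xpredT (f s)) (big_cat_nat _ nk) //= sumrB big_mkord; ring.
apply: naD_lt => //; first apply: naD_lt => //.
- by apply: H1; rewrite leq_maxr.
- by apply: na_sum_lt => // i _; apply: H2.
- rewrite big_seq; apply: na_sum_lt => // i; rewrite mem_index_iota => /andP[ni ik].
  apply: le_lt_trans (fb s i ik) _; apply: HN; apply: leq_trans ni; exact: leq_maxl.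
Qed.

Variable a0 : C.
Hypothesis va0 : v a0 = 1.
Hypothesis char0 : forall n, n.+1%:R != 0 :> C.

Lemma ldser_addX (w : nat -> C) k :
  ldser (fun r => a0 ^+ r + w r) k = \sum_(i < k.+1) a0 ^+ (k - i) * ldser w i.
Proof.
rewrite ldser_mul // /ps_mul (reindex_inj rev_ord_inj) /=; apply: eq_bigr => i _.
rewrite subSS -(ldser_eq char0 (logder_geom k a0)) ?leq_subr //.
by rewrite subKn // -ltnS.
Qed.

(** The coefficient of T^k in W(T) / (1 - a0 T) is a0^k times the partial sum of a0^(-i) W_i. The
    partial sums converge, so along k_s - j everything depends on the limit of a0^(k_s). *)
Lemma ldser_unit_cvg (w : nat -> C) (eta : R) (k : nat -> nat) (A : C) : 0 <= eta < 1 ->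
  (forall i, v (ldser w i) <= eta ^+ i) -> (forall s, (s <= k s)%N) ->
  tends (fun s => a0 ^+ k s) A ->
  forall j, exists l, tends (fun s => ldser (fun r => a0 ^+ r + w r) (k s - j)) l.
Proof.
move=> eta1 wb sk aA j.
have a00 : a0 != 0 by rewrite -(na_gt0 na) va0.
have [l ll] : exists l, tends (fun s => \sum_(i < (k s - j).+1) a0 ^- i * ldser w i) l.
  have [|l ll] := @series_cvg (fun i => a0 ^- i * ldser w i) _ (null_exp eta1).
    by move=> i; rewrite (naM na) naV // naX // va0 expr1n invr1 mul1r.
  exists l; move=> e /ll[N HN]; exists (N + j)%N => s Ns; apply: HN.
  have := sk s; lia.
exists (A * a0 ^- j * l).
apply: eq_tends (tendsM (tendsM aA (tends_cst (a0 ^- j))) ll).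
exists j.+1 => s js; have jk : (j < k s)%N by apply: leq_trans (sk s).
rewrite ldser_addX mulr_sumr; apply: eq_bigr => i _.
have ik : (i <= k s - j)%N by rewrite -ltnS.
have -> : a0 ^+ k s = a0 ^+ (k s - j - i) * a0 ^+ i * a0 ^+ j.
  by rewrite -!exprD subnK // subnK // ltnW.
by rewrite mulfK ?expf_neq0 // mulrA mulfK ?expf_neq0.
Qed.

(* If u_r = u'_r / (1 - q^r) then F(t) = F'(t) F(q t) for the associated series. *)
Lemma ldser_twist (u w : nat -> C) (q : C) (eta : R) : 0 <= eta < 1 -> v q <= eta ->
  (forall r, (0 < r)%N -> (1 - q ^+ r) * w r = u r) ->
  (forall i, v (ldser u i) <= eta ^+ i) -> forall i, v (ldser w i) <= eta ^+ i.
Proof.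
move=> /andP[eta0 eta1] qeta uw ub.
have q1 r : (0 < r)%N -> v (1 - q ^+ r) = 1.
  move=> r0; rewrite addrC na_isosceles ?na1 // naN // naX //.
  by rewrite exprn_ilt1 ?(na_ge0 na) -?lt0n // (le_lt_trans qeta).
elim/ltn_ind => -[_|N IH]; first by rewrite (ldserP char0 0 _).1 na1.
have E : ldser w N.+1 = \sum_(i < N.+2) ldser u i * (q ^+ (N.+1 - i) * ldser w (N.+1 - i)).
  rewrite (@eq_ldser _ char0 N.+1 w (fun r => u r + q ^+ r * w r)).
    by rewrite ldser_mul //; apply: eq_bigr => i _; rewrite ldser_scale.
  by move=> i /andP[i0 _]; rewrite -uw // mulrBl mul1r subrK.
have {}E : (1 - q ^+ N.+1) * ldser w N.+1 =
    \sum_(i < N.+1) ldser u i.+1 * (q ^+ (N - i) * ldser w (N - i)).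
  rewrite mulrBl mul1r {1}E big_ord_recl subn0 (ldserP char0 0 _).1 mul1r addrC addKr.
  by apply: eq_bigr => i _; rewrite lift0 subSS.
rewrite -[v (ldser _ _)]mul1r -(q1 N.+1 isT) -(naM na) E.
apply: na_sum_le => // [|i _]; first exact: exprn_ge0.
have iN : (i <= N)%N by rewrite -ltnS.
have -> : eta ^+ N.+1 = eta ^+ i.+1 * eta ^+ (N - i) by rewrite -exprD addSn subnKC.
rewrite (naM na); apply: ler_pM; rewrite ?(na_ge0 na) // (naM na).
rewrite -[leRHS]mul1r; apply: ler_pM; rewrite ?(na_ge0 na) //.
  by rewrite naX // exprn_ile1 ?(na_ge0 na) // (le_trans qeta) // ltW.
by apply: IH; rewrite ltnS leq_subr.
Qed.

End Limits.

(** * Residue field and Teichmuller representatives *)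

Lemma comring_field (K : comNzRingType) :
  (forall x : K, x != 0 -> exists y, y * x = 1) ->
  exists (k : fieldType) (f : {rmorphism K -> k}), bijective f.
Proof.
move=> H.
pose inv (x : K) := if pselect (exists y, y * x = 1) is left e then projT1 (cid e) else 0.
have mulVx (x : K) : x != 0 -> inv x * x = 1.
  by rewrite /inv => /H; case: pselect => // e _; exact: projT2 (cid e).
have inv0 : inv 0 = 0.
  rewrite /inv; case: pselect => // e; have := projT2 (cid e).
  by rewrite mulr0 => /esym/eqP; rewrite oner_eq0.
pose k : fieldType := HB.pack K (GRing.ComNzRing_isField.Build K mulVx inv0).
by exists k, (idfun : {rmorphism K -> K}); exists id.
Qed.

Section ResidueField.
Local Open Scope quotient_scope.
Variables (R : realFieldType) (C : closedFieldType) (v : C -> R).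
Hypothesis na : nonarch v.

Definition vint : {pred C} := fun x => v x <= 1.
Fact vint_closed : subring_closed vint.
Proof.
split; first by rewrite unfold_in (na1 na).
  by move=> x y; rewrite !unfold_in; apply: naB_le.
move=> x y; rewrite !unfold_in (naM na) => x1 y1.
by rewrite mulr_ile1 ?(na_ge0 na).
Qed.
HB.instance Definition _ := GRing.isSubringClosed.Build C vint vint_closed.

Record vring := VRing { vval : C; vvalP : vval \in vint }.
HB.instance Definition _ := [isSub for vval].
HB.instance Definition _ := [Choice of vring by <:].
HB.instance Definition _ := [SubChoice_isSubComNzRing of vring by <:].

Definition vmax : {pred vring} := fun x => v (vval x) < 1.
Fact vmax_closed : idealr_closed vmax.
Proof.
split; rewrite ?unfold_in /= ?(na0 na) ?ltr01 ?(na1 na) ?ltxx //.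
move=> a x y; rewrite !unfold_in => x1 y1; apply: naD_lt => //.
rewrite (naM na); apply: le_lt_trans x1.
by rewrite ler_piMl ?(na_ge0 na) //; exact: vvalP.
Qed.
HB.instance Definition _ := isIdealr.Build vring vmax vmax_closed.

(** The quotient of the valuation ring by its maximal ideal is handed over as a field with a map
    [red] defined on all of C (zero outside the ring), so later arguments need not mention the
    quotient. *)
Lemma residue_fieldP : exists (k : fieldType) (red : C -> k),
  [/\ red 1 = 1,
      forall x y, v x <= 1 -> v y <= 1 -> red (x + y) = red x + red y,
      forall x y, v x <= 1 -> v y <= 1 -> red (x * y) = red x * red y,
      forall x, v x <= 1 -> (red x == 0) = (v x < 1)
    & forall a, exists2 x, v x <= 1 & red x = a].
Proof.
pose K : comNzRingType := {ideal_quot vmax}.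
have K0 (x : vring) : (\pi_K x == 0 :> K) = (v (vval x) < 1)%R.
  transitivity (\pi_K x == \pi_K 0 :> K); first by rewrite rmorph0.
  by rewrite -Quotient.idealrBE subr0.
have inv (x : K) : x != 0 -> exists y, y * x = 1.
  rewrite -[x]reprK; set y := generic_quotient.repr x; rewrite K0 -leNgt => y1.
  have vy : v (vval y) = 1 by apply/eqP; rewrite eq_le y1 andbT; exact: vvalP.
  have y0 : vval y != 0 by rewrite -(na_gt0 na) vy.
  have yi : (vval y)^-1 \in vint by rewrite unfold_in naV // vy invr1.
  exists (\pi_K (VRing yi)); rewrite -rmorphM /= -[RHS](rmorph1 (\pi_K : {rmorphism vring -> K})).
  by congr (\pi_K _); apply: val_inj => /=; rewrite mulVf.
have [k [f [g gf fg]]] := comring_field inv.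
pose red (x : C) : k := if insub x is Some y then f (\pi_K (y : vring)) else 0.
have redE x (x1 : v x <= 1) : red x = f (\pi_K (VRing (x1 : x \in vint))).
  by rewrite /red insubT.
exists k, red; split.
- have i1 : v 1 <= 1 by rewrite (na1 na).
  rewrite (redE _ i1) -[RHS](rmorph1 f) -[in RHS](rmorph1 (\pi_K : {rmorphism vring -> K})).
  by congr (f (\pi_K _)); apply: val_inj.
- move=> x y x1 y1; have xy1 : v (x + y) <= 1 by apply: naD_le.
  rewrite (redE _ x1) (redE _ y1) (redE _ xy1) -!rmorphD /=.
  by congr (f (\pi_K _)); apply: val_inj.
- move=> x y x1 y1; have xy1 : v (x * y) <= 1.
    by rewrite (naM na) mulr_ile1 ?(na_ge0 na).
  rewrite (redE _ x1) (redE _ y1) (redE _ xy1) -!rmorphM /=.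
  by congr (f (\pi_K _)); apply: val_inj.
- by move=> x x1; rewrite (redE _ x1) -(rmorph0 f) (can_eq gf) K0.
- move=> a; exists (vval (generic_quotient.repr (g a))); first exact: vvalP.
  have x1 := vvalP (generic_quotient.repr (g a)).
  rewrite (redE _ x1) -[RHS]fg -[in RHS](reprK (g a)).
  by congr (f (\pi_K _)); apply: val_inj.
Qed.

End ResidueField.

Section Teichmuller.
Variables (R : realFieldType) (C : closedFieldType) (v : C -> R) (p : nat).
Hypotheses (na : nonarch v) (pr_p : prime p) (vp : v p%:R = p%:R^-1).
Let p_gt1 := prime_gt1 pr_p.
Let p_gt0 := prime_gt0 pr_p.

(** With d = x - y, every term of (d + y)^p - y^p contains d and, besides it, either another d or a
    binomial coefficient divisible by p. *)
Lemma pow_p_contract x y c : v y <= 1 -> v (x - y) <= c -> v p%:R <= c -> c <= 1 ->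
  v (x ^+ p - y ^+ p) <= c * v (x - y).
Proof.
move=> y1; set d := x - y => dc pc c1.
have c0 : 0 <= c by apply: le_trans pc; apply: na_ge0.
have -> : x = d + y by rewrite subrK.
rewrite exprDn big_ord_recl /= subn0 expr0 mulr1 bin0 mulr1n -addrA.
case: p pr_p pc => // q pr_q pc; apply: naD_le => //.
  rewrite exprS (naM na) mulrC ler_wpM2r ?(na_ge0 na) // naX //.
  case: q pr_q pc => // q _ _; rewrite exprS -[leRHS]mulr1; apply: ler_pM; rewrite ?exprn_ge0 ?(na_ge0 na) //.
  by rewrite exprn_ile1 ?(na_ge0 na) // (le_trans dc).
rewrite big_ord_recr /= /bump !leq0n !add1n subnn expr0 mul1r binn mulr1n addrK.
apply: na_sum_le => // [|i _]; first by rewrite mulr_ge0 ?(na_ge0 na).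
rewrite /bump leq0n add1n -mulr_natr (naM na) mulrC; apply: ler_pM; rewrite ?(na_ge0 na) //.
  apply: le_trans pc; apply: v_dvdn => //; apply: prime_dvd_bin => //=; have := ltn_ord i; lia.
have iq := ltn_ord i.
rewrite (naM na) (_ : (q.+1 - i.+1 = (q - i.+1).+1)%N); last by lia.
rewrite exprS (naM na) -mulrA ler_piMr ?(na_ge0 na) //.
rewrite !(naX na) mulr_ile1 ?exprn_ge0 ?(na_ge0 na) ?exprn_ile1 ?(na_ge0 na) //.
exact: le_trans c1.
Qed.

(** Taking p^L-th powers leaves the difference unchanged, whereas each p-th power would strictly
    shrink a nonzero one. *)
Lemma teich_uniq L x y : (0 < L)%N -> x ^+ (p ^ L) = x -> y ^+ (p ^ L) = y ->
  v x <= 1 -> v y <= 1 -> v (x - y) < 1 -> x = y.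
Proof.
move=> L0 xL yL x1 y1 xy; apply/eqP; rewrite -subr_eq0 -(na_eq0 na) eq_le (na_ge0 na) andbT.
rewrite leNgt; apply/negP => d0.
pose c := Num.max (v p%:R) (v (x - y)).
have c1 : c < 1 by rewrite gt_max xy (vp_lt1 pr_p vp).
have H : v (x ^+ p - y ^+ p) <= c * v (x - y).
  by apply: pow_p_contract; rewrite ?le_max ?lexx ?orbT // ltW.
have : v (x - y) < v (x - y).
  rewrite -{1}xL -{1}yL -(prednK L0) expnS !exprM.
  apply: le_lt_trans (_ : c * v (x - y) < _); last by rewrite gtr_pMl.
  by apply: na_exp_sub => //; rewrite naX // exprn_ile1 ?(na_ge0 na).
by rewrite ltxx.
Qed.

Lemma pow_pM x (c : R) M : v x <= 1 -> v (x - 1) <= c -> v p%:R <= c -> c <= 1 ->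
  v (x ^+ (p ^ M) - 1) <= c ^+ M.+1.
Proof.
move=> x1 xc pc c1; have c0 : 0 <= c by apply: le_trans pc; apply: na_ge0.
elim: M => [|M IH]; first by rewrite expn0 !expr1.
rewrite expnSr exprM -(expr1n _ p) exprS.
apply: le_trans (_ : c * v (x ^+ (p ^ M) - 1) <= _).
  apply: pow_p_contract; rewrite ?(na1 na) // (le_trans IH) // exprS ler_piMr //.
  by rewrite exprn_ile1.
by rewrite ler_wpM2l.
Qed.

Variables (k : fieldType) (red : C -> k).
Hypotheses (red1 : red 1 = 1)
  (redD : forall x y, v x <= 1 -> v y <= 1 -> red (x + y) = red x + red y)
  (redM : forall x y, v x <= 1 -> v y <= 1 -> red (x * y) = red x * red y)
  (red_eq0 : forall x, v x <= 1 -> (red x == 0) = (v x < 1))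
  (red_surj : forall a, exists2 x, v x <= 1 & red x = a).

Lemma red0 : red 0 = 0.
Proof. by apply/eqP; rewrite red_eq0 (na0 na) ?ler01 ?ltr01. Qed.

Lemma redN x : v x <= 1 -> red (- x) = - red x.
Proof.
move=> x1; apply/eqP; rewrite -addr_eq0 -redD ?naN //.
by rewrite addNr red0.
Qed.

Lemma redX x n : v x <= 1 -> red (x ^+ n) = red x ^+ n.
Proof.
move=> x1; elim: n => [|n IH]; first by rewrite !expr0.
by rewrite !exprS redM ?IH // naX // exprn_ile1 ?(na_ge0 na).
Qed.

Lemma red_eq x y : v x <= 1 -> v y <= 1 -> (red x == red y) = (v (x - y) < 1).
Proof.
move=> x1 y1; rewrite -subr_eq0 -redN // -redD ?naN // red_eq0 //.
exact: naB_le.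
Qed.

Lemma red_sum (I : Type) (s : seq I) (F : I -> C) : (forall i, v (F i) <= 1) ->
  red (\sum_(i <- s) F i) = \sum_(i <- s) red (F i).
Proof.
move=> F1; elim: s => [|i s IH]; first by rewrite !big_nil red0.
rewrite !big_cons redD ?IH //; exact: na_sum_le.
Qed.

Lemma red_nat n : red n%:R = n%:R.
Proof.
elim: n => [|n IH]; first exact: red0.
by rewrite -!natr1 redD ?IH ?red1 ?na_nat ?(na1 na).
Qed.

Lemma k_pchar : p \in [pchar k].
Proof.
rewrite inE pr_p -red_nat red_eq0 ?na_nat //; exact: vp_lt1.
Qed.

(** A monic lift has a root in C, and it is integral: for a root of absolute value above 1 the
    leading term would dominate. Its reduction is the desired root. *)
Lemma k_closed (P : {poly k}) : size P != 1%N -> exists z, root P z.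
Proof.
have [->|P0] := eqVneq P 0; first by exists 0; rewrite root0.
move=> sP; pose n := (size P).-1.
have sPn : size P = n.+1 by rewrite prednK // lt0n size_poly_eq0.
have n0 : (0 < n)%N by move: sP; rewrite sPn eqSS -lt0n.
have [lift [lift1 liftP]] : exists lift : k -> C,
    (forall a, v (lift a) <= 1) /\ (forall a, red (lift a) = a).
  have := choice (fun a => (let: ex_intro2 x H1 H2 := red_surj a in
    ex_intro (fun x => v x <= 1 /\ red x = a) x (conj H1 H2))).
  by move=> [l H]; exists l; split=> a; case: (H a).
pose Q : {poly C} := 'X^n + \poly_(i < n) lift (P`_i / lead_coef P).
have szq : (size (\poly_(i < n) lift (P`_i / lead_coef P)) < size ('X^n : {poly C}))%N.
  by rewrite size_polyXn ltnS size_poly.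
have sQ : size Q = n.+1 by rewrite size_polyDl // size_polyXn.
have [w rw] : exists w, root Q w by apply/closed_rootP; rewrite sQ eqSS -lt0n.
have Qw : w ^+ n = - \sum_(i < n) lift (P`_i / lead_coef P) * w ^+ i.
  move: rw; rewrite rootE hornerD hornerXn addrC addr_eq0 horner_poly => /eqP ->.
  by rewrite opprK.
have w1 : v w <= 1.
  rewrite leNgt; apply/negP => w1.
  have : v (w ^+ n) <= v w ^+ n.-1.
    rewrite Qw naN //; apply: na_sum_le => // [|i _]; first by rewrite exprn_ge0 ?(na_ge0 na).
    rewrite (naM na) naX // -[leRHS]mul1r; apply: ler_pM; rewrite ?exprn_ge0 ?(na_ge0 na) //.
    by apply: ler_weXn2l; [exact: ltW | have := ltn_ord i; lia].
  by rewrite naX // ler_eXn2l //; lia.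
exists (red w).
rewrite rootE horner_coef sPn big_ord_recr /=.
have lc : P`_n = lead_coef P by rewrite lead_coefE.
have lc0 : lead_coef P != 0 by rewrite lead_coef_eq0.
have := congr1 red Qw; rewrite redX // redN ?red_sum; last first.
- by apply: na_sum_le => // i _; rewrite (naM na) mulr_ile1 ?(na_ge0 na) // naX // exprn_ile1 ?(na_ge0 na).
- by move=> i; rewrite (naM na) mulr_ile1 ?(na_ge0 na) // naX // exprn_ile1 ?(na_ge0 na).
move=> E; rewrite lc E mulrN mulr_sumr subr_eq0; apply/eqP; apply: eq_bigr => i _.
rewrite redM // ?liftP ?redX //; first by rewrite mulrA mulrCA mulfV // mulr1.
by rewrite naX // exprn_ile1 ?(na_ge0 na).
Qed.

(** In place of Hensel's lemma: X^q - X splits in C and is small at a lift y of z, so one of its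
    factors y - x is small. *)
Lemma teich_exists (z : k) q : (1 < q)%N -> z ^+ q = z ->
  exists x, [/\ x ^+ q = x, v x <= 1 & red x = z].
Proof.
move=> q1 zq; have [y y1 yz] := red_surj z.
have q0 : (0 < q)%N := ltnW q1.
pose P : {poly C} := 'X^q - 'X.
have sP : size P = q.+1 by rewrite size_polyDl ?size_polyXn // size_polyN size_polyX.
have lP : lead_coef P = 1.
  by rewrite lead_coefE sP /= coefB coefXn eqxx coefX (gtn_eqF q1) subr0.
have [r Pr] := closed_field_poly_normal P; rewrite lP scale1r in Pr.
have [x xr xy] : exists2 x, x \in r & v (y - x) < 1.
  apply/hasP; apply/negPn/negP => /hasPn H.
  have : v P.[y] < 1.
    rewrite !hornerE -red_eq0; last by apply: naB_le => //; rewrite naX // exprn_ile1 ?(na_ge0 na).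
    rewrite redD ?naN ?redN ?redX ?yz ?zq ?subrr //.
    by rewrite naX // exprn_ile1 ?(na_ge0 na).
  rewrite Pr horner_prod na_prod // ltNge => /negP[].
  rewrite big_seq; elim/big_rec: _ => // x e xr e1.
  by rewrite -[leLHS]mulr1; apply: ler_pM => //; rewrite hornerXsubC leNgt H.
have xq : x ^+ q = x.
  have : root P x by rewrite Pr root_prod_XsubC.
  by rewrite rootE !hornerE subr_eq0 => /eqP.
have x1 : v x <= 1 by rewrite -(subKr y x); apply: naB_le => //; apply: ltW.
by exists x; split=> //; rewrite -yz; apply/eqP; rewrite red_eq // naB.
Qed.

Section FiniteField.
Variables (E : finFieldType) (L : nat) (eps : {rmorphism E -> k}).
Hypotheses (cardE : #|E| = (p ^ L)%N) (L_gt0 : (0 < L)%N).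

Lemma teichP : exists tau : E -> C, forall x,
  [/\ tau x ^+ (p ^ L) = tau x, v (tau x) <= 1 & red (tau x) = eps x].
Proof.
have H x : exists t, [/\ t ^+ (p ^ L) = t, v t <= 1 & red t = eps x].
  apply: teich_exists; last by rewrite -rmorphXn -cardE expf_card.
  by rewrite -(expn0 p) ltn_exp2l.
by have [tau tauP] := choice H; exists tau.
Qed.

Definition teich : E -> C := projT1 (cid teichP).

Lemma teich_pow x : teich x ^+ (p ^ L) = teich x.
Proof. by have [] := projT2 (cid teichP) x. Qed.
Lemma teich_le1 x : v (teich x) <= 1.
Proof. by have [] := projT2 (cid teichP) x. Qed.
Lemma teich_red x : red (teich x) = eps x.
Proof. by have [] := projT2 (cid teichP) x. Qed.

Lemma teich_eq x y : y ^+ (p ^ L) = y -> v y <= 1 -> red y = eps x -> y = teich x.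
Proof.
move=> yL y1 yx; apply: (teich_uniq L_gt0 yL (teich_pow x) y1 (teich_le1 x)).
by rewrite -red_eq ?teich_le1 // teich_red yx.
Qed.

Lemma teichM x y : teich (x * y) = teich x * teich y.
Proof.
apply/esym/teich_eq.
- by rewrite exprMn !teich_pow.
- by rewrite (naM na) mulr_ile1 ?(na_ge0 na) ?teich_le1.
- by rewrite redM ?teich_le1 // !teich_red rmorphM.
Qed.

Lemma teich1 : teich 1 = 1.
Proof. by apply/esym/teich_eq; rewrite ?expr1n ?(na1 na) // red1 rmorph1. Qed.

Lemma teich_eq0 x : (teich x == 0) = (x == 0).
Proof.
apply/eqP/eqP => [x0|->].
  by apply/eqP; rewrite -(fmorph_eq0 eps) -teich_red x0 red0.
apply/esym/teich_eq; rewrite ?(na0 na) ?red0 ?rmorph0 //.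
by rewrite expr0n expn_eq0 (gtn_eqF p_gt0).
Qed.

Lemma teichV x : teich x^-1 = (teich x)^-1.
Proof.
have [->|x0] := eqVneq x 0.
  have /eqP -> : teich 0 == 0 by rewrite teich_eq0.
  rewrite invr0; have /eqP -> : teich 0 == 0 by rewrite teich_eq0.
  by rewrite invr0.
have t0 : teich x != 0 by rewrite teich_eq0.
by apply: (mulIf t0); rewrite -teichM !mulVf // teich1.
Qed.

Lemma teich_inj : injective teich.
Proof. by move=> x y E'; apply: (fmorph_inj eps); rewrite -!teich_red E'. Qed.

(** If q - 1 does not divide w, some g has a w-th power different from 1, since otherwise X^r - 1,
    with r the remainder of w, would have too many roots. Translation by g permutes the sum and
    forces it to vanish. *)
Lemma teich_orth (w : int) : \sum_(x : {x : E | x != 0}) teich (val x) ^ w =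
  if ((p ^ L - 1)%N %| w)%Z then (p ^ L - 1)%:R else 0.
Proof.
have pL1 : (1 < p ^ L)%N by rewrite -(expn0 p) ltn_exp2l.
set q1 := (p ^ L - 1)%N; have q10 : (0 < q1)%N by rewrite subn_gt0.
have tq1 (x : E) : x != 0 -> teich x ^+ q1 = 1.
  move=> x0; have t0 : teich x != 0 by rewrite teich_eq0.
  by apply: (mulIf t0); rewrite -exprSr /q1 subn1 prednK ?teich_pow ?mul1r // ltnW.
have cZ : #|{: {x : E | x != 0}}| = q1.
  rewrite card_sig (eq_card (B := predC1 (0 : E))) ?cardC1 ?cardE /q1 ?subn1 //.
case: ifP => [/dvdzP[l ->]|ndv].
  rewrite (eq_bigr (fun=> 1)) ?sumr_const ?cZ // => -[x x0] _ /=.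
  by rewrite mulrC -exprz_exp -exprnP tq1 // exp1rz.
have [g gw] : exists g : {x : E | x != 0}, teich (val g) ^ w != 1.
  apply/existsP; rewrite -[X in is_true X]negbK negb_exists; apply/negP => /forallP H.
  pose r := `|(w %% q1)%Z|%N.
  have wr : (w %% q1)%Z = r%:Z by rewrite /r; have := modz_ge0 w (_ : q1%:Z != 0); lia.
  have rq : (r < q1)%N by have := ltz_pmod w (_ : 0 < q1%:Z); lia.
  have r0 : (0 < r)%N.
    rewrite lt0n; apply: contraFneq ndv => r0.
    by apply/dvdz_mod0P; rewrite wr r0.
  have tr (x : {x : E | x != 0}) : teich (val x) ^+ r = 1.
    have := H x; rewrite negbK => /eqP.
    rewrite {1}(divz_eq w q1) expfzDr ?teich_eq0 ?(valP x) // [(_ %/ _)%Z * _]mulrC -exprz_exp -exprnP tq1 ?(valP x) //.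
    by rewrite exp1rz mul1r wr.
  have := @max_poly_roots _ ('X^r - 1 : {poly C}) [seq teich (val x) | x : {x : E | x != 0}].
  rewrite -size_poly_eq0 size_XnsubC // size_map -fintype.cardE cZ => /(_ isT).
  have -> : all (root ('X^r - 1)) [seq teich (val x) | x : {x : E | x != 0}].
    by apply/allP => _ /mapP[x _ ->]; rewrite rootE !hornerE tr subrr.
  rewrite map_inj_uniq ?enum_uniq => [/(_ isT isT)|x y /teich_inj/val_inj //].
  by rewrite ltnS leqNgt rq.
set S := \sum_x _; apply/eqP; have : S * (teich (val g) ^ w - 1) == 0.
  rewrite mulrBr mulr1 subr_eq0; apply/eqP; rewrite mulr_suml.
  have nz (x : {x : E | x != 0}) : val x * val g != 0 by rewrite mulf_neq0 ?(valP x) ?(valP g).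
  pose h (x : {x : E | x != 0}) : {x : E | x != 0} := exist _ (val x * val g) (nz x).
  have hinj : injective h.
    by move=> x y /(congr1 val) /= /(mulIf (valP g)) /val_inj.
  rewrite /S [RHS](reindex_inj hinj); apply: eq_bigr => x _ /=.
  by rewrite teichM expfzMl.
by rewrite mulf_eq0 subr_eq0 (negPf gw) orbF.
Qed.

End FiniteField.

End Teichmuller.

(** With L = F[x], the generator is sent to a root of the image of its minimal polynomial. Elements
    are represented by chosen polynomials in x; divisibility by the minimal polynomial makes the
    choice irrelevant. *)
Lemma extend_embedding (k : fieldType)
  (k_closed : forall P : {poly k}, size P != 1%N -> exists z, root P z)
  (F : fieldType) (L : fieldExtType F) (x : L) (eps : {rmorphism F -> k}) :
  <<1%VS; x>>%VS = fullv ->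
  exists e : {rmorphism L -> k}, forall a, e a%:A = eps a.
Proof.
move=> gen.
have polP (u : L) : exists P : {poly F}, u = (map_poly (in_alg L) P).[x].
  by apply/Fadjoin1_polyP; rewrite gen memvf.
have [m mE] : exists m, minPoly 1%AS x = map_poly (in_alg L) m.
  by apply/polyOver1P/minPolyOver.
have sm : size (map_poly eps m) != 1%N.
  rewrite size_map_poly -(size_map_poly (in_alg L)) -mE size_minPoly.
  by rewrite eqSS -lt0n adjoin_degreeE divn_gt0 ?adim_gt0 // dimvS // subv_adjoin.
have [z /rootP mz] := k_closed _ sm.
have [pol polE] := choice polP.
have wd (P Q : {poly F}) : (map_poly (in_alg L) P).[x] = (map_poly (in_alg L) Q).[x] ->
    (map_poly eps P).[z] = (map_poly eps Q).[z].
  move=> PQ; apply/eqP; rewrite -subr_eq0 -hornerN -hornerD -rmorphB /=.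
  have : minPoly 1%AS x %| map_poly (in_alg L) (P - Q).
    apply: minPoly_dvdp; first by apply/polyOver1P; exists (P - Q).
    by rewrite rootE rmorphB hornerD hornerN PQ subrr.
  rewrite mE dvdp_map => /dvdpP[h ->].
  by rewrite rmorphM hornerM mz mulr0.
pose e u := (map_poly eps (pol u)).[z].
have eE P : e (map_poly (in_alg L) P).[x] = (map_poly eps P).[z].
  by apply: wd; rewrite -polE.
have eB : zmod_morphism e.
  move=> u w; rewrite {1}(polE u) {1}(polE w) -hornerN -hornerD -rmorphB eE.
  by rewrite rmorphB hornerD hornerN.
have eM : monoid_morphism e.
  split.
    have -> : (1 : L) = (map_poly (in_alg L) 1).[x] by rewrite rmorph1 hornerC.
    by rewrite eE rmorph1 hornerC.
  move=> u w; rewrite {1}(polE u) {1}(polE w) -hornerM -rmorphM eE.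
  by rewrite rmorphM hornerM.
pose e' : {rmorphism L -> k} := HB.pack e (GRing.isZmodMorphism.Build _ _ e eB)
  (GRing.isMonoidMorphism.Build _ _ e eM).
exists e' => a; have -> : a%:A = (map_poly (in_alg L) a%:P).[x].
  by rewrite map_polyC hornerC.
by rewrite [LHS]eE map_polyC hornerC.
Qed.

(** * Finite fields *)

(** The roots of the defining polynomial are the fixed points of a power of Frobenius, hence a
    subfield; since they also generate the splitting field, they exhaust it, and separability counts
    them. *)
Lemma card_fin_ext (F : finFieldType) m : #|finvect_type (fin_ext F m)| = (#|F| ^ m.+1)%N.
Proof.
have [p pr_p charF] := finPcharP F.
set M := (#|F| ^ m.+1)%N; pose L := fin_ext F m.
have charL : p \in [pchar L] by rewrite pchar_lalg.
have F1 : (1 < #|F|)%N := finNzRing_gt1 F.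
have pF : (p %| #|F|)%N.
  have := card_pprimeChar charF; case: (logn _ _) => [|l] E.
    by move: F1; rewrite -[#|F|]/(#|pPrimeCharType charF|) E.
  by rewrite -[#|F|]/(#|pPrimeCharType charF|) E expnS dvdn_mulr.
have M_gt1 : (1 < M)%N by rewrite -(exp1n m.+1) ltn_exp2r.
have M_gt0 : (0 < M)%N := ltnW M_gt1.
have pM : (p %| M)%N by rewrite /M expnS dvdn_mulr.
have m1_gt0 : (0 < M.-1)%N by rewrite -ltnS prednK.
pose q (K : nzRingType) : {poly K} := 'X^M - 'X.
have Dq (K : nzRingType) : q K = ('X^(M.-1) - 1) * ('X - 0%:P).
  by rewrite subr0 mulrBl mul1r -exprSr prednK.
have [zs DqL defL] : splittingFieldFor 1 (map_poly (in_alg L) (q F)) {:L}.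
  exact: (svalP (FinSplittingFieldFor (Xq_sub_X_neq0 F m))).
rewrite rmorphB rmorphXn /= map_polyX -/(q L) in DqL.
have Uzs : uniq zs.
  rewrite -separable_prod_XsubC -(eqp_separable DqL) Dq separable_root andbC.
  rewrite /root !hornerE subr_eq0 eq_sym expr0n gtn_eqF ?oner_eq0 //=.
  rewrite cyclotomic.separable_Xn_sub_1 // -subn1 natrB // subr_eq0.
  by case/dvdnP: pM => c ->; rewrite natrM (pcharf0 charL) mulr0 eq_sym oner_eq0.
have [a _ Da] := finField_galois_generator (sub1v {:L}).
rewrite /= dimv1 expn1 in Da.
pose Em := fixedSpace (a ^+ m.+1)%g.
have in_zs : zs =i Em.
  move=> z; rewrite -root_prod_XsubC -(eqp_root DqL) (sameP fixedSpaceP eqP).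
  rewrite /root !hornerE subr_eq0 /= /M; congr (_ == z).
  elim: (m.+1) => [|i IHi]; first by rewrite gal_id.
  by rewrite expgSr expnSr exprM IHi galM ?Da ?memvf.
have defEm : Em = {:L}%VS.
  apply/eqP; rewrite eqEsubv subvf -defL -[Em]subfield_closed agenvS //.
  by rewrite subv_add sub1v; apply/span_subvP=> z; rewrite in_zs.
have /eq_card-> : finvect_type L =i zs by move=> z; rewrite in_zs defEm memvf.
apply: succn_inj; rewrite (card_uniqP _) //= -(size_prod_XsubC _ id).
by rewrite -(eqp_size DqL) size_polyDl size_polyXn // size_polyN size_polyX.
Qed.

Lemma sum_cycle (gT : finGroupType) (V : nmodType) (a : gT) (F : gT -> V) :
  \sum_(x in <[a]>%g) F x = \sum_(t < #[a]%g) F (a ^+ t)%g.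
Proof.
rewrite -(big_mkord xpredT (fun t => F (a ^+ t)%g)) /index_iota subn0 -(big_map (fun t => a ^+ t)%g xpredT F).
rewrite big_uniq /=; last first.
  rewrite map_inj_in_uniq ?iota_uniq // => i j; rewrite !mem_iota => /andP[_ i_a] /andP[_ j_a] /eqP.
  by rewrite eq_expg_mod_order !modn_small // => /eqP.
apply: eq_bigl => x; apply/idP/mapP => [/cyclePmin[i ia ->]|[i _ ->]]; last exact: mem_cycle.
by exists i; rewrite // mem_iota.
Qed.

Lemma galTrace_finField (F : finFieldType) (L : splittingFieldType F) (x : L) :
  galTrace 1 {:L} x = \sum_(t < \dim {:L}) x ^+ (#|F| ^ t) /\
  exists c, galTrace 1 {:L} x = c%:A.
Proof.
have E1 := finField_galois_generator (sub1v {:L}).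
have [a /eqP ga Da] := E1.
rewrite dimv1 expn1 in Da.
have aX t : (a ^+ t)%g x = x ^+ (#|F| ^ t).
  elim: t => [|t IH]; first by rewrite gal_id.
  by rewrite expgSr expnSr exprM galM ?memvf // IH Da ?memvf.
have gal1 : galois 1 {:L} by apply: finField_galois; apply: sub1v.
have oa : #[a]%g = \dim {:L} by rewrite orderE -ga -galois_dim // dimv1 divn1.
split.
  by rewrite /galTrace ga (sum_cycle a (fun s => s x)) oa; apply: eq_bigr => t _; rewrite aX.
have := @galTrace_fixedField _ _ 1%AS {:L}%AS x (memvf x).
by rewrite (galois_fixedField gal1) => /vlineP[c ->]; exists c.
Qed.

(** The Galois trace lies in the prime field, so the default value in [abs_trace] is not taken; the
    Galois group is generated by Frobenius, which gives the sum of powers. *)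
Lemma abs_traceP (p : nat) (E : finFieldType) (charE : p \in [pchar E]) (x : E) :
  (abs_trace charE x : nat)%:R = \sum_(t < logn p #|E|) x ^+ (p ^ t).
Proof.
have pr_p := pcharf_prime charE.
have [] := @galTrace_finField 'F_p (pPrimeCharType charE) x.
rewrite (pprimeChar_dimf charE) card_Fp // /abs_trace.
set tr := galTrace _ _ _ => trE [c cE]; rewrite -[RHS]trE cE.
by case: pickP => [c' /eqP E1|/(_ c)]; rewrite ?cE ?eqxx //= -E1 /GRing.scale /= /pprimeChar_scale mulr1.
Qed.

Section Embeddings.
Variables (p : nat) (pr_p : prime p) (k : fieldType).
Hypothesis charK : p \in [pchar k].
Hypothesis k_closed : forall P : {poly k}, size P != 1%N -> exists z, root P z.

Definition Fp_emb : {rmorphism 'F_p -> k} :=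
  (in_alg (pPrimeCharType charK) : {rmorphism 'F_p -> pPrimeCharType charK}).

Lemma Fp_embE a : Fp_emb a = (a : nat)%:R.
Proof. by rewrite /Fp_emb /= /GRing.scale /= /pprimeChar_scale mulr1. Qed.

Lemma residue_embedding (f : {poly 'F_p}) (hf : closed_point_Gm f) z :
  root (map_poly Fp_emb f) z ->
  exists eps : {rmorphism residue_field hf -> k}, eps (point_coord hf) = z.
Proof.
move=> fz.
have [_ f_monic _] := and3P hf.
have fE : mk_monic f = f by apply: (mk_monicE (closed_point_mi hf)).
have modE P : (map_poly Fp_emb (Pdiv.CommonRing.rmodp P (mk_monic f))).[z] = (map_poly Fp_emb P).[z].
  rewrite fE [in RHS](Pdiv.RingMonic.rdivp_eq f_monic P) rmorphD rmorphM hornerD hornerM.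
  by rewrite (eqP fz) mulr0 add0r.
pose e (u : residue_field hf) := (map_poly Fp_emb (u : {poly %/ f})).[z].
have eB : zmod_morphism e.
  by move=> u w; rewrite /e -hornerN -hornerD -rmorphB.
have eM : monoid_morphism e.
  split; rewrite /e.
    have -> : ((1 : {poly %/ f}) : {poly 'F_p}) = 1%:P by exact: (qpolyCE f 1).
    by rewrite map_polyC hornerC; exact: (rmorph1 Fp_emb).
  by move=> u w; rewrite poly_of_qpolyM modE rmorphM hornerM.
pose e' : {rmorphism residue_field hf -> k} := HB.pack e (GRing.isZmodMorphism.Build _ _ e eB)
  (GRing.isMonoidMorphism.Build _ _ e eM).
by exists e'; rewrite /= /e /= modE map_polyX hornerX.
Qed.

Lemma finField_generator (F : finFieldType) (L : splittingFieldType F) :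
  exists x : L, <<1%VS; x>>%VS = fullv.
Proof.
pose E : finFieldType := finvect_type L.
have /cyclicP[g gE] : cyclic [set: {unit E}].
  exact: field_unit_group_cyclic.
exists (val g : L); apply/eqP; rewrite eqEsubv subvf; apply/subvP => y _.
have [->|y0] := eqVneq y 0; first exact: mem0v.
have yU : (y : E) \is a GRing.unit by rewrite unitfE.
have : FinRing.unit E yU \in [set: {unit E}] by rewrite inE.
rewrite gE => /cycleP[i /(congr1 val) /= ->].
by rewrite FinRing.val_unitX; apply: rpredX; apply: memv_adjoin.
Qed.

Lemma fin_ext_embedding (F : finFieldType) m (eps : {rmorphism F -> k}) :
  exists e : {rmorphism fin_ext F m -> k}, forall a, e a%:A = eps a.
Proof.
have [x gen] := finField_generator (fin_ext F m).
exact: (extend_embedding k_closed eps gen).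
Qed.

End Embeddings.

(** * Fredholm determinants *)

Section CoefBoundProd.
Variables (R : realFieldType) (C : fieldType) (v : C -> R).
Hypothesis na : nonarch v.

Lemma cbound_prod (I : finType) (c : I -> R) (r : R) (P : I -> {poly C}) : 0 <= r ->
  (forall i, 0 <= c i) -> (forall i, cbound v (c i) r (P i)) ->
  cbound v (\prod_i c i) r (\prod_i P i).
Proof.
move=> r0 c0 bP; suff [] : 0 <= \prod_i c i /\ cbound v (\prod_i c i) r (\prod_i P i) by [].
apply: (big_ind2 (fun a Q => 0 <= a /\ cbound v a r Q)) => [|a Q a' Q'|//].
  by split; [exact: ler01 | exact: cbound1].
by move=> [a0 bQ] [a0' bQ']; split; [apply: mulr_ge0 | apply: cboundM].
Qed.

Lemma cbound_int r (z : int) : 0 <= r -> cbound v 1 r z%:~R.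
Proof.
move=> r0 j; rewrite -(rmorph_int polyC) coefC mul1r; case: eqP => [->|_]; first by rewrite na_int.
by rewrite na0 ?exprn_ge0.
Qed.

End CoefBoundProd.

(** * Weights on matrix indices and uniform bounds for determinants *)

Section WeightedMatrix.
Variables (R : realFieldType) (C : fieldType) (v : C -> R) (p : nat) (sigma : R).
Hypotheses (na : nonarch v) (p_gt1 : (1 < p)%N) (s01 : 0 < sigma < 1).
Let s0 : 0 < sigma. Proof. by case/andP: s01. Qed.
Let s1 : sigma <= 1. Proof. by case/andP: s01 => _ /ltW. Qed.

(** The shape of a Dwork operator: its entry at (i, j) is a coefficient of index p i - j, of size
    sigma^|p i - j|, and |p i - j| is at least p |i| - |j|. *)
Definition wbounded n (wt : 'I_n -> nat) (X : 'M[C]_n) : Prop :=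
  forall i j, v (X i j) <= sigma ^+ (p * wt i) / sigma ^+ wt j.

Lemma sigma_rate t : 0 < sigma ^+ ((p - 1) * t.+1) <= 1.
Proof. by rewrite exprn_gt0 ?exprn_ile1 // ltW. Qed.

(** Split p wt(i) - wt(j) as (p - 1) wt(i) + (wt(i) - wt(j)): the second part is a ratio of weights,
    and a row of weight above t gains at least (p - 1)(t + 1) from the first. *)
Lemma wbounded_det n (wt : 'I_n -> nat) (X : 'M[C]_n) t : wbounded wt X ->
  pbound v (sigma ^+ ((p - 1) * t.+1)) 1 #|[set i | (wt i <= t)%N]|
    (\det (1%:M - 'X *: map_mx polyC X)).
Proof.
move=> bX.
have -> : [set i | (wt i <= t)%N] = [set i | ~~ (t < wt i)%N].
  by apply/setP => i; rewrite !inE -leqNgt.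
have pE i : sigma ^+ (p * wt i) = sigma ^+ ((p - 1) * wt i) * sigma ^+ wt i.
  by rewrite -exprD; congr (_ ^+ _); nia.
apply: (pbound_det na (sigma_rate t) (W := fun i => sigma ^+ wt i)) => [i|i j|i j ti].
- by rewrite exprn_gt0.
- apply: le_trans (bX i j) _; rewrite pE -mulrA ler_piMl ?divr_ge0 ?exprn_ge0 ?(ltW s0) //.
  by rewrite exprn_ile1 // ltW.
apply: le_trans (bX i j) _; rewrite pE -mulrA ler_wpM2r ?divr_ge0 ?exprn_ge0 ?(ltW s0) //.
by rewrite ler_wiXn2l ?(ltW s0) // leq_mul2l ti orbT.
Qed.

Lemma wboundedM n (wt : 'I_n -> nat) (X Y : 'M[C]_n) : wbounded wt X -> wbounded wt Y ->
  wbounded wt (X *m Y).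
Proof.
move=> bX bY i j; rewrite mxE.
apply: na_sum_le => // [|u _]; first by rewrite divr_ge0 ?exprn_ge0 ?(ltW s0).
rewrite (naM na); apply: le_trans (_ : (sigma ^+ (p * wt i) / sigma ^+ wt u) *
   (sigma ^+ (p * wt u) / sigma ^+ wt j) <= _).
  by apply: ler_pM; rewrite ?(na_ge0 na).
rewrite -mulrA ler_wpM2l ?exprn_ge0 ?(ltW s0) // mulrA ler_piMl ?invr_ge0 ?exprn_ge0 ?(ltW s0) //.
rewrite mulrC ler_pdivrMr ?exprn_gt0 // mul1r ler_wiXn2l ?(ltW s0) //.
by rewrite leq_pmull // ltnW.
Qed.

End WeightedMatrix.

Section CountWords.
Variables (N : nat) (wt : 'I_N -> nat) (M t : nat).
Hypotheses (wt0 : forall x y, wt x = 0%N -> wt y = 0%N -> x = y)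
  (wt_count : (#|[set x | (wt x <= t)%N]| <= M)%N).

Definition wtw j (s : j.-tuple 'I_N) : nat := (\sum_l wt (tnth s l))%N.

Lemma wtwE j (s : j.-tuple 'I_N) : wtw s = (\sum_(x <- s) wt x)%N.
Proof. by rewrite big_tuple. Qed.

Lemma wtw_sort j (s : j.-tuple 'I_N) : wtw (wsort s) = wtw s.
Proof. by rewrite !wtwE; apply: perm_big; exact: wsort_perm. Qed.

Lemma count_le_wtw j (s : j.-tuple 'I_N) x : (0 < wt x)%N -> (count_mem x s <= wtw s)%N.
Proof.
move=> wx; rewrite wtwE; elim: (s : seq _) => [|y l IH] /=; first by rewrite big_nil.
rewrite big_cons; apply: leq_add => //; by case: eqP => [->|].
Qed.

(* The letters of positive weight determine a sorted word of a given length,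
   as there is at most one letter of weight zero. *)
Lemma count_words j e : (#|[set s : widx N j e | (wtw (val s) <= t)%N]| <= t.+1 ^ M)%N.
Proof.
pose L := {x : 'I_N | (0 < wt x <= t)%N}.
pose f (s : widx N j e) : {ffun L -> 'I_t.+1} := [ffun x => inord (count_mem (val x) (val s))].
have cL : (#|{: L}| <= M)%N.
  apply: leq_trans wt_count; rewrite card_sig; apply: subset_leq_card.
  by apply/subsetP => x; rewrite !inE => /andP[].
have finj : {in [set s : widx N j e | (wtw (val s) <= t)%N] &, injective f}.
  move=> s s'; rewrite !inE => st s't /ffunP E.
  have cE x : (0 < wt x)%N -> count_mem x (val s) = count_mem x (val s').
    move=> wx; have [xt|tx] := leqP (wt x) t.
      have xL : (0 < wt x <= t)%N by rewrite wx xt.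
      have := congr1 val (E (exist _ x xL)); rewrite !ffunE /= !inordK //.
        by rewrite ltnS; apply: leq_trans s't; exact: count_le_wtw.
      by rewrite ltnS; apply: leq_trans st; exact: count_le_wtw.
    have H (w : widx N j e) : (wtw (val w) <= t)%N -> count_mem x (val w) = 0%N.
      move=> wtt; apply/eqP; rewrite -leqn0 leqNgt -has_count has_pred1; apply/negP => xw.
      have : (wt x <= wtw (val w))%N by rewrite wtwE (big_rem x) //= leq_addr.
      by move=> /leq_trans/(_ wtt); rewrite leqNgt tx.
    by rewrite !H.
  have pe : perm_eq (val s) (val s').
    apply/perm_count => x; have [x0|/cE //] := posnP (wt x).
    have Z (w : widx N j e) : (count_mem x (val w) + \sum_(y | y != x) count_mem y (val w) = j)%N.
      by rewrite -[RHS](size_tuple (val w)) -(sum_count_mem (val w)) [RHS](bigD1 x).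
    have /eqP := etrans (Z s) (esym (Z s')).
    rewrite (eq_bigr (fun y => count_mem y (val s'))) => [|y yx]; first by rewrite eqn_add2r => /eqP.
    by apply: cE; rewrite lt0n; apply: contraNneq yx => y0; apply/eqP/wt0.
  apply: val_inj => /=; have /andP[ss _] := valP s; have /andP[ss' _] := valP s'.
  by rewrite -(wsort_id ss) -(wsort_id ss'); apply/eqP; rewrite wsort_eq.
rewrite -(card_in_imset finj); apply: leq_trans (max_card _) _.
by rewrite card_ffun card_ord leq_pexp2l.
Qed.

(** A strictly increasing word uses the only possible letter of weight zero at most once, and every
    other letter adds at least 1 to the weight. *)
Lemma ext_words_empty j (s : widx N j true) : (wtw (val s) <= t)%N -> (j <= t.+1)%N.
Proof.
move=> st; have /andP[_ /= us] := valP s.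
have : (size (val s) <= 1 + wtw (val s))%N.
  rewrite -(count_predC (fun x => wt x == 0%N)) wtwE leq_add //.
    rewrite -size_filter; have := filter_uniq (fun x => wt x == 0%N) us.
    have : all (fun x => wt x == 0%N) [seq x <- val (val s) | wt x == 0%N] by exact: filter_all.
    case: filter => [|x [|y l]] //= /and3P[/eqP x0 /eqP y0 _].
    by rewrite inE (wt0 x0 y0) eqxx.
  elim: (val (val s)) => [|y l IH] /=; first by rewrite big_nil.
  by rewrite big_cons leq_add //; case: (wt y).
by rewrite size_tuple => H; apply: leq_trans H _; rewrite add1n ltnS.
Qed.

End CountWords.

(** * Symmetric and exterior powers of a Frobenius matrix over the parameter torus *)

Section Dynamics.
Variables (R : realFieldType) (C : closedFieldType) (v : C -> R) (p : nat) (sigma : R).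
Hypotheses (na : nonarch v) (p_gt1 : (1 < p)%N) (s01 : 0 < sigma < 1).
Hypothesis char0 : forall n, n.+1%:R != 0 :> C.
Let s0 : 0 < sigma. Proof. by case/andP: s01. Qed.
Let s1 : sigma <= 1. Proof. by case/andP: s01 => _ /ltW. Qed.
Variables (N : nat) (A : 'M[{poly C}]_N) (wt : 'I_N -> nat).
Hypothesis A_bound : forall i j,
  cbound v (sigma ^+ (p * wt i) / sigma ^+ wt j) sigma (A i j).

Definition Aat y : 'M[C]_N := map_mx (horner_eval y) A.
(** The product A(y^(p^(m-1))) ... A(y^p) A(y), that is, the m-step Frobenius of the fibre at a
    point y with y^(p^m) = y. *)
Fixpoint Aprod m y : 'M[C]_N :=
  if m is m'.+1 then Aat (y ^+ (p ^ m')) *m Aprod m' y else 1%:M.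
(** By [tr_wmx_sym] and [tr_wmx_ext], [symtr] and [exttr] are the trace of Sym^j and (-1)^j times
    the trace of Lambda^j of [Aprod m y]. Expressing them through power sums allows limits in which
    the size of the matrix changes. *)
Definition symtr m y j := ldser (fun r => \tr (Aprod m y ^+ r)) j.
Definition exttr m y j := ldser (fun r => - \tr (Aprod m y ^+ r)) j.

Lemma newton_Aprod m y k : (0 < k)%N ->
  \tr (Aprod m y ^+ k) = - \sum_(i < k.+1) exttr m y i *+ i * symtr m y (k - i).
Proof. exact: newton_girard. Qed.

Lemma Aat_bounded y : v y <= 1 -> wbounded v p sigma wt (Aat y).
Proof.
move=> y1 i j; rewrite mxE.
rewrite -[leRHS]mulr1 -(expr0 sigma); apply: (cbound_horner na) => //.
  by rewrite divr_ge0 ?exprn_ge0 ?(ltW s0).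
by rewrite s1 ltW.
Qed.

Lemma exttr_bound m y t j : (0 < m)%N -> v y <= 1 ->
  v (exttr m y j) <= (sigma ^+ ((p - 1) * t.+1)) ^+ (j - #|[set i | (wt i <= t)%N]|).
Proof.
move=> m0 y1; have bA : wbounded v p sigma wt (Aprod m y).
  case: m m0 => // m _; elim: m => [|m IH].
    by rewrite /= mulmx1 expn0 expr1; exact: Aat_bounded.
  apply: wboundedM IH => //; apply: Aat_bounded; rewrite naX // exprn_ile1 ?(na_ge0 na) //.
by rewrite /exttr -[leRHS]mul1r -(ldser_eq char0 (logder_det (Aprod m y) j) (leqnn j)) (wbounded_det na).
Qed.

Section SymExt.
Variables a b : nat.

Lemma wkerf_eval j e (s t : j.-tuple 'I_N) y :
  (wkerf e A s t).[y] = wkerf e (Aat y) s t.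
Proof.
rewrite horner_sum; apply: eq_bigr => w _; rewrite hornerM horner_prod; congr (_ * _).
  rewrite /wsgn; case: e; last exact: hornerC.
  by rewrite -(rmorph_int polyC) hornerC.
by apply: eq_bigr => l _; rewrite mxE.
Qed.

Lemma wkerf_cbound j e (s t : j.-tuple 'I_N) :
  cbound v (sigma ^+ (p * wtw wt s) / sigma ^+ (wtw wt t)) sigma (wkerf e A s t).
Proof.
apply: (cbound_sum na) => [||w /eqP wt']; rewrite ?divr_ge0 ?exprn_ge0 ?(ltW s0) //.
have -> : sigma ^+ (p * wtw wt s) / sigma ^+ wtw wt t =
    1 * \prod_l (sigma ^+ (p * wt (tnth s l)) / sigma ^+ wt (tnth w l)).
  rewrite mul1r big_split /= prodfV -wt' wtw_sort /wtw big_distrr /=.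
  by rewrite -!(big_morph (fun n => sigma ^+ n) (exprD sigma) (expr0 sigma)).
have H l : 0 <= sigma ^+ (p * wt (tnth s l)) / sigma ^+ wt (tnth w l).
  by rewrite divr_ge0 ?exprn_ge0 ?(ltW s0).
apply: (cboundM na); rewrite ?(ltW s0) ?prodr_ge0 //.
  by rewrite /wsgn; case: e; [apply: cbound_int; rewrite ?(ltW s0) | apply: cbound1; rewrite ?(ltW s0)].
by apply: cbound_prod; rewrite ?(ltW s0).
Qed.

Definition pairs : finType := (widx N a false * widx N b true)%type.
Definition pwt (x : pairs) : nat := (wtw wt (val x.1) + wtw wt (val x.2))%N.
(** The entries of Sym^a A (x) Lambda^b A, kept as polynomials in y: their coefficients are the
    input of the trace formula in the single variable y. *)
Definition pker (x y : pairs) : {poly C} :=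
  wkerf false A (val x.1) (val y.1) * wkerf true A (val x.2) (val y.2).

Lemma pker_cbound x y :
  cbound v (sigma ^+ (p * pwt x) / sigma ^+ pwt y) sigma (pker x y).
Proof.
have -> : sigma ^+ (p * pwt x) / sigma ^+ pwt y =
  (sigma ^+ (p * wtw wt (val x.1)) / sigma ^+ wtw wt (val y.1)) *
  (sigma ^+ (p * wtw wt (val x.2)) / sigma ^+ wtw wt (val y.2)).
  by rewrite mulrACA -invfM -!exprD mulnDr.
by apply: (cboundM na); rewrite ?divr_ge0 ?exprn_ge0 ?(ltW s0) //; apply: wkerf_cbound.
Qed.

Definition pdeg : nat := \max_(x : pairs) \max_(y : pairs) size (pker x y).

Lemma pker_deg x y : (size (pker x y) <= pdeg)%N.
Proof. by apply: leq_trans (leq_bigmax x); exact: leq_bigmax. Qed.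

Let M := #|{: pairs}|.
Definition pcoef (e : int) : 'M[C]_M :=
  kmx (fun x y : pairs => if e is Posz j then (pker x y)`_j else 0).
Definition pc (t : nat) (e : expo 1) : 'M[C]_M := pcoef (e ord0).

Lemma pc_bounded t e : ~~ bounded pdeg e -> pc t e = 0.
Proof.
move=> nb; have : ~~ (`|e ord0|%N <= pdeg)%N.
  by apply: contra nb => H; apply/forallP => i; rewrite ord1.
rewrite -ltnNge /pc; case: (e ord0) => l le; apply/matrixP => x y; rewrite !mxE //.
by rewrite nth_default //; apply: leq_trans (pker_deg _ _) _; apply: ltnW.
Qed.

Lemma pc_laurent t y : laurent pdeg pc t y =
  kmx (fun x x' : pairs => wkerf false (Aat (y ord0)) (val x.1) (val x'.1) *
                           wkerf true (Aat (y ord0)) (val x.2) (val x'.2)).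
Proof.
rewrite /laurent (reindex (fun i : 'I_(pdeg.*2.+1) => [ffun=> i] : box 1 pdeg)) /=; last first.
  exists (fun e : box 1 pdeg => e ord0) => [i _|e _]; first by rewrite ffunE.
  by apply/ffunP => i; rewrite ffunE (ord1 i).
apply/matrixP => i j; rewrite summxE !mxE -!wkerf_eval -hornerM -/(pker _ _).
rewrite (horner_coef_wide _ (leqW (pker_deg _ _))).
set P := pker _ _.
pose F (l : nat) : C := if (pdeg <= l)%N then P`_(l - pdeg) * y ord0 ^+ (l - pdeg) else 0.
rewrite (eq_bigr (fun l : 'I__ => F l)) => [|l _].
  rewrite -(big_mkord xpredT F) (@big_cat_nat _ _ _ pdeg) //=; last by rewrite -addnn; lia.
  rewrite big1_seq ?add0r => [|l]; last first.
    by move=> /andP[_]; rewrite mem_index_iota => /andP[_ lt]; rewrite /F leqNgt lt.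
  rewrite -{1}[pdeg]add0n big_addn (_ : (pdeg.*2.+1 - pdeg = pdeg.+1)%N); last by rewrite -addnn; lia.
  by rewrite big_mkord; apply: eq_bigr => l _; rewrite /F leq_addl addnK.
rewrite !mxE /monom big_ord1 !ffunE /F.
have [le|lt] := leqP pdeg l.
  by rewrite subzn // mulrC.
have -> : (l : nat)%:Z - pdeg%:Z = Negz (pdeg - l).-1 by rewrite NegzE prednK ?subn_gt0 //; lia.
by rewrite mulr0.
Qed.

Lemma pc_laurent_prod m y : laurent_prod p pdeg pc m y =
  kmx (fun x x' : pairs => wkerf false (Aprod m (y ord0)) (val x.1) (val x'.1) *
                           wkerf true (Aprod m (y ord0)) (val x.2) (val x'.2)).
Proof.
have two0 : 2%:R != 0 :> C by apply: char0 1%N.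
elim: m => [|m IH] /=.
  apply/matrixP => i j; rewrite !mxE !wkerf1 -natrM mulnb -(inj_eq enum_val_inj).
  by case: (enum_val i) (enum_val j) => x x' [y1 y2].
rewrite pc_laurent IH kmxM; apply: eq_kmx => x x'.
rewrite -!wkerfM // big_distrl /=.
transitivity (\sum_(u1 : widx N a false) \sum_(u2 : widx N b true)
  (wkerf false (Aat (y ord0 ^+ (p ^ m))) (val x.1) (val u1) * wkerf true (Aat (y ord0 ^+ (p ^ m))) (val x.2) (val u2)) *
  (wkerf false (Aprod m (y ord0)) (val u1) (val x'.1) * wkerf true (Aprod m (y ord0)) (val u2) (val x'.2))).
  by rewrite pair_bigA.
apply: eq_bigr => u1 _; rewrite mulr_sumr; apply: eq_bigr => u2 _.
by rewrite mulrACA.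
Qed.

Lemma tr_pc m y : \tr (laurent_prod p pdeg pc m y) =
  (-1) ^+ b * (symtr m (y ord0) a * exttr m (y ord0) b).
Proof.
rewrite pc_laurent_prod tr_kmx /symtr /exttr -tr_wmx_sym // -tr_wmx_ext // !tr_wmx.
have E (x z z' : C) : z * z = 1 -> z * (x * (z * z')) = x * z'.
  by move=> zz; rewrite mulrCA (mulrA z) zz mul1r.
rewrite E; last by rewrite -expr2 sqrr_sign.
rewrite big_distrl /= -(pair_bigA _ (fun s S => wkerf false (Aprod m (y ord0)) (val s) (val s) *
  wkerf true (Aprod m (y ord0)) (val S) (val S))) /=.
by apply: eq_bigr => s _; rewrite mulr_sumr.
Qed.

(** Dwork's operator in the parameter. The coefficient matrices [pc] are the same at every stage, so
    [psi_prod] is just a power of this matrix. *)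
Definition frob : 'M[C]_#|{: box 1 pdeg * 'I_M}| := psi p pdeg pc 0.

Lemma psi_prod_frob m : psi_prod p pdeg pc m = frob ^+ m.
Proof. by elim: m => [|m IH] //=; rewrite IH exprS. Qed.

Definition fwt (i : 'I_#|{: box 1 pdeg * 'I_M}|) : nat :=
  (`|pos (enum_val i).1 ord0|%N + pwt (enum_val (enum_val i).2))%N.

(** The coefficient of y^l in [pker] carries sigma^l, and l = p z - z' is at least p |z| - |z'|; so
    the exponent of y simply adds its absolute value to the weight of the words. *)
Lemma frob_bounded : wbounded v p sigma fwt frob.
Proof.
move=> i j; rewrite mxE /pc !mxE /fwt.
move: (enum_val i) (enum_val j) => [e x] [e' x'] /=.
rewrite expoB expoMn; move: (pos e ord0) (pos e' ord0) => z z'.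
move: (enum_val x) (enum_val x') => {}x {}x'.
case E: (z * p - z') => [l|l]; last first.
  by rewrite na0 // divr_ge0 ?exprn_ge0 ?(ltW s0).
apply: le_trans (pker_cbound x x' l) _.
have -> : sigma ^+ (p * (`|z|%N + pwt x)) / sigma ^+ (`|z'|%N + pwt x') =
    (sigma ^+ (p * pwt x) / sigma ^+ pwt x') * (sigma ^+ (p * `|z|%N) / sigma ^+ `|z'|%N).
  by rewrite mulnDr !exprD invfM mulrACA mulrC.
rewrite ler_wpM2l ?divr_ge0 ?exprn_ge0 ?(ltW s0) //.
rewrite ler_pdivlMr ?exprn_gt0 // -exprD ler_wiXn2l ?(ltW s0) //.
have [z0|z0] := leP 0 z.
  have -> : (p * `|z|%N)%N = `|(z * p%:Z)%R|%N by rewrite abszM absz_nat mulnC.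
  have : 0 <= z * p%:Z by rewrite mulr_ge0.
  by move: E; move: (z * p%:Z) => zp; lia.
have -> : (p * `|z|%N)%N = `|(z * p%:Z)%R|%N by rewrite abszM absz_nat mulnC.
have : z * p%:Z <= 0 by apply: mulr_le0_ge0 => //; exact: ltW.
by move: E; move: (z * p%:Z) => zp; lia.
Qed.

(** Neither a nor the radius of the box enters: weight at most t leaves 2t + 1 exponents of y and at
    most (t + 1)^M1 words of each kind, and for b > t + 1 no exterior word at all. *)
Lemma fwt_count t M1 : (forall x y, wt x = 0%N -> wt y = 0%N -> x = y) ->
  (#|[set x | (wt x <= t)%N]| <= M1)%N ->
  (#|[set i | (fwt i <= t)%N]| <= (b <= t.+1) * (t.*2.+1 * (t.+1 ^ M1 * t.+1 ^ M1)))%N.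
Proof.
move=> wt0 cM.
have [bt|tb] := leqP b t.+1; last first.
  rewrite leqn0 cards_eq0; apply/eqP/setP => i; rewrite !inE; apply/negP => it.
  suff : (b <= t.+1)%N by rewrite leqNgt tb.
  apply: (ext_words_empty wt0 (s := (enum_val (enum_val i).2).2)).
  by apply: leq_trans it; rewrite /fwt /pwt addnA leq_addl.
rewrite mul1n.
pose f (i : 'I_#|{: box 1 pdeg * 'I_M}|) := ((enum_val i).1, enum_val (enum_val i).2).
have finj : injective f.
  move=> i j [] E1 /enum_val_inj E2; apply: enum_val_inj.
  by case: (enum_val i) (enum_val j) E1 E2 => x1 x2 [y1 y2] /= -> ->.
rewrite -(card_imset _ finj).
pose S1 := [set e : box 1 pdeg | (`|pos e ord0|%N <= t)%N].
pose S2 := [set s : widx N a false | (wtw wt (val s) <= t)%N].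
pose S3 := [set s : widx N b true | (wtw wt (val s) <= t)%N].
apply: leq_trans (_ : #|setX S1 (setX S2 S3)| <= _)%N.
  apply/subset_leq_card/subsetP => _ /imsetP[i it ->]; move: it.
  rewrite !inE /f /= /fwt /pwt => it.
  apply/and3P; split; apply: leq_trans it; rewrite ?leq_addr //.
    by rewrite addnCA leq_addr.
  by rewrite addnA leq_addl.
rewrite !cardsX !leq_mul ?count_words //.
pose g (e : box 1 pdeg) : 'I_t.*2.+1 := inord `|(pos e ord0 + t%:Z)%R|%N.
have ginj : {in S1 &, injective g}.
  move=> e e'; rewrite !inE => et e't /(congr1 val); rewrite /= !inordK.
  - move=> E; suff H : pos e = pos e' by apply: pos_inj H.
    apply/ffunP => i; rewrite (ord1 i).
    by move: (pos e ord0) (pos e' ord0) et e't E => z z'; lia.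
  - by move: (pos e' ord0) e't => z; lia.
  - by move: (pos e ord0) et => z; lia.
by rewrite -(card_in_imset ginj) (leq_trans (max_card _)) ?card_ord.
Qed.

Lemma frob_trace (Z : finType) (tau : Z -> C) m : (forall z, tau z != 0) -> (0 < m)%N ->
  (forall w : int, \sum_z tau z ^ w =
     if ((p ^ m - 1)%N %| w)%Z then (p ^ m - 1)%:R else 0) ->
  (-1) ^+ b * \sum_z symtr m (tau z) a * exttr m (tau z) b =
  (p ^ m - 1)%:R * \tr (frob ^+ m).
Proof.
move=> tau0 m0 orth; rewrite -psi_prod_frob.
rewrite -[X in X * _]expr1 -(trace_formula p_gt1 pc_bounded tau0 m0 orth).
rewrite mulr_sumr (reindex (fun x : {ffun 'I_1 -> Z} => x ord0)) /=; last first.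
  exists (fun z => [ffun=> z]) => [x _|z _]; last by rewrite ffunE.
  by apply/ffunP => i; rewrite ffunE (ord1 i).
by apply: eq_bigr => x _; rewrite tr_pc.
Qed.

End SymExt.

Section Fredholm.
Variables (Z : nat -> finType) (tau : forall m, Z m -> C) (cnt : nat -> nat).
Hypotheses (tau_neq0 : forall m (z : Z m), tau z != 0)
  (orth : forall m, (0 < m)%N -> forall w : int, \sum_(z : Z m) tau z ^ w =
     if ((p ^ m - 1)%N %| w)%Z then (p ^ m - 1)%:R else 0)
  (wt0 : forall x y, wt x = 0%N -> wt y = 0%N -> x = y)
  (wt_count : forall t, (#|[set x | (wt x <= t)%N]| <= cnt t)%N).

Definition char_frob a b : {poly C} := \det (1%:M - 'X *: map_mx polyC (frob a b)).
Definition twist_poly (P : {poly C}) : {poly C} := \poly_(l < size P) (p%:R ^+ l * P`_l).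

Lemma coef_twist P l : (twist_poly P)`_l = p%:R ^+ l * P`_l.
Proof. by rewrite coef_poly; case: ltnP => // le; rewrite nth_default ?mulr0. Qed.

(** Numerator ([b] true) and denominator ([b] false) of the L-function of the k-th power sums.
    Newton-Girard gives the operator on Sym^(k-i) (x) Lambda^i the multiplicity i and the sign
    (-1)^(i-1). The factor p^m - 1 yields both D(T) and D(pT), and the sign decides which of the two
    is in the numerator. *)
Definition fred (b : bool) k : {poly C} :=
  \prod_(i < k) (if odd i.+1 (+) b then twist_poly (char_frob (k - i.+1) i.+1)
                 else char_frob (k - i.+1) i.+1) ^+ i.+1.

Definition fred_trace (b : bool) k m : C := \sum_(i < k)
  ((-1) ^+ i.+2 * p%:R ^+ (m * (odd i.+1 (+) b)) * (p ^ m - 1)%:R^-1 *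
   \sum_(z : Z m) symtr m (tau z) (k - i.+1) * exttr m (tau z) i.+1) *+ i.+1.

Lemma fred_logder b k L : logder L (fred_trace b k) (fun l => (fred b k)`_l).
Proof.
apply: logder_prodT => i; apply: logderX.
have D : logder L (fun m => (-1) ^+ i.+2 * (p ^ m - 1)%:R^-1 *
    \sum_(z : Z m) symtr m (tau z) (k - i.+1) * exttr m (tau z) i.+1)
    (fun l => (char_frob (k - i.+1) i.+1)`_l).
  apply: eq_logder (logder_det (frob (k - i.+1) i.+1) L) => // m /andP[m0 _].
  have q0 : (p ^ m - 1)%:R != 0 :> C.
    have : (0 < p ^ m - 1)%N by rewrite subn_gt0 -(exp1n m) ltn_exp2r.
    by case: (p ^ m - 1)%N.
  rewrite exprS mulN1r !mulNr -mulrA mulrCA (frob_trace _ _ (@tau_neq0 m) m0 (orth m0)).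
  by rewrite mulKf.
case: (_ (+) _).
  apply: eq_logder (logder_scale p%:R D) => [m _|l _]; last by rewrite coef_twist.
  by rewrite muln1 [(-1) ^+ _ * p%:R ^+ m]mulrC !mulrA.
by apply: eq_logder D => // m _; rewrite muln0 expr0 mulr1.
Qed.

(** For each i the two families differ by the factor p^m - 1 up to sign; it cancels the inverse in
    [fred_trace], and the Newton-Girard sum remains. *)
Lemma fred_newton k m : (0 < k)%N -> (0 < m)%N ->
  fred_trace true k m = fred_trace false k m + \sum_(z : Z m) \tr (Aprod m (tau z) ^+ k).
Proof.
move=> k0 m0.
have q0 : (p ^ m - 1)%:R != 0 :> C.
  have : (0 < p ^ m - 1)%N by rewrite subn_gt0 -(exp1n m) ltn_exp2r.
  by case: (p ^ m - 1)%N.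
have qE : (p ^ m - 1)%:R = p%:R ^+ m - 1 :> C.
  by rewrite natrB ?natrX // expn_gt0 ltnW.
rewrite [X in _ + X](eq_bigr _ (fun z _ => newton_Aprod m (tau z) k0)) sumrN.
rewrite exchange_big /= big_ord_recl /= big1 ?add0r => [|z _]; last by rewrite mulr0n mul0r.
apply/eqP; rewrite addrC -subr_eq -sumrB -sumrN; apply/eqP; apply: eq_bigr => i _.
rewrite /bump leq0n add1n.
rewrite -mulrnBl -mulrBl -mulrBl -mulrBr.
set S := \sum_z _; have -> : \sum_(z : Z m) exttr m (tau z) i.+1 *+ i.+1 * symtr m (tau z) (k - i.+1) = S *+ i.+1.
  by rewrite -sumrMnl; apply: eq_bigr => z _; rewrite mulrnAl mulrC.
rewrite -mulNrn; congr (_ *+ _).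
rewrite -[RHS]mulN1r; congr (_ * _).
have E : (-1) ^+ i.+2 * (p%:R ^+ (m * (odd i.+1 (+) true)) - p%:R ^+ (m * (odd i.+1 (+) false))) =
   - (p ^ m - 1)%:R :> C.
  rewrite qE -signr_odd /= addbT addbF negbK; case: (odd i) => /=.
    by rewrite muln1 muln0 expr0 expr1 mulN1r opprB.
  by rewrite muln1 muln0 expr0 mul1r opprB.
by rewrite E mulNr mulfV.
Qed.

(** Factors with i > t + 1 have no index of weight at most t, and for the others the multiplicity i
    is at most t + 1; hence the number of degrees without decay does not depend on k. *)
Lemma fred_bound b k t : v p%:R <= 1 ->
  pbound v (sigma ^+ ((p - 1) * t.+1)) 1
    (t.+1 * t.+1 * (t.*2.+1 * (t.+1 ^ cnt t * t.+1 ^ cnt t))) (fred b k).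
Proof.
move=> vp1; have r01 := sigma_rate p s01 t.
set X := (t.*2.+1 * _)%N.
have H := @pbound_prod _ _ _ na _ r01 _ (fun i : 'I_k => 1) (fun i => ((i.+1 <= t.+1) * X) * i.+1)%N
  (fun i => (if odd i.+1 (+) b then twist_poly (char_frob (k - i.+1) i.+1)
                 else char_frob (k - i.+1) i.+1) ^+ i.+1) (fun=> ler01).
rewrite big1 // in H.
apply: (pboundW r01 ler01) (H _) => [|i].
  apply: leq_trans (_ : \sum_(i < k) (i < t.+1) * (t.+1 * X) <= _)%N.
    apply: leq_sum => i _; rewrite ltnS -mulnA leq_mul2l; case: leqP => //= it.
    by rewrite mulnC leq_mul2r ltnS it orbT.
  rewrite -big_distrl /= -mulnA leq_mul2r; apply/orP; right.
  suff : (\sum_(i < k) (i < t.+1) = minn k t.+1)%N by move=> ->; exact: geq_minr.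
  elim: k {H} => [|k IH]; first by rewrite big_ord0 min0n.
  by rewrite big_ord_recr /= IH; lia.
rewrite -[1](expr1n R i.+1); apply: (pboundX na r01) => //.
have D : pbound v (sigma ^+ ((p - 1) * t.+1)) 1 ((i.+1 <= t.+1) * X) (char_frob (k - i.+1) i.+1).
  apply: (pboundW r01 ler01) (wbounded_det na p_gt1 s01 t (@frob_bounded _ _)).
  exact: fwt_count.
case: (_ (+) _) => // l; rewrite coef_twist (naM na) naX //.
apply: le_trans (D l); rewrite ler_piMl ?(na_ge0 na) // exprn_ile1 ?(na_ge0 na) //.
Qed.

End Fredholm.
End Dynamics.

(** * The Frobenius matrix of the Kloosterman family *)

Section DworkMatrix.
Variables (C : closedFieldType) (p n K : nat).
Hypothesis p_gt1 : (1 < p)%N.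
Variable lam : nat -> C.

Definition split_poly : {poly C} := \poly_(j < K) lam j.
Definition lamz (z : int) : C := if z is Posz j then split_poly`_j else 0.

(* The coefficient of [x^w] in [\prod_i theta (x_i) * theta (y / \prod_i x_i)],
   as a polynomial in [y]. *)
Definition kl_coef (w : expo n) : {poly C} :=
  \poly_(j < K) (lam j * \prod_i lamz (w i + j%:Z)).

Definition dmx : 'M[{poly C}]_#|{: box n K * 'I_1}| :=
  kmx (fun a b : box n K * 'I_1 => kl_coef (pos a.1 *+ p - pos b.1)).
Definition dwt (i : 'I_#|{: box n K * 'I_1}|) : nat := (\sum_l `|pos (enum_val i).1 l|)%N.

Section Bounds.
Variables (R : realFieldType) (v : C -> R) (sigma : R).
Hypotheses (na : nonarch v) (s01 : 0 < sigma < 1).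
Let s0 : 0 < sigma. Proof. by case/andP: s01. Qed.
Let s1 : sigma <= 1. Proof. by case/andP: s01 => _ /ltW. Qed.
Hypothesis lam_bound : forall j, v (lam j) <= (sigma ^+ n.+1) ^+ j.

Lemma lamz_bound z : v (lamz z) <= if z is Posz j then (sigma ^+ n.+1) ^+ j else 0.
Proof.
case: z => j /=; last by rewrite na0.
by rewrite coef_poly; case: ifP => // _; rewrite na0 ?exprn_ge0 ?(ltW s0).
Qed.

(** The term uses degree j in the last factor and w_i + j in the i-th one. From \sum |w_i| <= \sum
    (w_i + j) + n j it follows that n + 1 times the total degree is at least j + \sum |w_i|, which
    explains the exponent n + 1 on sigma. *)
Lemma kl_coef_bound (w : expo n) j :
  v (kl_coef w)`_j <= sigma ^+ (j + \sum_i `|w i|)%N.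
Proof.
have e0 N : 0 <= sigma ^+ N by rewrite exprn_ge0 ?(ltW s0).
rewrite coef_poly; case: ifP => _; last by rewrite na0.
have [/forallP wj|/forallPn[i wi]] := boolP [forall i, 0 <= w i + j%:Z]; last first.
  rewrite (bigD1 i) //=; case E: (w i + j%:Z) wi => [l|l] // _.
  by rewrite mul0r mulr0 na0.
rewrite (naM na) na_prod //.
apply: le_trans (_ : (sigma ^+ n.+1) ^+ j * \prod_i (sigma ^+ n.+1) ^+ `|(w i + j%:Z)%R|%N <= _).
  apply: ler_pM; rewrite ?(na_ge0 na) //.
    by apply: prodr_ge0 => i _; exact: na_ge0.
  apply: ler_prod => i _; rewrite (na_ge0 na) /=; have := lamz_bound (w i + j%:Z).
  by case: (w i + j%:Z) (wj i).
rewrite -(big_morph (fun N => (sigma ^+ n.+1) ^+ N) (exprD _) (expr0 _)) -exprD -exprM ler_wiXn2l ?(ltW s0) //.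
set S := (\sum_i `|(w i + j%:Z)%R|)%N.
have : (\sum_i `|w i| <= S + n * j)%N.
  have -> : (n * j = \sum_(i < n) j)%N by rewrite sum_nat_const card_ord.
  by rewrite -big_split; apply: leq_sum => i _ /=; move: (w i) (wj i) => z; lia.
by move: (\sum_i _)%N => T; nia.
Qed.

Lemma dmx_bound i j : cbound v (sigma ^+ (p * dwt i) / sigma ^+ dwt j) sigma (dmx i j).
Proof.
move=> l; rewrite mxE; apply: le_trans (kl_coef_bound _ _) _.
rewrite mulrAC ler_pdivlMr ?exprn_gt0 // -!exprD ler_wiXn2l ?(ltW s0) //.
rewrite addnC -addnA leq_add2l /dwt big_distrr -big_split /=.
apply: leq_sum => i' _; rewrite expoB expoMn.
move: (pos (enum_val i).1 i') (pos (enum_val j).1 i') => z z'.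
have -> : (p * `|z|%N)%N = `|(z * p%:Z)%R|%N by rewrite abszM absz_nat mulnC.
by move: (z * p%:Z) => zp; lia.
Qed.

End Bounds.

Lemma dwt_inj0 i j : dwt i = 0%N -> dwt j = 0%N -> i = j.
Proof.
move=> /eqP; rewrite sum_nat_eq0 => /forallP i0 /eqP; rewrite sum_nat_eq0 => /forallP j0.
apply: enum_val_inj; move: (enum_val i) (enum_val j) i0 j0 => [a x] [b y] /= a0 b0.
rewrite (ord1 x) (ord1 y); congr (_, _); have H : pos a = pos b; last by apply: pos_inj H.
apply/ffunP => l; have := a0 l; have := b0 l.
by rewrite !absz_eq0 => /eqP -> /eqP ->.
Qed.

Lemma dwt_count t : (#|[set i | (dwt i <= t)%N]| <= t.*2.+1 ^ n)%N.
Proof.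
pose f (i : 'I_#|{: box n K * 'I_1}|) : {ffun 'I_n -> 'I_t.*2.+1} :=
  [ffun l => inord `|(pos (enum_val i).1 l + t%:Z)%R|%N].
have le i l : (dwt i <= t)%N -> (`|pos (enum_val i).1 l|%N <= t)%N.
  by apply: leq_trans; rewrite /dwt (bigD1 l) //= leq_addr.
have finj : {in [set i | (dwt i <= t)%N] &, injective f}.
  move=> i j; rewrite !inE => it jt /ffunP E.
  have H : pos (enum_val i).1 = pos (enum_val j).1.
    apply/ffunP => l; have := congr1 val (E l); have := le i l it; have := le j l jt.
    have fE a : f a l = inord `|(pos (enum_val a).1 l + t%:Z)%R|%N.
      by rewrite /f ffunE.
    rewrite !fE; move: (pos (enum_val i).1 l) (pos (enum_val j).1 l) => z z' z't zt.
    by rewrite /= !inordK; lia.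
  apply: enum_val_inj; move: (enum_val i) (enum_val j) H => [a x] [b y] /= H.
  by rewrite (ord1 x) (ord1 y); congr (_, _); apply: pos_inj H.
rewrite -(card_in_imset finj); apply: leq_trans (max_card _) _.
by rewrite card_ffun !card_ord.
Qed.

Section FixedPoint.
Variable y : C.
Definition kl_mx (t : nat) (w : expo n) : 'M[C]_1 := const_mx (kl_coef w).[y ^+ (p ^ t)].

Lemma kl_mx_bounded t w : ~~ bounded K w -> kl_mx t w = 0.
Proof.
move=> /forallPn[i wi]; suff H : kl_coef w = 0 by apply/matrixP => a b; rewrite !mxE H horner0.
apply/polyP => j; rewrite coef_poly coef0; case: ifP => // jK.
rewrite (bigD1 i) //= (_ : lamz _ = 0) ?mul0r ?mulr0 //.
move: wi jK; case E: (w i + j%:Z) => [l|l] //= wi jK.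
by rewrite coef_poly; case: ifP => // lK; move: E; move: (w i) wi; lia.
Qed.

Lemma psi_dmx m : psi_prod p K kl_mx m = Aprod p dmx m y.
Proof.
elim: m => [|m IH] //=; rewrite IH; congr (_ *m _).
by apply/matrixP => i j; rewrite !mxE.
Qed.

(** The degree j term of the last factor shifts every exponent by - j, and [lamz] compensates by
    reading the coefficient at w_i + j. *)
Lemma kl_laurent t (x : 'I_n -> C) : (forall i, x i != 0) ->
  laurent K kl_mx t x = const_mx ((\prod_i split_poly.[x i]) *
    split_poly.[y ^+ (p ^ t) / \prod_i x i]).
Proof.
move=> x0; apply/matrixP => a b; rewrite summxE !mxE.
set z := y ^+ _.
have hE u : split_poly.[u] = \sum_(j < K) split_poly`_j * u ^+ j.
  by rewrite (horner_coef_wide _ (size_poly _ _)).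
rewrite [split_poly.[z / _]]hE mulr_sumr.
pose G (j : nat) (w : expo n) := \prod_i (x i ^ w i * lamz (w i + j%:Z)).
transitivity (\sum_(j < K) lam j * z ^+ j * \sum_(e : box n K) G j (pos e)).
  under [RHS]eq_bigr do rewrite mulr_sumr.
  rewrite exchange_big /=; apply: eq_bigr => e _.
  rewrite !mxE (horner_coef_wide _ (size_poly _ _)) mulr_sumr; apply: eq_bigr => j _.
  rewrite coef_poly ltn_ord /G big_split /= -/(monom x (pos e)).
  by rewrite mulrCA -!mulrA; congr (_ * _); rewrite mulrC -!mulrA mulrCA.
apply: eq_bigr => j _.
have -> : \sum_(e : box n K) G j (pos e) = (\prod_i split_poly.[x i]) / (\prod_i x i) ^+ j.
  transitivity (\prod_(i < n) \sum_(e < K.*2.+1) x i ^ (e%:Z - K%:Z) * lamz (e%:Z - K%:Z + j%:Z)).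
    rewrite bigA_distr_bigA /=; apply: eq_bigr => e _.
    by apply: eq_bigr => i _; rewrite !ffunE.
  rewrite -prodrXl -prodfV -big_split /=; apply: eq_bigr => i _.
  have jK := ltn_ord j.
  rewrite (@horner_coef_wide _ (K + j.+1)); last by apply: leq_trans (size_poly _ _) _; rewrite leq_addr.
  pose F (e : nat) := x i ^ (e%:Z - K%:Z) * lamz (e%:Z - K%:Z + j%:Z).
  (* Positions below K - j stand for exponents w with w + j < 0, where [lamz] vanishes. *)
  rewrite -(big_mkord xpredT F) (@big_cat_nat _ _ _ (K - j)) //=; last by rewrite -addnn; lia.
  rewrite big1_seq ?add0r => [|e]; last first.
    move=> /andP[_]; rewrite mem_index_iota => /andP[_ lt]; rewrite /F.
    by case E: (_ + j%:Z) => [l|l]; rewrite ?mulr0 //; lia.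
  rewrite -{1}[(K - j)%N]add0n big_addn (_ : (K.*2.+1 - (K - j) = K + j.+1)%N); last by rewrite -addnn; lia.
  rewrite big_mkord mulr_suml; apply: eq_bigr => l _; rewrite /F.
  have -> : (l + (K - j))%N%:Z - K%:Z + j%:Z = l%:Z by lia.
  have -> : (l + (K - j))%N%:Z - K%:Z = l%:Z - j%:Z by lia.
  by rewrite expfzDr // -exprnN mulrC mulrA.
rewrite coef_poly ltn_ord expr_div_n; ring.
Qed.

Lemma tr_dmx (Z : finType) (tau : Z -> C) m : (forall z, tau z != 0) -> (0 < m)%N ->
  (forall w : int, \sum_z tau z ^ w =
     if ((p ^ m - 1)%N %| w)%Z then (p ^ m - 1)%:R else 0) ->
  \sum_(x : {ffun 'I_n -> Z}) \prod_(t < m) ((\prod_i split_poly.[tau (x i) ^+ (p ^ t)]) *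
     split_poly.[(y / \prod_i tau (x i)) ^+ (p ^ t)]) =
  (p ^ m - 1)%:R ^+ n * \tr (Aprod p dmx m y).
Proof.
move=> tau0 m0 orth; rewrite -psi_dmx -(trace_formula p_gt1 kl_mx_bounded tau0 m0 orth).
apply: eq_bigr => x _.
suff -> : laurent_prod p K kl_mx m (fun i => tau (x i)) = const_mx (\prod_(t < m)
    ((\prod_i split_poly.[tau (x i) ^+ (p ^ t)]) * split_poly.[(y / \prod_i tau (x i)) ^+ (p ^ t)])).
  by rewrite /mxtrace big_ord1 mxE.
elim: m {m0 orth} => [|m IH] /=.
  by rewrite big_ord0; apply/matrixP => a b; rewrite !mxE (ord1 a) (ord1 b).
rewrite IH kl_laurent => [|i]; last by rewrite expf_neq0.
apply/matrixP => a b; rewrite !mxE big_ord1 !mxE big_ord_recr /= mulrC; congr (_ * (_ * _)).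
by rewrite expr_div_n -prodrXl.
Qed.

End FixedPoint.
End DworkMatrix.

(** * Closed points of the torus *)

Section ClosedPoints.
Variables (p : nat) (pr_p : prime p) (m : nat).
Let E : splittingFieldType 'F_p := fin_ext 'F_p m.
Notation emb := (map_poly (in_alg E)).

Lemma card_E : #|finvect_type E| = (p ^ m.+1)%N.
Proof. by rewrite card_fin_ext card_Fp. Qed.

Lemma dim_E : \dim {:E} = m.+1.
Proof.
have := card_vspacef (Vector.class (finvect_type E : vectType 'F_p)); rewrite card_vspace card_Fp // card_E.
by move/(congr1 (logn p)); rewrite !pfactorK.
Qed.

Lemma fptP (b : E) : exists f : {poly 'F_p}, minPoly 1%AS b = emb f.
Proof. by have /polyOver1P := minPolyOver 1%AS b. Qed.

(** The closed point below the geometric point b. *)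
Definition fpt (b : E) : {poly 'F_p} := projT1 (cid (fptP b)).
Lemma fptE (b : E) : minPoly 1%AS b = emb (fpt b).
Proof. exact: projT2 (cid (fptP b)). Qed.

Lemma root_fpt (b : E) : root (emb (fpt b)) b.
Proof. by rewrite -fptE root_minPoly. Qed.

Lemma fpt_dvd (b : E) (g : {poly 'F_p}) : root (emb g) b = (fpt b %| g).
Proof.
apply/idP/idP => [gb|/dvdpP[h ->]]; last by rewrite rmorphM rootM root_fpt orbT.
rewrite -(dvdp_map (in_alg E)) -fptE; apply: minPoly_dvdp => //.
by apply/polyOver1P; exists g.
Qed.

Lemma fpt_monic (b : E) : fpt b \is monic.
Proof. by rewrite -(map_monic (in_alg E)) -fptE monic_minPoly. Qed.

Lemma fpt_closed (b : E) : b != 0 -> closed_point_Gm (fpt b).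
Proof.
move=> b0; apply/and3P; split; last first.
- apply: contraNneq b0 => fX; have := root_fpt b.
  by rewrite fX map_polyX rootX.
- exact: fpt_monic.
apply/irreducibleP; split.
  rewrite -(size_map_poly (in_alg E)) -fptE size_minPoly ltnS.
  by rewrite adjoin_degreeE divn_gt0 ?adim_gt0 // dimvS // subv_adjoin.
move=> q q1 qf.
have := dvdp_map (in_alg E) q (fpt b); rewrite qf => qf'.
have q_over : emb q \is a polyOver 1%AS by apply/polyOver1P; exists q.
have q_dvd : emb q %| minPoly 1%AS b by rewrite fptE.
have /orP[|] := minPoly_irr q_over q_dvd; first by rewrite fptE eqp_map.
by rewrite -(rmorph1 emb) eqp_map => /eqp_size; rewrite size_poly1 => /eqP; rewrite (negPf q1).
Qed.

Lemma fpt_degree (b : E) : (point_degree (fpt b) %| m.+1)%N.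
Proof.
rewrite /point_degree -(size_map_poly (in_alg E)) -fptE size_minPoly /= adjoin_degreeE dimv1 divn1.
by rewrite -dim_E; apply: (@field_dimS _ _ <<1; b>>%AS {:E}%AS); apply: subvf.
Qed.

Lemma closed_eq (f g : {poly 'F_p}) : closed_point_Gm f -> closed_point_Gm g -> f %| g -> f = g.
Proof.
move=> /and3P[/irreducibleP[f1 _] fm _] /and3P[/irreducibleP[_ gi] gm _] fg.
apply/eqP; rewrite -eqp_monic //; apply: gi => //.
by rewrite gtn_eqF.
Qed.

Lemma fpt_eq (b : E) f : b != 0 -> closed_point_Gm f -> (fpt b == f) = root (emb f) b.
Proof.
move=> b0 cf; rewrite fpt_dvd; apply/eqP/idP => [->|]; first exact: dvdpp.
by apply: closed_eq => //; apply: fpt_closed.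
Qed.

Lemma closed_dvd (f : {poly 'F_p}) : closed_point_Gm f -> (point_degree f %| m.+1)%N ->
  f %| 'X^(p ^ m.+1) - 'X.
Proof.
move=> cf /dvdnP[c mE].
have fE : mk_monic f = f by apply: (mk_monicE (closed_point_mi cf)).
have [_ f_monic _] := and3P cf.
pose x := point_coord cf; set F := residue_field cf in x *.
have cF : #|F| = (p ^ point_degree f)%N by rewrite (card_qfpoly (closed_point_mi cf)) card_Fp.
have xq : x ^+ (p ^ m.+1) = x.
  rewrite mE mulnC expnM -cF; elim: c {mE} => [|c IH]; first by rewrite expn0 expr1.
  by rewrite expnS exprM expf_card IH.
have : in_qpoly f ('X^(p ^ m.+1) - 'X) = 0.
  rewrite rmorphB rmorphXn /=; apply/eqP; rewrite subr_eq0; apply/eqP; exact: xq.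
move=> /(congr1 (fun u : {poly %/ f} => u : {poly 'F_p})) /=.
rewrite fE => H; rewrite (Pdiv.RingMonic.rdivp_eq f_monic ('X^(p ^ m.+1) - 'X)) H addr0.
exact: dvdp_mull.
Qed.

(** f divides X^q - X, a product of distinct linear factors over the field with q elements, so all
    its roots lie there and are simple; 0 is not among them because f is not X. *)
Lemma card_fpt (f : {poly 'F_p}) : closed_point_Gm f -> (point_degree f %| m.+1)%N ->
  #|[set b : finvect_type E | (b != 0) && (fpt b == f)]| = point_degree f.
Proof.
move=> cf fm; have := closed_dvd cf fm; rewrite -(dvdp_map (in_alg E)).
rewrite rmorphB rmorphXn /= map_polyX -card_E.
have -> : ('X^#|finvect_type E| - 'X : {poly E}) = \prod_(x : finvect_type E) ('X - x%:P).
  exact: (finField_genPoly (finvect_type E)).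
rewrite -big_enum /= => /dvdp_prod_XsubC[msk].
set s := mask msk _ => fs.
have us : uniq s by rewrite mask_uniq ?enum_uniq.
have -> : [set b : finvect_type E | (b != 0) && (fpt b == f)] = [set b in s].
  apply/setP => b; rewrite !inE.
  have -> : (b \in s) = root (emb f) b by rewrite (eqp_root fs) root_prod_XsubC.
  have [b0|b0] := eqVneq b 0; last by rewrite fpt_eq.
  rewrite b0 /=; apply/esym/negP => f0.
  have : 'X %| f.
    rewrite -(dvdp_map (in_alg E)) map_polyX -['X]subr0 -(rmorph0 (@polyC E)) dvdp_XsubCl.
    exact: f0.
  have /and3P[/irreducibleP[_ fi] fmo fX] := cf.
  move=> /(fi 'X); rewrite size_polyX => /(_ isT); rewrite eqp_monic ?monicX // eq_sym.
  by rewrite (negPf fX).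
rewrite cardsE (card_uniqP us) /point_degree -(size_map_poly (in_alg E)) (eqp_size fs).
by rewrite size_prod_XsubC.
Qed.

End ClosedPoints.

Lemma comp_poly_trunc (F : fieldType) N (a : F) d :
  (\poly_(j < N) a ^+ j) \Po 'X^d = \sum_(j < N) a ^+ j *: 'X^(j * d).
Proof.
rewrite poly_def (raddf_sum (comp_poly 'X^d)); apply: eq_bigr => j _.
by rewrite /= comp_polyZ comp_Xn_poly -exprM mulnC.
Qed.

Section EulerProduct.
Variables (p : nat) (pr_p : prime p) (F : fieldType) (w : {poly 'F_p} -> F).
Hypothesis char0 : forall n, n.+1%:R != 0 :> F.

(** A closed point of degree d dividing m contributes d w^(m/d) to the logarithmic derivative, that
    is w^(m/d) for each of its d geometric points. The index is [m.-1] because [fin_ext _ m] has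
    degree m + 1. *)
Lemma euler_ldser N : euler_product_Gm w N =
  ldser (fun m => \sum_(b : {b : finvect_type (fin_ext 'F_p m.-1) | b != 0})
    w (fpt (val b)) ^+ (m %/ point_degree (fpt (val b)))) N.
Proof.
rewrite /euler_product_Gm; set Q := \prod_(f | _) _.
apply: (@ldser_eq _ char0 N _ (fun l => Q`_l)) => //; rewrite /Q.
pose u (f : {poly_(N.+1) 'F_p}) m : F := let d := point_degree (f : {poly 'F_p}) in
  if (d %| m)%N then d%:R * w f ^+ (m %/ d) else 0.
apply: (eq_logder (u := fun m => \sum_(f : {poly_(N.+1) 'F_p} | closed_point_Gm (f : {poly 'F_p})) u f m)).
- move=> m /andP[m0 mN].
  pose E := finvect_type (fin_ext 'F_p m.-1).
  have fN (b : E) : (size (fpt b) <= N.+1)%N.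
    have := fpt_degree pr_p b; rewrite prednK // => /(dvdn_leq m0).
    by rewrite /point_degree; case: (size _) => //= l lm; apply: leq_trans mN.
  rewrite [RHS](partition_big (fun b : {b : E | b != 0} => npolyp N.+1 (fpt (val b)))
    (fun f : {poly_(N.+1) 'F_p} => closed_point_Gm (f : {poly 'F_p}))) /=; last first.
    by move=> b _; rewrite npolypK // fpt_closed // (valP b).
  apply: eq_bigr => f cf; rewrite /u /=.
  have fb (b : {b : E | b != 0}) : (npolyp N.+1 (fpt (val b)) == f) = (fpt (val b) == f :> {poly 'F_p}).
    by rewrite -val_eqE /= -[X in X == _]/(npolyp N.+1 (fpt (val b)) : {poly 'F_p}) npolypK.
  case: ifP => dm.
    rewrite (eq_bigr (fun=> w f ^+ (m %/ point_degree (f : {poly 'F_p})))) => [|b]; last first.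
      by rewrite fb => /eqP ->.
    rewrite -[RHS]/(\sum_(b in [pred b : {b : E | b != 0} | npolyp N.+1 (fpt (val b)) == f])
      w f ^+ (m %/ point_degree (f : {poly 'F_p}))).
    rewrite sumr_const -[RHS]mulr_natl; congr (_%:R * _).
    have dm' : (point_degree (f : {poly 'F_p}) %| m.-1.+1)%N by rewrite prednK.
    rewrite -[LHS](card_fpt pr_p cf dm').
    rewrite -(card_imset _ val_inj); apply: eq_card => b; rewrite inE.
    apply/andP/imsetP => [[b0 bf]|[c cf' ->]].
      exists (exist _ b b0) => //; have E1 := fb (exist _ b b0).
      by rewrite inE; apply: etrans E1 _.
    have E1 := fb c; split; first exact: (valP c).
    by apply: etrans (esym E1) _; move: cf'; rewrite inE.
  rewrite big_pred0 // => b; rewrite fb; apply/negP => /eqP bf.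
  by move: dm; rewrite -bf; have := fpt_degree pr_p (val b); rewrite prednK // => ->.
- by [].
apply: logder_prod => f cf.
have d0 : (0 < point_degree (f : {poly 'F_p}))%N.
  by have /and3P[/irreducibleP[f1 _] _ _] := cf; rewrite /point_degree -ltnS prednK // ltnW.
set d := point_degree _.
have P : logder N (fun i => w f ^+ i) (fun i => (\poly_(j < N.+1) w f ^+ j)`_i).
  by apply: eq_logder (logder_geom N (w f)) => // i iN; rewrite coef_poly ltnS iN.
apply: eq_logder (logder_comp_Xn d0 P) => // i _; rewrite comp_poly_trunc.
by [].
Qed.

End EulerProduct.

(** * Kloosterman sums *)

Lemma choice_dep (A : nat -> Type) (P : forall m, A m -> Prop) :
  (forall m, exists x, P m x) -> exists f : forall m, A m, forall m, P m (f m).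
Proof. by move=> H; exists (fun m => projT1 (cid (H m))) => m; exact: projT2 (cid (H m)). Qed.

Section TeichmullerMaps.
Variables (R : realFieldType) (C : closedFieldType) (v : C -> R) (p : nat).
Hypotheses (na : nonarch v) (pr_p : prime p) (vp : v p%:R = p%:R^-1).
Let p_gt0 := prime_gt0 pr_p.

(** What later arguments need from Teichmuller representatives, collected so that the residue field
    and the embedding into it disappear. [tm_tr] compares the trace of the representatives with an
    integer lift of the trace. *)
Record teich_map (E : finFieldType) (L : nat) (tau : E -> C) : Prop := TeichMap {
  tm_pow : forall x, tau x ^+ (p ^ L) = tau x;
  tm_le1 : forall x, v (tau x) <= 1;
  tm_eq0 : forall x, (tau x == 0) = (x == 0);
  tmM : {morph tau : x y / x * y};
  tmV : {morph tau : x / x^-1};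
  tm1 : tau 1 = 1;
  tm_tr : forall x (c : nat), c%:R = \sum_(t < L) x ^+ (p ^ t) ->
    v (\sum_(t < L) tau x ^+ (p ^ t) - c%:R) < 1;
  tm_orth : forall w : int, \sum_(x : {x : E | x != 0}) tau (val x) ^ w =
    if ((p ^ L - 1)%N %| w)%Z then (p ^ L - 1)%:R else 0 }.

Lemma tm_prod (E : finFieldType) (L : nat) (tau : E -> C) (I : finType) (x : I -> E) : teich_map L tau ->
  tau (\prod_i x i) = \prod_i tau (x i).
Proof. by move=> tm; apply: big_morph; [exact: tmM tm | exact: tm1 tm]. Qed.

Section Kloosterman.
Variables (n : nat) (Psi : 'F_p -> algC) (iota : {rmorphism algC -> C}).
Hypothesis HPsi : nontrivial_additive_character Psi.
Let xi := iota (Psi 1).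

Lemma Psi_exp (a : nat) : Psi a%:R = Psi 1 ^+ a.
Proof.
case: HPsi => P0 PD _; elim: a => [|a IH]; first by rewrite expr0.
by rewrite -natr1 PD IH exprSr.
Qed.

Lemma Psi_E a : iota (Psi a) = xi ^+ (a : nat).
Proof. by rewrite -{1}(natr_Zp a) Psi_exp rmorphXn. Qed.

Lemma xi_exp_p : xi ^+ p = 1.
Proof.
rewrite -rmorphXn -Psi_exp; case: HPsi => P0 _ _.
by rewrite (pcharf0 (pchar_Fp pr_p)) P0 rmorph1.
Qed.

Lemma xi_neq1 : xi != 1.
Proof.
case: HPsi => _ _ [a]; apply: contraNneq => xi1.
by apply/eqP/(fmorph_inj iota); rewrite Psi_E xi1 expr1n rmorph1.
Qed.

Lemma v_xi : v xi = 1.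
Proof.
have : v xi ^+ p = 1 by rewrite -naX // xi_exp_p na1.
by move/eqP; rewrite pexpr_eq1 ?(na_ge0 na) // => /eqP.
Qed.

Variables (pi : C) (rho : R) (K : nat).
Hypotheses (piE : pi ^+ p.-1 = - p%:R) (rho_gt0 : 0 < rho) (rhoE : rho ^+ (p ^ 2) = v pi)
  (xi_pi : v (xi - (1 + pi)) < v pi) (K_gt1 : (1 < K)%N).
Notation Th := (theta p pi K).

Section OneField.
Variables (E : finFieldType) (charE : p \in [pchar E]) (L : nat) (tau : E -> C).
Hypotheses (cardE : #|E| = (p ^ L)%N) (tm : teich_map L tau).

Lemma abs_traceD x y : abs_trace charE (x + y) = abs_trace charE x + abs_trace charE y.
Proof.
apply: (fmorph_inj (Fp_emb charE)); rewrite rmorphD !Fp_embE !abs_traceP -big_split /=.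
apply: eq_bigr => t _; apply: (@exprDn_pchar E).
rewrite pnatX (_ : [pchar E].-nat p) //; apply/pnatP => // q pr_q.
by rewrite dvdn_prime2 // => /eqP ->.
Qed.

Lemma abs_trace0 : abs_trace charE 0 = 0.
Proof. by apply: (addrI (abs_trace charE 0)); rewrite -abs_traceD !addr0. Qed.

Lemma theta_trace x :
  v (\prod_(t < L) Th.[tau x ^+ (p ^ t)] - iota (Psi (abs_trace charE x))) <= rho ^+ K / v p%:R.
Proof.
rewrite Psi_E.
apply: (theta_char na pr_p vp piE rho_gt0 rhoE xi_exp_p xi_pi K_gt1 (tm_pow tm x) (tm_le1 tm x)).
by apply: (tm_tr tm); rewrite abs_traceP cardE pfactorK.
Qed.

Lemma v_Psi a : v (iota (Psi a)) = 1.
Proof. by rewrite Psi_E naX // v_xi expr1n. Qed.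

Lemma theta_prod_le1 x : v (\prod_(t < L) Th.[tau x ^+ (p ^ t)]) <= 1.
Proof.
rewrite na_prod //; apply: prodr_ile1 => t _; rewrite (na_ge0 na) /=.
apply: (theta_le1 na pr_p vp piE rho_gt0 rhoE); rewrite naX // exprn_ile1 ?(na_ge0 na) //.
exact: tm_le1 tm x.
Qed.

(** The character value of a sum splits into a product over its n + 1 arguments, and each factor is
    replaced by means of [theta_trace]. All factors are at most 1, so the errors do not
    accumulate. *)
Lemma kloosterman_teich y :
  v ((\sum_(x : {ffun 'I_n -> {x : E | x != 0}}) \prod_(t < L)
       ((\prod_i Th.[tau (val (x i)) ^+ (p ^ t)]) *
        Th.[(tau y / \prod_i tau (val (x i))) ^+ (p ^ t)])) -
     iota (kloosterman_sum Psi n charE y)) <= rho ^+ K / v p%:R.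
Proof.
have b0 : 0 <= rho ^+ K / v p%:R by rewrite divr_ge0 ?(na_ge0 na) ?exprn_ge0 ?ltW.
have -> : kloosterman_sum Psi n charE y = \sum_(x : {ffun 'I_n -> {x : E | x != 0}})
   (Psi (abs_trace charE (y / \prod_i val (x i))) * \prod_i Psi (abs_trace charE (val (x i)))).
  rewrite /kloosterman_sum (reindex_omap (fun x : {ffun 'I_n -> {x : E | x != 0}} => [ffun i => val (x i)])
     (fun x => Some [ffun i => insubd (exist _ 1 (oner_neq0 E)) (x i)])) /=; last first.
    move=> x /forallP x0; congr Some; apply/ffunP => i; rewrite !ffunE /=.
    by rewrite insubdK // unfold_in x0.
  apply: eq_big => [x|x _].
    have -> : [forall i, [ffun i0 => val (x i0)] i != 0].
      by apply/forallP => i; rewrite ffunE (valP (x i)).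
    by apply/eqP; congr Some; apply/ffunP => i; rewrite !ffunE valKd.
  have [P0 PD _] := HPsi.
  have -> : \prod_i Psi (abs_trace charE (val (x i))) = Psi (abs_trace charE (\sum_i val (x i))).
    symmetry; apply: (big_morph (fun u => Psi (abs_trace charE u))) => [a b|]; last by rewrite abs_trace0.
    by rewrite abs_traceD PD.
  rewrite -PD -abs_traceD addrC.
  by congr (Psi (abs_trace _ (_ / _ + _))); apply: eq_bigr => i _; rewrite ffunE.
rewrite rmorph_sum -sumrB; apply: na_sum_le => // x _.
rewrite big_split /= exchange_big /= mulrC rmorphM rmorph_prod /=.
have -> : tau y / \prod_i tau (val (x i)) = tau (y / \prod_i val (x i)).
  by rewrite (tmM tm) (tmV tm) (tm_prod _ tm).
have P1 (u : E) : v (iota (Psi (abs_trace charE u))) <= 1 by rewrite v_Psi.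
have -> (a b a' b' : C) : a * b - a' * b' = (a - a') * b + a' * (b - b').
  by rewrite mulrBl mulrBr addrA subrK.
apply: naD_le => //; rewrite (naM na).
  rewrite -[leRHS]mulr1; apply: ler_pM; rewrite ?(na_ge0 na) ?theta_trace //.
  by rewrite na_prod //; apply: prodr_ile1 => i _; rewrite (na_ge0 na) theta_prod_le1.
rewrite v_Psi mul1r; apply: na_prod_sub => // i _; rewrite ?theta_trace ?theta_prod_le1 ?P1 //.
Qed.

(** Every term is congruent to 1 because xi is, and the number of terms is (q - 1)^n, congruent to
    (-1)^n. This is the source of the congruence of alpha_0 to 1. *)
Lemma kloosterman_sum_mod (y : E) :
  v (iota (kloosterman_sum Psi n charE y)) <= 1 /\
  v (iota (kloosterman_sum Psi n charE y) - (-1) ^+ n) < 1.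
Proof.
have xi1 : v (xi - 1) < 1.
  have -> : xi - 1 = (xi - (1 + pi)) + pi by rewrite opprD addrA subrK.
  have vpi := v_pi_lt1 na pr_p vp piE.
  by apply: naD_lt => //; apply: lt_trans xi_pi vpi.
have H1 : v (iota (kloosterman_sum Psi n charE y)) <= 1.
  by rewrite rmorph_sum; apply: na_sum_le => // x _; rewrite v_Psi.
split => //; rewrite rmorph_sum.
set A := [pred x : {ffun 'I_n -> E} | [forall i, x i != 0]].
rewrite -(subrK (\sum_(x | A x) 1) (\sum_(x | _) _)) -addrA; apply: (naD_lt na).
  rewrite -sumrB; apply: (na_sum_lt na) => // x _.
  rewrite Psi_E -(expr1n C (abs_trace charE (\sum_i x i + y / \prod_i x i))).
  by apply: le_lt_trans xi1; apply: (na_exp_sub na); rewrite ?v_xi ?(na1 na).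
have L0 : (0 < L)%N by have := finNzRing_gt1 E; rewrite cardE; case: L.
have -> : \sum_(x | A x) 1 = (#|E| - 1)%:R ^+ n :> C.
  rewrite -[LHS]/(\sum_(x in A) 1) sumr_const -natrX; congr _%:R.
  have := card_ffun_on 'I_n (predC1 (0 : E)); rewrite card_ord cardC1 subn1 => <-.
  by apply: eq_card => x; rewrite !inE; apply: eq_forallb.
apply: le_lt_trans (vp_lt1 pr_p vp); apply: (na_exp_sub na); rewrite ?(na_nat na) ?naN ?(na1 na) //.
have E0 : (0 < #|E|)%N by rewrite ltnW ?finNzRing_gt1.
rewrite natrB // opprK subrK; apply: (v_dvdn na).
by rewrite cardE -(prednK L0) expnS dvdn_mulr.
Qed.

End OneField.
End Kloosterman.

Section Points.
Variables (k : fieldType) (red : C -> k).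
Hypotheses (red1 : red 1 = 1)
  (redD : forall x y, v x <= 1 -> v y <= 1 -> red (x + y) = red x + red y)
  (redM : forall x y, v x <= 1 -> v y <= 1 -> red (x * y) = red x * red y)
  (red_eq0 : forall x, v x <= 1 -> (red x == 0) = (v x < 1))
  (red_surj : forall a, exists2 x, v x <= 1 & red x = a).

Lemma teich_mapP (E : finFieldType) (L : nat) (eps : {rmorphism E -> k}) :
  #|E| = (p ^ L)%N -> (0 < L)%N ->
  exists2 tau : E -> C, teich_map L tau & forall x, red (tau x) = eps x.
Proof.
move=> cardE L0; pose tau := teich na pr_p red1 redD redM red_eq0 red_surj eps cardE L0.
have le1 := teich_le1 na pr_p red1 redD redM red_eq0 red_surj eps cardE L0.
have tred := teich_red na pr_p red1 redD redM red_eq0 red_surj eps cardE L0.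
exists tau => //; split.
- exact: teich_pow.
- exact: le1.
- exact: teich_eq0.
- exact: teichM.
- exact: teichV.
- exact: teich1.
- move=> x c cE; have X1 t : v (tau x ^+ t) <= 1 by rewrite naX // exprn_ile1 ?(na_ge0 na) ?le1.
  have S1 : v (\sum_(t < L) tau x ^+ (p ^ t)) <= 1 by apply: na_sum_le.
  rewrite -(red_eq na redD red_eq0) ?na_nat // (red_sum na redD red_eq0) // (red_nat na red1 redD red_eq0).
  rewrite -(rmorph_nat eps) cE rmorph_sum; apply/eqP; apply: eq_bigr => t _.
  by rewrite (redX na red1 redM) ?le1 // tred rmorphXn.
- exact: teich_orth.
Qed.

(** The residue field at f is embedded so that its coordinate has the same image as b;
    representatives with equal reduction coincide, so Kloosterman sums at f can be evaluated at the
    representative of b. *)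
Lemma teich_points :
  exists tau : forall m, finvect_type (fin_ext 'F_p m) -> C,
  forall m, teich_map m.+1 (tau m) /\
  forall (b : finvect_type (fin_ext 'F_p m)) (f : {poly 'F_p}) (hf : closed_point_Gm f) (r : nat),
    b != 0 -> f = fpt b -> (0 < r)%N ->
    exists2 tau' : finvect_type (fin_ext (residue_field hf) (r * (m.+1 %/ point_degree f)).-1) -> C,
      teich_map (m.+1 * r) tau' & tau' (point_coord hf)%:A = tau m b.
Proof.
have ck := k_pchar na pr_p vp red1 redD red_eq0.
have kc : forall P : {poly k}, size P != 1%N -> exists z, root P z.
  by move=> P; apply: (k_closed na pr_p red1 redD redM red_eq0 red_surj).
have E1 m : exists tau : finvect_type (fin_ext 'F_p m) -> C, teich_map m.+1 tau /\
   exists eps : {rmorphism fin_ext 'F_p m -> k}, (forall x, red (tau x) = eps x) /\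
     forall a : 'F_p, eps a%:A = Fp_emb ck a.
  have [eps epsA] := fin_ext_embedding kc m (Fp_emb ck).
  have [tau tm tauE] := @teich_mapP (finvect_type (fin_ext 'F_p m)) m.+1 eps (card_E pr_p m) isT.
  by exists tau; split=> //; exists eps.
have [tau tauP] := choice_dep E1; exists tau => m; have [tm [eps [tauE epsA]]] := tauP m.
split=> // b f hf r b0 fE r0.
have root_f : root (map_poly (Fp_emb ck) f) (eps b).
  have := root_fpt b; rewrite -fE => /(rmorph_root eps).
  rewrite -map_poly_comp; congr (root _ _); apply: eq_map_poly => a /=; exact: epsA.
have [e1 e1E] := residue_embedding hf root_f.
set m' := (r * _).-1; have [e2 e2E] := fin_ext_embedding kc m' e1.
have dm : (point_degree f %| m.+1)%N by rewrite fE fpt_degree.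
have d0 : (0 < point_degree f)%N by rewrite (dvdn_gt0 _ dm).
have m'E : m'.+1 = (r * (m.+1 %/ point_degree f))%N.
  by rewrite prednK // muln_gt0 r0 divn_gt0 // dvdn_leq.
have cE : #|finvect_type (fin_ext (residue_field hf) m')| = (p ^ (m.+1 * r))%N.
  rewrite card_fin_ext m'E (card_qfpoly (closed_point_mi hf)) card_Fp // -expnM.
  by congr (_ ^ _)%N; rewrite -[(size f).-1]/(point_degree f) mulnCA [(point_degree f * _)%N]mulnC divnK // mulnC.
have L0 : (0 < m.+1 * r)%N by rewrite muln_gt0.
have [tau' tm' tauE'] := @teich_mapP (finvect_type (fin_ext (residue_field hf) m')) (m.+1 * r) e2 cE L0.
exists tau' => //; apply: (teich_uniq na pr_p vp L0 (tm_pow tm' _)); rewrite ?(tm_le1 tm') ?(tm_le1 tm) //.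
  have P1 := tm_pow tm b; elim: (r) => [|j IH]; first by rewrite muln0 expr1.
  by rewrite mulnS expnD exprM P1 IH.
rewrite -(red_eq na redD red_eq0) ?(tm_le1 tm') ?(tm_le1 tm) //.
by rewrite tauE' tauE e2E e1E.
Qed.

End Points.
End TeichmullerMaps.

(** * Unit roots *)

Lemma logder_inj (F : fieldType) N (u w f : nat -> F) : logder N u f -> logder N w f ->
  forall i, (0 < i <= N)%N -> u i = w i.
Proof.
move=> [f0 fu] [_ fw]; elim/ltn_ind => -[_ //|i IH] /= iN.
have := fw i iN; rewrite fu // !big_ord_recr /= subnn f0 !mulr1.
rewrite (eq_bigr (fun j : 'I_i => w j.+1 * f (i - j)%N)) => [|j _]; first by move/addrI.
by rewrite IH ?ltnS //= (ltn_trans _ iN) // ltnS.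
Qed.

Lemma logder_root_prod (F : fieldType) (I : finType) (a : I -> F) N :
  logder N (fun r => - \sum_i a i ^+ r) (fun j => (\prod_i (1 - a i *: 'X))`_j).
Proof.
by apply: eq_logder (logder_prodT (fun i => logder_sub1X N (a i))) => // r _; rewrite sumrN.
Qed.

(** Comparison of logarithmic derivatives; for even n the product is the inverse of L, which
    accounts for the sign (-1)^n. *)
Lemma root_power_sums (F : fieldType) (char0 : forall n, n.+1%:R != 0 :> F) (n : nat)
    (K : nat -> F) (alpha : 'I_n.+1 -> F) :
  let L := ps_exp (fun m => K m.-1 / m%:R) in
  let P := ps_of_poly (\prod_(i < n.+1) (1 - alpha i *: 'X)) in
  (if odd n then L =1 P else ps_mul L P =1 ps_of_poly 1) ->
  forall r, (0 < r)%N -> \sum_i alpha i ^+ r = (-1) ^+ n * K r.-1.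
Proof.
move=> L P H r r0; have LD := ldserP char0 r (fun m => K m.-1).
have PD := logder_root_prod alpha r.
rewrite -signr_odd; case: (odd n) H => H.
  have {}LD : logder r (fun m => K m.-1) P by apply: eq_logder LD => // i _; exact: H.
  by rewrite expr1 mulN1r (logder_inj LD PD (i := r)) ?opprK // r0 leqnn.
have E : logder r (fun m => K m.-1 - \sum_i alpha i ^+ m) (fun j => (1 : {poly F})`_j).
  apply: eq_logder (ldserP char0 r _) => // i ir; rewrite -[RHS](H i) ldser_mul //.
  by apply: eq_bigr => j _; congr (_ * _); apply/esym/(ldser_eq char0 PD); rewrite (leq_trans (leq_subr _ _)).
have rr : (0 < r <= r)%N by rewrite r0 leqnn.
have /eqP := logder_inj E (logder1 r) rr.
by rewrite subr_eq0 expr0 mul1r => /eqP ->.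
Qed.

Section RootBound.
Variables (R : archiRealFieldType) (C : fieldType) (v : C -> R).
Hypotheses (na : nonarch v) (char0 : forall n, n.+1%:R != 0 :> C).

Lemma power_unbounded (x b c : R) : 1 < x -> 0 < c -> exists r, b < c * x ^+ r.
Proof.
move=> x1 c0; have x0 : 0 < x := lt_trans ltr01 x1.
have xi : 0 <= x^-1 < 1 by rewrite invr_ge0 ltW //= invf_lt1.
have [b0|b0] := leP b 0.
  by exists 0%N; rewrite expr0 mulr1; apply: le_lt_trans b0 c0.
have [N HN] := null_exp xi (divr_gt0 c0 b0); exists N; have := HN N (leqnn N).
rewrite exprVn ltr_pdivlMr // mulrC ltr_pdivrMr ?exprn_gt0 //.
Qed.

(* The polynomial vanishing at the other roots extracts the powers of a single
   root from the power sums. *)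
Lemma roots_le1 (I : finType) (alpha : I -> C) (B : R) :
  (forall r, (0 < r)%N -> v (\sum_i alpha i ^+ r) <= B) -> forall i, v (alpha i) <= 1.
Proof.
move=> HB i0; rewrite leNgt; apply/negP => a1.
pose Q := \prod_(i | alpha i != alpha i0) ('X - (alpha i)%:P).
pose c := #|[pred i | alpha i == alpha i0]|%:R * Q.[alpha i0].
have Q0 : Q.[alpha i0] != 0.
  rewrite horner_prod; apply/prodf_neq0 => i ne; rewrite hornerXsubC subr_eq0 eq_sym //.
have c0 : c != 0.
  rewrite mulf_neq0 //; have : (0 < #|[pred i | alpha i == alpha i0]|)%N.
    by apply/card_gt0P; exists i0; rewrite inE.
  by case: #|_|.
have E r : \sum_i Q.[alpha i] * alpha i ^+ r = c * alpha i0 ^+ r.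
  rewrite (bigID (fun i => alpha i == alpha i0)) /= [X in _ + X]big1 ?addr0; last first.
    move=> i ne; rewrite horner_prod (bigD1 i) //= hornerXsubC subrr mul0r mul0r //.
  rewrite (eq_bigr (fun=> Q.[alpha i0] * alpha i0 ^+ r)) => [|i /eqP -> //].
  rewrite -[LHS]/(\sum_(i in [pred i | alpha i == alpha i0]) _) sumr_const -[LHS]mulr_natl mulrA //.
have bound r : (0 < r)%N -> v (c * alpha i0 ^+ r) <= (\sum_(l < size Q) v Q`_l) * B.
  move=> r0; rewrite -E.
  have -> : \sum_i Q.[alpha i] * alpha i ^+ r = \sum_(l < size Q) Q`_l * \sum_i alpha i ^+ (l + r).
    under eq_bigr do rewrite horner_coef mulr_suml.
    rewrite exchange_big /=; apply: eq_bigr => l _; rewrite mulr_sumr; apply: eq_bigr => i _.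
    by rewrite exprD mulrA.
  have B0 : 0 <= B by apply: le_trans (HB 1%N isT); exact: na_ge0.
  have s0 : 0 <= \sum_(l < size Q) v Q`_l by apply: sumr_ge0 => l _; exact: na_ge0.
  apply: (na_sum_le na) => [|l _]; first exact: mulr_ge0.
  rewrite (naM na); apply: ler_pM; rewrite ?(na_ge0 na) //.
    rewrite (bigD1 l) //= lerDl; apply: sumr_ge0 => l' _; exact: na_ge0.
  by apply: HB; rewrite addn_gt0 r0 orbT.
have vc : 0 < v c * v (alpha i0) by apply: mulr_gt0; [rewrite (na_gt0 na) | exact: lt_trans ltr01 a1].
have [r Hr] := power_unbounded ((\sum_(l < size Q) v Q`_l) * B) a1 vc.
have := bound r.+1 isT; rewrite leNgt => /negP; apply.
by rewrite (naM na) (naX na) exprS mulrA.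
Qed.

End RootBound.

Section AprodPower.
Variables (C : closedFieldType) (p N : nat) (A : 'M[{poly C}]_N).

Lemma Aprod_add m r y : Aprod p A (m + r) y = Aprod p A m (y ^+ (p ^ r)) *m Aprod p A r y.
Proof.
elim: m => [|m IH]; first by rewrite mul1mx.
by rewrite addSn /= IH mulmxA -exprM -expnD addnC.
Qed.

Lemma Aprod_exp m r y : y ^+ (p ^ m) = y -> Aprod p A (m * r) y = Aprod p A m y ^+ r.
Proof.
move=> ym; elim: r => [|r IH]; first by rewrite muln0.
by rewrite mulnSr Aprod_add ym IH exprSr.
Qed.

End AprodPower.

Section Link.
Variables (R : archiRealFieldType) (C : closedFieldType) (v : C -> R) (p : nat).
Hypotheses (na : nonarch v) (pr_p : prime p) (vp : v p%:R = p%:R^-1).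
Let p_gt0 := prime_gt0 pr_p.
Let char0 := natr_neq0 na pr_p vp.
Variables (n : nat) (Psi : 'F_p -> algC) (iota : {rmorphism algC -> C}).
Hypothesis HPsi : nontrivial_additive_character Psi.
Let xi := iota (Psi 1).
Variables (pi : C) (rho : R).
Hypotheses (piE : pi ^+ p.-1 = - p%:R) (rho_gt0 : 0 < rho) (rhoE : rho ^+ (p ^ 2) = v pi)
  (xi_pi : v (xi - (1 + pi)) < v pi).
Notation A K := (dmx p n K (dwork p pi)).

Lemma tr_kloosterman K (E : finFieldType) (charE : p \in [pchar E]) (L : nat) (tau : E -> C) y :
  (1 < K)%N -> (0 < L)%N -> #|E| = (p ^ L)%N -> teich_map v p L tau ->
  v ((p ^ L - 1)%:R ^+ n * \tr (Aprod p (A K) L (tau y)) -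
     iota (kloosterman_sum Psi n charE y)) <= rho ^+ K / v p%:R.
Proof.
move=> K1 L0 cardE tm.
have tau0 (x : {x : E | x != 0}) : tau (val x) != 0 by rewrite (tm_eq0 tm) (valP x).
rewrite -(tr_dmx n K (prime_gt1 pr_p) (dwork p pi) (tau y) tau0 L0 (tm_orth tm)).
exact: (kloosterman_teich na pr_p vp n HPsi piE rho_gt0 rhoE xi_pi K1 charE cardE tm).
Qed.

(** The assumption on the other roots only says that they are not units. That they lie inside the
    unit disc comes from [roots_le1], since all power sums are integral; the first power sum and
    [kloosterman_sum_mod] then give the congruence for the root of index [ord0]. *)
Lemma closed_point_roots (f : {poly 'F_p}) (hf : closed_point_Gm f) (alpha : 'I_n.+1 -> algC)
    (L := L_kloosterman Psi n (residue_field_pchar pr_p hf) (point_coord hf))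
    (P := ps_of_poly (\prod_(i < n.+1) (1 - alpha i *: 'X))) :
  (if odd n then L =1 P else ps_mul L P =1 ps_of_poly 1) ->
  (forall i, (v (iota (alpha i)) == 1) = (i == ord0)) ->
  [/\ forall i, i != ord0 -> v (iota (alpha i)) < 1, v (iota (alpha ord0) - 1) < 1 &
      forall r, (0 < r)%N -> \sum_i iota (alpha i) ^+ r =
        (-1) ^+ n * iota (kloosterman Psi n (residue_field_pchar pr_p hf) (point_coord hf) r.-1)].
Proof.
move=> LP unit0.
have PS r : (0 < r)%N -> \sum_i iota (alpha i) ^+ r =
    (-1) ^+ n * iota (kloosterman Psi n (residue_field_pchar pr_p hf) (point_coord hf) r.-1).
  move=> r0; have c0 : forall n, n.+1%:R != 0 :> algC by move=> n'; rewrite pnatr_eq0.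
  have := root_power_sums c0 LP r0; rewrite -/(kloosterman _ _ _ _ _).
  move/(congr1 iota); rewrite rmorph_sum rmorphM rmorphXn rmorphN1 /= => <-.
  by apply: eq_bigr => i _; rewrite rmorphXn.
have mod1 r := kloosterman_sum_mod na pr_p vp n HPsi piE xi_pi
  (fin_ext_pchar (residue_field_pchar pr_p hf) r).
have cardE r : #|finvect_type (fin_ext (residue_field hf) r)| =
    (p ^ (point_degree f * r.+1))%N.
  by rewrite card_fin_ext (card_qfpoly (closed_point_mi hf)) card_Fp // -expnM.
have N1 : v ((-1) ^+ n) = 1 by rewrite naX // naN1 // expr1n.
have le1 i : v (iota (alpha i)) <= 1.
  apply: (roots_le1 na char0 (alpha := fun i => iota (alpha i)) (B := 1)) => r r0.
  rewrite PS // (naM na) N1 mul1r.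
  exact: (mod1 _ _ (cardE r.-1) _).1.
have lt1 i : i != ord0 -> v (iota (alpha i)) < 1.
  by move=> i0; rewrite lt_neqAle le1 unit0 i0.
split=> //.
have := PS 1%N isT; rewrite big_ord_recl expr1 => E1.
have -> : iota (alpha ord0) - 1 = (-1) ^+ n *
  (iota (kloosterman Psi n (residue_field_pchar pr_p hf) (point_coord hf) 0) - (-1) ^+ n)
  - \sum_(i < n) iota (alpha (lift ord0 i)) ^+ 1.
  rewrite mulrBr -E1 -expr2 sqrr_sign; ring.
apply: (naB_lt na); last by apply: (na_sum_lt na) => // i _; rewrite expr1 lt1.
rewrite (naM na) N1 mul1r; exact: (mod1 _ _ (cardE 0%N) _).2.
Qed.

(** Since y is fixed by the p^(m+1)-th power, the r-th power of its Frobenius belongs to the field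
    of degree (m + 1) r over the prime field, which has degree r d over the residue field at f. So
    the r d-th Kloosterman sum is compared. *)
Lemma trace_roots K m r (f : {poly 'F_p}) (hf : closed_point_Gm f) (alpha : 'I_n.+1 -> C)
    (d := (m.+1 %/ point_degree f)%N) y
    (tau' : finvect_type (fin_ext (residue_field hf) (r * d).-1) -> C) :
  (1 < K)%N -> (0 < r)%N -> (point_degree f %| m.+1)%N -> y ^+ (p ^ m.+1) = y ->
  teich_map v p (m.+1 * r) tau' -> tau' (point_coord hf)%:A = y ->
  (forall r, (0 < r)%N -> \sum_i alpha i ^+ r =
     (-1) ^+ n * iota (kloosterman Psi n (residue_field_pchar pr_p hf) (point_coord hf) r.-1)) ->
  v ((1 - (p%:R ^+ m.+1) ^+ r) ^+ n * \tr (Aprod p (A K) m.+1 y ^+ r) - \sum_i (alpha i ^+ d) ^+ r)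
    <= rho ^+ K / v p%:R.
Proof.
move=> K1 r0 dm ym tm tauy PS.
have d0 : (0 < d)%N by rewrite divn_gt0 ?(dvdn_gt0 _ dm) // dvdn_leq.
have rd0 : (0 < r * d)%N by rewrite muln_gt0 r0.
have cE : #|finvect_type (fin_ext (residue_field hf) (r * d).-1)| = (p ^ (m.+1 * r))%N.
  rewrite card_fin_ext prednK // (card_qfpoly (closed_point_mi hf)) card_Fp // -expnM.
  by congr (_ ^ _)%N; rewrite -[(size f).-1]/(point_degree f) mulnCA [(point_degree f * _)%N]mulnC divnK // mulnC.
have L0 : (0 < m.+1 * r)%N by rewrite muln_gt0.
have H := tr_kloosterman (fin_ext_pchar (residue_field_pchar pr_p hf) (r * d).-1)
  (point_coord hf)%:A K1 L0 cE tm.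
rewrite tauy (Aprod_exp _ _ ym) in H.
have -> : \sum_i (alpha i ^+ d) ^+ r = (-1) ^+ n *
    iota (kloosterman Psi n (residue_field_pchar pr_p hf) (point_coord hf) (r * d).-1).
  by rewrite -PS //; apply: eq_bigr => i _; rewrite -exprM mulnC.
have -> : (1 - (p%:R ^+ m.+1) ^+ r) = - (p ^ (m.+1 * r) - 1)%:R :> C.
  by rewrite natrB ?expn_gt0 ?p_gt0 // opprB natrX exprM.
rewrite exprNn -mulrA -mulrBr (naM na) naX // naN1 // expr1n mul1r.
exact: H.
Qed.

End Link.

(** * Limits of the Fredholm determinants *)

Section Bounds.
Variables (R : archiRealFieldType) (C : fieldType) (v : C -> R).
Hypotheses (na : nonarch v) (char0 : forall n, n.+1%:R != 0 :> C).

Lemma ldserX (a : C) N : ldser (fun r => a ^+ r) N = a ^+ N.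
Proof. by rewrite -(ldser_eq char0 (logder_geom N a)). Qed.

Lemma ldser_boundD (u w : nat -> C) (eta : R) : 0 <= eta ->
  (forall i, v (ldser u i) <= eta ^+ i) -> (forall i, v (ldser w i) <= eta ^+ i) ->
  forall i, v (ldser (fun r => u r + w r) i) <= eta ^+ i.
Proof.
move=> e0 ub wb i; rewrite ldser_mul //; apply: (na_sum_le na) => [|j _]; first exact: exprn_ge0.
have ji : (j <= i)%N by rewrite -ltnS.
rewrite (naM na) -[in leRHS](subnKC ji) exprD.
by apply: ler_pM; rewrite ?(na_ge0 na).
Qed.

Lemma ldser_bound_sum (I : Type) (s : seq I) (a : I -> C) (eta : R) : 0 <= eta ->
  (forall i, v (a i) <= eta) -> forall N, v (ldser (fun r => \sum_(i <- s) a i ^+ r) N) <= eta ^+ N.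
Proof.
move=> e0 ab; elim: s => [|x s IH] N.
  rewrite (@eq_ldser _ char0 N _ (fun=> 0)) => [|i _]; last by rewrite big_nil.
  by rewrite ldser0 //; case: eqP => [->|_]; rewrite ?(na1 na) ?(na0 na) ?exprn_ge0.
rewrite (@eq_ldser _ char0 N _ (fun r => a x ^+ r + \sum_(i <- s) a i ^+ r)); last first.
  by move=> i _; rewrite big_cons.
apply: ldser_boundD => // i; rewrite ldserX (naX na).
by apply: lerXn2r; rewrite ?nnegrE ?(na_ge0 na).
Qed.

Lemma ldser_bound_coef (w : nat -> C) (eta : R) : 0 <= eta ->
  (forall i, v (ldser w i) <= eta ^+ i) -> forall r, (0 < r)%N -> v (w r) <= eta ^+ r.
Proof.
move=> e0 wb; elim/ltn_ind => -[//|M IH] _.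
have := (ldserP char0 M.+1 w).2 M (ltnSn M).
rewrite big_ord_recr /= subnn (ldserP char0 0 w).1 mulr1 => /eqP; rewrite addrC -subr_eq => /eqP <-.
apply: (naB_le na); first by apply: le_trans (na_mulrn na _ _) (wb _).
apply: (na_sum_le na) => [|i _]; first exact: exprn_ge0.
have iM := ltn_ord i.
have -> : (M.+1 = i.+1 + (M - i))%N by lia.
by rewrite (naM na) exprD; apply: ler_pM; rewrite ?(na_ge0 na) // IH // ltnS.
Qed.

Lemma max_lt1 (I : eqType) (s : seq I) (f : I -> R) (c : R) : 0 <= c < 1 ->
  (forall i, i \in s -> f i < 1) ->
  exists eta, [/\ 0 <= eta < 1, c <= eta & forall i, i \in s -> f i <= eta].
Proof.
move=> c1; elim: s => [|x s IH] H; first by exists c.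
have [i si|eta [/andP[e0 e1] ce He]] := IH; first by apply: H; rewrite inE si orbT.
exists (Num.max eta (f x)); split; rewrite ?le_max ?gt_max ?e0 ?e1 ?ce ?H ?mem_head //.
by move=> i; rewrite inE le_max => /orP[/eqP ->|/He ->]; rewrite ?lexx ?orbT.
Qed.

End Bounds.

(** * The limiting spectrum of one fibre and its unit eigenvalue *)

Section Fiber.
Variables (R : archiRealFieldType) (C : fieldType) (v : C -> R).
Hypotheses (na : nonarch v) (char0 : forall n, n.+1%:R != 0 :> C).
Variables (n : nat) (beta : 'I_n.+1 -> C) (q : C).
Hypotheses (beta_lt1 : forall i, i != ord0 -> v (beta i) < 1)
  (beta_unit : v (beta ord0 - 1) < 1) (q_lt1 : v q < 1).

(** Expanding (1 - q^r)^(-n) as a power series in q^r shows the power sums of the numbers beta_i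
    q^j, with binomial multiplicities. *)
Definition psum r : C := (1 - q ^+ r) ^- n * \sum_i beta i ^+ r.
Let fsum j r : C := (1 - q ^+ r) ^- j * \sum_i beta i ^+ r - beta ord0 ^+ r.

Lemma v_beta0 : v (beta ord0) = 1.
Proof. by rewrite -(na1 na); apply: (na_addr1 na); rewrite (na1 na). Qed.

Lemma v_1subq r : (0 < r)%N -> v (1 - q ^+ r) = 1.
Proof.
move=> r0; rewrite addrC (na_isosceles na) (na1 na) // (naN na) (naX na).
by rewrite exprn_ilt1 ?(na_ge0 na) // -lt0n.
Qed.

(** Induction on the number j of divisions by 1 - q^r. For j = 0 removing the unit root leaves the
    other roots. One more division is an instance of [ldser_twist], at the cost of the extra term (q
    beta_0)^r, which stays below the rate eta. *)
Lemma fiber_eta : exists eta : R, [/\ 0 <= eta < 1, v q <= eta &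
  forall j i, v (ldser (fsum j) i) <= eta ^+ i].
Proof.
have [||eta [eta01 qe be]] := @max_lt1 R _ (enum 'I_n) (fun i => v (beta (lift ord0 i))) (v q).
- by rewrite q_lt1 (na_ge0 na).
- by move=> i _; apply: beta_lt1; rewrite eq_sym neq_lift.
exists eta; split=> //; have /andP[e0 e1] := eta01.
have b0 := v_beta0; elim=> [|j IH].
  move=> i; rewrite (@eq_ldser _ char0 i _ (fun r => \sum_(i < n) beta (lift ord0 i) ^+ r)); last first.
    by move=> r _; rewrite /fsum expr0 invr1 mul1r big_ord_recl addrAC subrr add0r.
  apply: ldser_bound_sum => // j; apply: be; exact: mem_enum.
apply: (ldser_twist na char0 (u := fun r => fsum j r + (q * beta ord0) ^+ r) eta01 qe).
  move=> r r0; have q1 : 1 - q ^+ r != 0 by rewrite -(na_eq0 na) v_1subq ?oner_neq0.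
  rewrite /fsum mulrBr mulrA exprS invfM mulrA mulfV // mul1r exprMn mulrBl mul1r opprB.
  by rewrite addrA addrAC.
apply: ldser_boundD => // i; rewrite ldserX // (naX na) (naM na) b0 mulr1.
by apply: lerXn2r; rewrite ?nnegrE ?(na_ge0 na).
Qed.

Lemma psumE r : psum r = beta ord0 ^+ r + fsum n r.
Proof. by rewrite /fsum addrC subrK. Qed.

Lemma psum_le1 j : v (ldser psum j) <= 1.
Proof.
have [eta [/andP[e0 e1] _ eb]] := fiber_eta.
rewrite (@eq_ldser _ char0 j _ (fun r => beta ord0 ^+ r + fsum n r)) => [|r _]; last exact: psumE.
rewrite ldser_addX //; apply: (na_sum_le na) => // i _.
rewrite (naM na) (naX na) v_beta0 expr1n mul1r; apply: le_trans (eb n i) _.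
by rewrite exprn_ile1 // ltW.
Qed.

Variable ks : nat -> nat.
Hypothesis ks_gt : forall s, (s < ks s)%N.
Variable A : C.
Hypothesis ksA : tends v (fun s => beta ord0 ^+ ks s) A.

Lemma psum_tends : tends v (fun s => psum (ks s)) A.
Proof.
have [eta [e01 _ eb]] := fiber_eta; have /andP[e0 e1] := e01.
have H : tends v (fun s => beta ord0 ^+ ks s + fsum n (ks s)) (A + 0).
  apply: (tendsD na ksA); apply: tends_null (null_exp e01) _ => s; rewrite subr0.
  have k0 : (0 < ks s)%N by apply: leq_ltn_trans (ks_gt s).
  apply: le_trans (ldser_bound_coef na char0 e0 (eb n) k0) _.
  by apply: ler_wiXn2l => //; [exact: ltW | exact: ltnW].
by rewrite addr0 in H; move=> e /H; apply: eventuallyW => s; rewrite psumE.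
Qed.

Hypothesis complete : forall u : nat -> C,
  (forall e, 0 < e -> exists N, forall i j, (N <= i)%N -> (N <= j)%N -> v (u i - u j) < e) ->
  exists l, tends v u l.

Lemma psum_ser_tends j : exists l, tends v (fun s => ldser psum (ks s - j)) l.
Proof.
have [eta [e01 _ eb]] := fiber_eta.
have [l ll] := ldser_unit_cvg na complete v_beta0 char0 e01 (eb n) (fun s => ltnW (ks_gt s)) ksA j.
exists l => e /ll; apply: eventuallyW => s.
by rewrite (@eq_ldser _ char0 _ _ psum) // => r _; rewrite psumE.
Qed.

End Fiber.

Section Exponents.
Variables (R : archiRealFieldType) (C : closedFieldType) (v : C -> R) (p : nat).
Hypotheses (na : nonarch v) (pr_p : prime p) (vp : v p%:R = p%:R^-1).

(** These exponents are congruent to k modulo p^s and exceed s; the summand |k| outweighs a negative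
    k. *)
Definition approx_exp (k : int) (s : nat) : nat :=
  absz (k + ((p ^ s) * (absz k + s.+1))%N%:Z).

Lemma approx_expE k s : (approx_exp k s)%:Z = k + ((p ^ s) * (absz k + s.+1))%N%:Z.
Proof.
have : (`|k| + s.+1 <= (p ^ s) * (absz k + s.+1))%N by rewrite leq_pmull // expn_gt0 prime_gt0.
by rewrite /approx_exp; move: (_ * _)%N => x; lia.
Qed.

Lemma approx_exp_gt k s : (s < approx_exp k s)%N.
Proof.
have : (`|k| + s.+1 <= (p ^ s) * (absz k + s.+1))%N by rewrite leq_pmull // expn_gt0 prime_gt0.
by have := approx_expE k s; move: (_ * _)%N => x; lia.
Qed.

(** Since a is congruent to 1, its p^s-th powers tend to 1 by [pow_pM]; this is where the congruence
    for the unit root enters. *)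
Lemma approx_exp_tends k a : v (a - 1) < 1 -> tends v (fun s => a ^+ approx_exp k s) (a ^ k).
Proof.
move=> a1; have va : v a = 1 by rewrite -(na1 na); apply: (na_addr1 na); rewrite (na1 na).
have a0 : a != 0 by rewrite -(na_eq0 na) va oner_eq0.
pose c := Num.max (v p%:R) (v (a - 1)).
have c0 : 0 <= c by rewrite le_max (na_ge0 na).
have c1 : c < 1 by rewrite gt_max a1 (vp_lt1 pr_p vp).
have vak : v (a ^ k) = 1.
  by case: k => k /=; rewrite ?(naV na) (naX na) va expr1n ?invr1.
apply: (tends_null (r := fun s => c ^+ s)) => [|s]; first by apply: null_exp; rewrite c0.
rewrite exprnP approx_expE expfzDr // -[X in _ - X]mulr1 -mulrBr (naM na) vak mul1r.
rewrite -exprnP exprM -(expr1n C (absz k + s.+1)).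
apply: (na_exp_sub na); rewrite ?(naX na) ?va ?expr1n ?(na1 na) //.
apply: le_trans (_ : c ^+ s.+1 <= _); last by rewrite exprS ler_piMl ?exprn_ge0 // ltW.
by apply: (pow_pM na pr_p); rewrite ?va ?le_max ?lexx ?orbT // ltW.
Qed.

End Exponents.

Lemma eventually_fin (T : finType) (P : T -> nat -> Prop) :
  (forall z, eventually (P z)) -> eventually (fun i => forall z, P z i).
Proof.
move=> H; have [|N HN] := @eventually_all (fun j i => forall z, j = enum_rank z -> P z i) #|T|.
  move=> j jT; have [N HN] := H (enum_val (Ordinal jT)); exists N => i Ni z jz.
  have -> : z = enum_val (Ordinal jT); last exact: HN.
  by apply: enum_rank_inj; rewrite enum_valK; apply: val_inj.
by exists N => i Ni z; apply: (HN i Ni (enum_rank z)).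
Qed.

Section Family.
Variables (R : archiRealFieldType) (C : closedFieldType) (v : C -> R) (p : nat).
Hypotheses (na : nonarch v) (pr_p : prime p) (vp : v p%:R = p%:R^-1).
Hypothesis complete : forall u : nat -> C,
  (forall e, 0 < e -> exists N, forall i j, (N <= i)%N -> (N <= j)%N -> v (u i - u j) < e) ->
  exists l, tends v u l.
Let char0 := natr_neq0 na pr_p vp.
Let p_gt1 := prime_gt1 pr_p.
Let vp1 := vp_lt1 pr_p vp.
Variables (n : nat) (sigma : R) (lam : nat -> C).
Hypotheses (s01 : 0 < sigma < 1) (lam_bound : forall j, v (lam j) <= (sigma ^+ n.+1) ^+ j).
Let s0 : 0 < sigma. Proof. by case/andP: s01. Qed.
Let s1 : sigma < 1. Proof. by case/andP: s01. Qed.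
Notation A K := (dmx p n K lam).
Variables (Z : nat -> finType) (tau : forall m, Z m -> C) (beta : forall m, Z m -> 'I_n.+1 -> C).
Hypotheses (tau_neq0 : forall m (z : Z m), tau z != 0)
  (tau_le1 : forall m (z : Z m), v (tau z) <= 1)
  (orth : forall m, (0 < m)%N -> forall w : int, \sum_(z : Z m) tau z ^ w =
     if ((p ^ m - 1)%N %| w)%Z then (p ^ m - 1)%:R else 0)
  (beta_lt1 : forall m (z : Z m) i, (0 < m)%N -> i != ord0 -> v (beta z i) < 1)
  (beta_unit : forall m (z : Z m), (0 < m)%N -> v (beta z ord0 - 1) < 1)
  (trace_beta : forall K m (z : Z m) r, (1 < K)%N -> (0 < m)%N -> (0 < r)%N ->
     v ((1 - (p%:R ^+ m) ^+ r) ^+ n * \tr (Aprod p (A K) m (tau z) ^+ r) - \sum_i beta z i ^+ r)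
       <= (sigma ^+ n.+1) ^+ K / v p%:R).

Definition fps m (z : Z m) : nat -> C := psum (beta z) (p%:R ^+ m).

Lemma v_pm m : (0 < m)%N -> v (p%:R ^+ m) < 1.
Proof. by move=> m0; rewrite (naX na) exprn_ilt1 ?(na_ge0 na) // -lt0n. Qed.

Lemma tr_fps K m (z : Z m) r : (1 < K)%N -> (0 < m)%N -> (0 < r)%N ->
  v (\tr (Aprod p (A K) m (tau z) ^+ r) - fps z r) <= (sigma ^+ n.+1) ^+ K / v p%:R.
Proof.
move=> K1 m0 r0; have q1 := v_1subq na (v_pm m0) r0.
have q0 : (1 - (p%:R ^+ m) ^+ r) ^+ n != 0 :> C by apply: expf_neq0; rewrite -(na_eq0 na) q1 oner_eq0.
rewrite -[X in X <= _]mul1r -(expr1n R n) -q1 -(naX na) -(naM na) mulrBr /fps /psum mulVKf //.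
exact: trace_beta.
Qed.

Lemma tail_null e : 0 < e -> eventually (fun K => (sigma ^+ n.+1) ^+ K / v p%:R < e).
Proof.
move=> e0; have vp0 : 0 < v p%:R by apply: vp_gt0 pr_p vp.
have r01 : 0 <= sigma ^+ n.+1 < 1 by rewrite exprn_ge0 ?exprn_ilt1 // ltW.
have [N HN] := null_exp r01 (mulr_gt0 e0 vp0); exists N => K /HN.
by rewrite ltr_pdivrMr.
Qed.

Lemma tr_tends m (z : Z m) r : (0 < m)%N -> (0 < r)%N ->
  tends v (fun K => \tr (Aprod p (A K) m (tau z) ^+ r)) (fps z r).
Proof.
move=> m0 r0 e /tail_null[N HN]; exists (maxn 2 N) => K; rewrite geq_max => /andP[K1 NK].
exact: le_lt_trans (tr_fps z K1 m0 r0) (HN K NK).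
Qed.

Lemma symtr_tends m (z : Z m) j : (0 < m)%N ->
  tends v (fun K => symtr p (A K) m (tau z) j) (ldser (fps z) j).
Proof. by move=> m0; apply: (ldser_tends na char0) => r r0; exact: tr_tends. Qed.

Lemma exttr_tends m (z : Z m) j : (0 < m)%N ->
  tends v (fun K => exttr p (A K) m (tau z) j) (ldser (fun r => - fps z r) j).
Proof.
by move=> m0; apply: (ldser_tends na char0) => r r0; apply: (tendsN na); exact: tr_tends.
Qed.

Lemma exttr_le K m (z : Z m) i : (0 < m)%N ->
  v (exttr p (A K) m (tau z) i.+1) <= (sigma ^+ (p - 1)) ^+ i.
Proof.
move=> m0; have := exttr_bound na p_gt1 s01 char0 (dmx_bound p_gt1 na s01 lam_bound (K := K))
  0 i.+1 m0 (tau_le1 z).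
rewrite muln1 => /le_trans; apply; rewrite ler_wiXn2l ?exprn_ge0 ?exprn_ile1 ?(ltW s0) ?(ltW s1) //.
have := dwt_count n K p_gt1 0; rewrite exp1n; lia.
Qed.

Variable k : int.
Let ks := approx_exp p k.

(** The index k_s - i of [symtr] grows with s, so convergence in K at each fixed index does not
    suffice. For a given s only finitely many triples with m <= s and j <= k_s occur, and one depth
    serves them all. *)
Lemma choose_depth : exists Ks : nat -> nat, forall s, [/\ (s <= Ks s)%N, (1 < Ks s)%N &
  forall m (z : Z m) j, (0 < m <= s)%N -> (j <= ks s)%N ->
    v (symtr p (A (Ks s)) m (tau z) j - ldser (fps z) j) < v p%:R ^+ s].
Proof.
suff H s : exists K, [/\ (s <= K)%N, (1 < K)%N &
  forall m (z : Z m) j, (0 < m <= s)%N -> (j <= ks s)%N ->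
    v (symtr p (A K) m (tau z) j - ldser (fps z) j) < v p%:R ^+ s].
  by have [Ks KsP] := choice H; exists Ks.
have es : 0 < v p%:R ^+ s by rewrite exprn_gt0 // (vp_gt0 pr_p vp).
have [N HN] : eventually (fun K => forall m, (m < s.+1)%N -> forall z : Z m, forall j, (j < (ks s).+1)%N ->
    (0 < m)%N -> v (symtr p (A K) m (tau z) j - ldser (fps z) j) < v p%:R ^+ s).
  apply: (eventually_all (P := fun m K => forall z : Z m, forall j, (j < (ks s).+1)%N ->
    (0 < m)%N -> v (symtr p (A K) m (tau z) j - ldser (fps z) j) < v p%:R ^+ s)) => m _.
  apply: (eventually_fin (P := fun z K => forall j, (j < (ks s).+1)%N ->
    (0 < m)%N -> v (symtr p (A K) m (tau z) j - ldser (fps z) j) < v p%:R ^+ s)) => z.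
  apply: (eventually_all (P := fun j K => (0 < m)%N ->
    v (symtr p (A K) m (tau z) j - ldser (fps z) j) < v p%:R ^+ s)) => j _.
  have [m0|m0] := posnP m; first by exists 0%N.
  by have := symtr_tends z j m0 es; apply: eventuallyW.
exists (maxn N (maxn s 2)); split; try lia.
move=> m z j /andP[m0 ms] jk; apply: HN => //; lia.
Qed.

Lemma vp_null : null (fun s => v p%:R ^+ s).
Proof. by apply: null_exp; rewrite (na_ge0 na) vp1. Qed.

Lemma exp_fps_tends m (z : Z m) : (0 < m)%N ->
  tends v (fun s => beta z ord0 ^+ ks s) (beta z ord0 ^ k).
Proof. by move=> m0; apply: approx_exp_tends => //; exact: beta_unit. Qed.

Section Depth.
Variable Ks : nat -> nat.
Hypotheses (Ks_ge : forall s, (s <= Ks s)%N) (Ks_gt1 : forall s, (1 < Ks s)%N)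
  (Ks_close : forall s m (z : Z m) j, (0 < m <= s)%N -> (j <= ks s)%N ->
    v (symtr p (A (Ks s)) m (tau z) j - ldser (fps z) j) < v p%:R ^+ s).

Lemma ks_gt s : (s < ks s)%N. Proof. exact: approx_exp_gt. Qed.

Lemma symtr_le1 s m (z : Z m) j : (0 < m <= s)%N -> (j <= ks s)%N ->
  v (symtr p (A (Ks s)) m (tau z) j) <= 1.
Proof.
move=> ms jk; have /andP[m0 _] := ms.
rewrite -[symtr _ _ _ _ _](subrK (ldser (fps z) j)); apply: (naD_le na).
  apply: le_trans (ltW (Ks_close z ms jk)) _.
  by rewrite exprn_ile1 ?(na_ge0 na) // ltW.
exact: (psum_le1 na char0 (fun i => beta_lt1 z m0) (beta_unit z m0) (v_pm m0)).
Qed.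

Lemma symtr_depth_tends m (z : Z m) j : (0 < m)%N ->
  exists l, tends v (fun s => symtr p (A (Ks s)) m (tau z) (ks s - j)) l.
Proof.
move=> m0.
have [||l ll] := @psum_ser_tends _ _ _ na char0 n (beta z) (p%:R ^+ m) _ _ (v_pm m0) ks ks_gt
  _ (exp_fps_tends z m0) complete j.
- by move=> i; exact: beta_lt1.
- exact: beta_unit.
exists l => e e0; have [N HN] := eventuallyI (ll e e0) (vp_null e0).
exists (maxn m N) => s; rewrite geq_max => /andP[ms Ns]; have [H1 H2] := HN s Ns.
rewrite -[symtr _ _ _ _ _](subrK (ldser (fps z) (ks s - j))) -addrA; apply: (naD_lt na) => //.
by apply: lt_trans H2; apply: Ks_close; rewrite ?m0 ?leq_subr.
Qed.

(** Dominated convergence in i: the exterior trace supplies the decay (sigma^(p-1))^i, while the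
    symmetric one is at most 1 and converges at the moving index k_s - i. *)
Lemma fred_trace_tends b m : (0 < m)%N ->
  exists l, tends v (fun s => fred_trace p (A (Ks s)) tau b (ks s) m) l.
Proof.
move=> m0.
pose c i : C := (-1) ^+ i.+2 * p%:R ^+ (m * (odd i.+1 (+) b)) * (p ^ m - 1)%:R^-1.
(* The bounds on [symtr] hold for m <= s only; earlier terms are replaced by zero, without effect on
   the limit. *)
pose f s i : C := if (m <= s)%N then (c i * \sum_(z : Z m)
  symtr p (A (Ks s)) m (tau z) (ks s - i.+1) * exttr p (A (Ks s)) m (tau z) i.+1) *+ i.+1 else 0.
have q1 : v (p ^ m - 1)%:R = 1.
  have -> : (p ^ m - 1)%:R = - (1 - p%:R ^+ m) :> C.
    by rewrite natrB ?expn_gt0 ?prime_gt0 // natrX opprB.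
  by rewrite (naN na) addrC (na_isosceles na) ?(naN na) ?(na1 na) ?v_pm.
have c1 i : v (c i) <= 1.
  have N1 : v ((-1) ^+ i.+2) = 1 by rewrite (naX na) (naN1 na) expr1n.
  rewrite /c (naM na) (naV na) q1 invr1 mulr1 (naM na) N1 mul1r (naX na).
  by rewrite exprn_ile1 ?(na_ge0 na) // ltW.
have r01 : 0 <= sigma ^+ (p - 1) < 1.
  by rewrite exprn_ge0 ?(ltW s0) //= exprn_ilt1 ?(ltW s0) // subn_eq0 -ltnNge.
have [||l ll] := @dominated_cvg _ _ _ na complete f (fun i => (sigma ^+ (p - 1)) ^+ i) ks
  (null_exp r01) (fun s => ltnW (ks_gt s)).
- move=> s i ik; rewrite /f; case: ifP => ms; last by rewrite (na0 na) exprn_ge0 // (andP r01).1.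
  apply: le_trans (na_mulrn na _ _) _; rewrite (naM na) -[leRHS]mul1r.
  apply: ler_pM; rewrite ?(na_ge0 na) // (na_sum_le na) // => [|z _].
    by rewrite exprn_ge0 // (andP r01).1.
  rewrite (naM na) -[leRHS]mul1r; apply: ler_pM; rewrite ?(na_ge0 na) ?exttr_le //.
  by apply: symtr_le1; rewrite ?m0 ?leq_subr.
- move=> i.
  have H (z : Z m) : exists l, tends v (fun s => symtr p (A (Ks s)) m (tau z) (ks s - i.+1) *
      exttr p (A (Ks s)) m (tau z) i.+1) l.
    have [l ll] := symtr_depth_tends z i.+1 m0.
    exists (l * ldser (fun r => - fps z r) i.+1); apply: (tendsM na) => //.
    exact: (tends_sub Ks_ge (exttr_tends z i.+1 m0)).
  have [l ll] := choice H.
  exists (c i * (\sum_z l z) * i.+1%:R).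
  apply: eq_tends (_ : eventually (fun s => _ = f s i)) (_ : tends v (fun s => c i * (\sum_(z : Z m)
    symtr p (A (Ks s)) m (tau z) (ks s - i.+1) * exttr p (A (Ks s)) m (tau z) i.+1) * i.+1%:R) _).
    by exists m => s ms; rewrite /f ms mulr_natr.
  apply: (tendsM na); last exact: tends_cst.
  apply: (tendsM na); first exact: tends_cst.
  by apply: (tends_sum na) => z _; exact: ll.
exists l; apply: eq_tends ll; exists m => s ms; rewrite /fred_trace.
by apply: eq_bigr => i _; rewrite /f ms.
Qed.

Lemma trace_depth_tends m : (0 < m)%N ->
  tends v (fun s => \sum_(z : Z m) \tr (Aprod p (A (Ks s)) m (tau z) ^+ ks s))
    (\sum_(z : Z m) beta z ord0 ^ k).
Proof.
move=> m0; apply: (tends_sum na) => z _.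
have P1 : tends v (fun s => fps z (ks s)) (beta z ord0 ^ k).
  apply: (psum_tends na char0 (fun i => beta_lt1 z m0) (beta_unit z m0) (v_pm m0) ks_gt).
  exact: exp_fps_tends.
move=> e e0; have [N HN] := eventuallyI (P1 e e0) (tail_null e0); exists N => s Ns.
have [H1 _] := HN s Ns; have [_ H2] := HN (Ks s) (leq_trans Ns (Ks_ge s)).
rewrite -[\tr _](subrK (fps z (ks s))) -addrA; apply: (naD_lt na) => //.
apply: le_lt_trans H2; apply: tr_fps => //; exact: leq_ltn_trans (ks_gt s).
Qed.

End Depth.

(** The limits are taken on the traces, for each m. The exponentials of the limits are the two
    series; they inherit the bounds of [fred_bound], which are uniform in s, and [fred_newton]
    becomes the product identity. *)
Theorem unit_root_quotient : exists g h : nat -> C,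
  [/\ forall t, exists c, forall N, v (g N) <= (sigma ^+ ((p - 1) * t.+1)) ^+ (N - c),
      forall t, exists c, forall N, v (h N) <= (sigma ^+ ((p - 1) * t.+1)) ^+ (N - c),
      h 0%N = 1 &
      ps_mul (ldser (fun m => \sum_(z : Z m) beta z ord0 ^ k)) h =1 g].
Proof.
have [Ks KsP] := choose_depth.
have Ks_ge s : (s <= Ks s)%N by case: (KsP s).
have Ks_gt1 s : (1 < Ks s)%N by case: (KsP s).
have Ks_close s : forall m (z : Z m) j, (0 < m <= s)%N -> (j <= ks s)%N ->
    v (symtr p (A (Ks s)) m (tau z) j - ldser (fps z) j) < v p%:R ^+ s by case: (KsP s).
have lim b m : exists l, (0 < m)%N -> tends v (fun s => fred_trace p (A (Ks s)) tau b (ks s) m) l.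
  have [->|m0] := posnP m; first by exists 0.
  by have [l ll] := fred_trace_tends Ks_ge Ks_close b m0; exists l.
have [Gt GtP] := choice (lim true); have [Gf GfP] := choice (lim false).
have bound b G : (forall m, (0 < m)%N -> tends v (fun s => fred_trace p (A (Ks s)) tau b (ks s) m) (G m)) ->
    forall t, exists c, forall N, v (ldser G N) <= (sigma ^+ ((p - 1) * t.+1)) ^+ (N - c).
  move=> H t; exists (t.+1 * t.+1 * (t.*2.+1 * (t.+1 ^ (t.*2.+1 ^ n) * t.+1 ^ (t.*2.+1 ^ n))))%N => N.
  apply: (tends_le na (ldser_tends na char0 H N)); exists 0%N => s _.
  rewrite -(ldser_eq char0 (fred_logder p_gt1 s01 char0 (A (Ks s)) tau_neq0 orth b (ks s) N)) //.
  rewrite -[leRHS]mul1r.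
  apply: (fred_bound na p_gt1 s01 (dmx_bound p_gt1 na s01 lam_bound (K := Ks s))
    (cnt := fun t => (t.*2.+1 ^ n)%N) _ _ b (ks s) t (ltW vp1)).
    by move=> x y; exact: dwt_inj0.
  by move=> t'; exact: (dwt_count n (Ks s) p_gt1 t').
exists (ldser Gt), (ldser Gf); split.
- exact: bound GtP.
- exact: bound GfP.
- exact: (ldserP char0 0 Gf).1.
move=> N; rewrite -ldser_mul //; apply: eq_ldser => // m /andP[m0 _].
apply: (tends_uniq na) (_ : tends v _ _) (GtP m m0).
apply: eq_tends (_ : tends v (fun s => \sum_(z : Z m) \tr (Aprod p (A (Ks s)) m (tau z) ^+ ks s) +
  fred_trace p (A (Ks s)) tau false (ks s) m) _); last first.
  apply: (tendsD na); last exact: GfP.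
  exact: trace_depth_tends.
exists 0%N => s _; rewrite addrC fred_newton //.
exact: leq_ltn_trans (ks_gt s).
Qed.

End Family.

(** * The unit root zeta function *)

Section Assembly.
Variables (R : archiRealFieldType) (C : closedFieldType) (v : C -> R) (p : nat).
Hypotheses (na : nonarch v) (pr_p : prime p) (vp : v p%:R = p%:R^-1).
Hypothesis complete : forall u : nat -> C,
  (forall e, 0 < e -> exists N, forall i j, (N <= i)%N -> (N <= j)%N -> v (u i - u j) < e) ->
  exists l, tends v u l.

(** For a given z, t is taken with r^(t+1) v(z) <= 1/2; past the corresponding c the terms then
    decay like powers of 1/2. *)
Lemma entire_tends (g : nat -> C) (r : R) : 0 < r < 1 ->
  (forall t, exists c, forall N, v (g N) <= (r ^+ t.+1) ^+ (N - c)) ->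
  forall z, exists l, tends v (fun N => \sum_(i < N) g i * z ^+ i) l.
Proof.
move=> /andP[r0 r1] gb z; have z0 : 0 <= v z := na_ge0 na z.
have B0 : 0 < 1 + v z by rewrite ltr_pwDl.
have [t Ht] : exists t, r ^+ t.+1 * v z <= 2^-1.
  have e0 : 0 < 2^-1 / (1 + v z) by rewrite divr_gt0 ?invr_gt0 ?ltr0n.
  have r01 : 0 <= r < 1 by rewrite ltW.
  have [t Ht] := null_exp r01 e0; exists t; have := Ht t.+1 (leqnSn t).
  rewrite ltr_pdivlMr // => /ltW; apply: le_trans; rewrite ler_wpM2l ?exprn_ge0 ?(ltW r0) //.
  by rewrite lerDr.
have [c gc] := gb t.
pose b N := (1 + v z) ^+ c * 2^-1 ^+ (N - c).
suff [b_null b_bound] : null b /\ forall N, v (g N * z ^+ N) <= b N by exact: series_cvg b_null b_bound.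
split=> [e e0|N].
  have h01 : 0 <= (2^-1 : R) < 1 by rewrite invr_ge0 ler0n invf_lt1 ?ltr0n ?ltr1n.
  have Bc : 0 < (1 + v z) ^+ c by rewrite exprn_gt0.
  have [N HN] := null_exp h01 (divr_gt0 e0 Bc); exists (N + c)%N => i Ni.
  by rewrite /b mulrC -ltr_pdivlMr //; apply: HN; lia.
rewrite /b (naM na) (naX na).
have [Nc|cN] := leqP N c.
  rewrite (_ : (N - c = 0)%N) ?expr0 ?mulr1; last by lia.
  have gN : v (g N) <= 1 by apply: le_trans (gc N) _; rewrite (_ : (N - c = 0)%N) ?expr0 //; lia.
  apply: le_trans (_ : 1 * (1 + v z) ^+ N <= _).
    by apply: ler_pM; rewrite ?(na_ge0 na) ?exprn_ge0 ?lerXn2r ?nnegrE ?lerDr ?(ltW B0).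
  by rewrite mul1r ler_weXn2l // lerDl.
apply: le_trans (_ : (r ^+ t.+1) ^+ (N - c) * (v z ^+ (N - c) * v z ^+ c) <= _).
  by rewrite -exprD subnK 1?ltnW // ler_wpM2r ?exprn_ge0.
rewrite mulrA -exprMn mulrC; apply: ler_pM; rewrite ?exprn_ge0 ?mulr_ge0 ?exprn_ge0 ?(ltW r0) //.
  by rewrite lerXn2r ?nnegrE ?lerDr ?(ltW B0).
by rewrite lerXn2r ?nnegrE ?mulr_ge0 ?exprn_ge0 ?(ltW r0) ?invr_ge0 ?ler0n.
Qed.

Variables (n : nat) (Psi : 'F_p -> algC) (iota : {rmorphism algC -> C}).
Hypothesis HPsi : nontrivial_additive_character Psi.
Variable alpha0 : {poly 'F_p} -> algC.
Hypothesis Halpha0 : forall (f : {poly 'F_p}) (hf : closed_point_Gm f),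
  let L := L_kloosterman Psi n (residue_field_pchar pr_p hf) (point_coord hf) in
  exists alpha : 'I_n.+1 -> algC,
    let P := ps_of_poly (\prod_(i < n.+1) (1 - alpha i *: 'X)) in
    [/\ forall i, alpha i != 0,
        if odd n then L =1 P else ps_mul L P =1 ps_of_poly 1,
        forall i, (v (iota (alpha i)) == 1) = (i == ord0)
      & alpha ord0 = alpha0 f].
Variable k : int.

Lemma unit_root_meromorphic : exists g h : nat -> C,
  [/\ forall z, exists l, tends v (fun N => \sum_(i < N) g i * z ^+ i) l,
      forall z, exists l, tends v (fun N => \sum_(i < N) h i * z ^+ i) l,
      h 0%N = 1 &
      ps_mul (euler_product_Gm (fun f => iota (alpha0 f ^ k))) h =1 g].
Proof.
have char0 := natr_neq0 na pr_p vp; have p_gt1 := prime_gt1 pr_p.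
have [w [piE xi_pi]] := exists_pi na pr_p vp (xi_exp_p pr_p iota HPsi) (xi_neq1 iota HPsi) (ltn0Sn n).
set pi := w ^+ _ in piE xi_pi.
have rhoE : (v w ^+ n.+1) ^+ (p ^ 2) = v pi by rewrite (naX na) exprM.
have vpi1 : v pi < 1 := v_pi_lt1 na pr_p vp piE.
have vpi0 : 0 < v pi.
  rewrite (na_gt0 na); apply/eqP => pi0; move: piE.
  rewrite pi0 expr0n (_ : (p.-1 == 0)%N = false); last by lia.
  by move/esym/eqP; rewrite oppr_eq0 (negPf (p_neq0 na pr_p vp)).
have np0 : (0 < n.+1 * p ^ 2)%N by rewrite muln_gt0 expn_gt0 (ltnW p_gt1).
have vw01 : 0 < v w < 1.
  apply/andP; split.
    rewrite (na_gt0 na); apply: contraTneq vpi0 => w0.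
    by rewrite /pi w0 expr0n gtn_eqF // (na0 na) ltxx.
  rewrite ltNge; apply/negP => w1; move: vpi1; rewrite ltNge /pi (naX na) exprn_ege1 //.
have rho0 : 0 < v w ^+ n.+1 by rewrite exprn_gt0 // (andP vw01).1.
have [kf [red [red1 redD redM red_eq0 red_surj]]] := residue_fieldP na.
have [tau tauP] := teich_points na pr_p vp red1 redD redM red_eq0 red_surj.
have [al alP] : exists al : {poly 'F_p} -> 'I_n.+1 -> C, forall f (hf : closed_point_Gm f),
    [/\ al f ord0 = iota (alpha0 f), forall i, i != ord0 -> v (al f i) < 1,
      v (al f ord0 - 1) < 1 & forall r, (0 < r)%N -> \sum_i al f i ^+ r =
        (-1) ^+ n * iota (kloosterman Psi n (residue_field_pchar pr_p hf) (point_coord hf) r.-1)].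
  (* [choice] asks for roots at every polynomial; one that is not a closed point gets zeros. *)
  suff H f : exists a : 'I_n.+1 -> C, forall hf : closed_point_Gm f,
    [/\ a ord0 = iota (alpha0 f), forall i, i != ord0 -> v (a i) < 1,
      v (a ord0 - 1) < 1 & forall r, (0 < r)%N -> \sum_i a i ^+ r =
        (-1) ^+ n * iota (kloosterman Psi n (residue_field_pchar pr_p hf) (point_coord hf) r.-1)].
    by have [al alP] := choice H; exists al.
  have [hf|nf] := pselect (closed_point_Gm f); last by exists (fun=> 0).
  have [a [a0 aL aU aE]] := Halpha0 hf.
  have [a1 a2 a3] := closed_point_roots na vp HPsi piE xi_pi aL aU.
  by exists (fun i => iota (a i)) => hf'; rewrite (bool_irrelevance hf' hf); split=> //; rewrite aE.
pose Z m : finType := {b : finvect_type (fin_ext 'F_p m.-1) | b != 0}.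
pose tz m (z : Z m) : C := tau m.-1 (val z).
pose dg m (z : Z m) := (m %/ point_degree (fpt (val z)))%N.
(* Over the field of degree m the roots at a point of degree d are raised to the power m/d. *)
pose be m (z : Z m) i : C := al (fpt (val z)) i ^+ dg m z.
have cl m (z : Z m) : closed_point_Gm (fpt (val z)) := fpt_closed (valP z).
have dgP m (z : Z m) : (0 < m)%N -> (0 < dg m z)%N.
  move=> m0; have dm := fpt_degree pr_p (val z); rewrite prednK // in dm.
  by rewrite divn_gt0 ?(dvdn_gt0 m0 dm) // dvdn_leq.
have be0 m (z : Z m) i : (0 < m)%N -> i != ord0 -> v (be m z i) < 1.
  move=> m0 i0; have [_ H _ _] := alP _ (cl m z).
  by rewrite (naX na) exprn_ilt1 ?(na_ge0 na) ?H // -lt0n dgP.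
have be1 m (z : Z m) : (0 < m)%N -> v (be m z ord0 - 1) < 1.
  move=> m0; have [_ _ H _] := alP _ (cl m z).
  have v1 : v (al (fpt (val z)) ord0) = 1 by rewrite -(na1 na); apply: (na_addr1 na); rewrite (na1 na).
  rewrite -(expr1n C (dg m z)); apply: le_lt_trans H.
  by apply: (na_exp_sub na); rewrite ?v1 ?(na1 na).
have tz0 m (z : Z m) : tz m z != 0 by rewrite (tm_eq0 (tauP m.-1).1) (valP z).
have tz1 m (z : Z m) : v (tz m z) <= 1 by exact: tm_le1 (tauP m.-1).1 _.
have orth m : (0 < m)%N -> forall w : int, \sum_(z : Z m) tz m z ^ w =
    if ((p ^ m - 1)%N %| w)%Z then (p ^ m - 1)%:R else 0.
  by case: m => // m _; exact: tm_orth (tauP m).1.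
have trz K m (z : Z m) r : (1 < K)%N -> (0 < m)%N -> (0 < r)%N ->
    v ((1 - (p%:R ^+ m) ^+ r) ^+ n * \tr (Aprod p (dmx p n K (dwork p pi)) m (tz m z) ^+ r) -
      \sum_i be m z i ^+ r) <= (v w ^+ n.+1) ^+ K / v p%:R.
  move=> K1 m0 r0; case: m z m0 => // m z _; have [tm pts] := tauP m.
  have [tau' tm' tauE] := pts (val z) _ (cl m.+1 z) r (valP z) erefl r0.
  have [_ _ _ PS] := alP _ (cl m.+1 z).
  exact: (trace_roots na vp HPsi piE rho0 rhoE xi_pi K1 r0 (fpt_degree pr_p (val z)) (tm_pow tm _) tm' tauE PS).
have lamb := dwork_bound na pr_p vp piE rho0 rhoE.
have [g [h [gb hb h0 gh]]] := unit_root_quotient na pr_p vp complete vw01 lamb tz0 tz1 orth be0 be1 trz k.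
have s01 : 0 < v w ^+ (p - 1) < 1.
  by rewrite exprn_gt0 ?exprn_ilt1 ?(andP vw01).1 ?(andP vw01).2 ?(na_ge0 na) //; lia.
have ent (f : nat -> C) : (forall t, exists c, forall N, v (f N) <= (v w ^+ ((p - 1) * t.+1)) ^+ (N - c)) ->
    forall z, exists l, tends v (fun N => \sum_(i < N) f i * z ^+ i) l.
  by move=> H; apply: (entire_tends s01) => t; have [c Hc] := H t; exists c => N; rewrite -(exprM (v w)).
exists g, h; split=> //; [exact: ent gb | exact: ent hb | move=> N].
rewrite -gh; apply: eq_bigr => i _; congr (_ * _).
rewrite (euler_ldser pr_p _ char0); apply: eq_ldser => // m /andP[m0 _].
apply: eq_bigr => z _; have [E _ _ _] := alP _ (cl m z).
rewrite /be E fmorphXz; set a := iota _; rewrite -/(dg m z).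
by rewrite !exprnP exprzAC.
Qed.

End Assembly.

From mathcomp Require Import all_classical all_reals all_analysis.
Import numFieldNormedType.Exports.

Section PadicComplexField.
Variables (R : realType) (C : closedFieldType) (v : C -> R) (p : nat).
Local Open Scope classical_set_scope.

Lemma Cp_nonarch : is_Cp v p -> nonarch v.
Proof.
move=> HC; split; [exact: Cp_norm_eq0 HC | exact: Cp_normM HC | exact: Cp_ultrametric HC|].
(* Nonnegativity holds because every element of C is a square. *)
move=> x; have [y <-] := nth_root x (ltn0Sn 1).
by rewrite expr2 (Cp_normM HC) -expr2 sqr_ge0.
Qed.

Lemma vcvg_tends (u : nat -> C) l : nonarch v -> vcvg v u l <-> tends v u l.
Proof.
move=> na; rewrite /vcvg; split=> [ul e e0|ul].
  have /cvgrPdist_lt/(_ e e0)[N _ HN] := ul; exists N => i Ni.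
  by have := HN i Ni; rewrite /= sub0r normrN ger0_norm // (na_ge0 na).
apply/cvgrPdist_lt => e e0; have [N HN] := ul e e0; exists N => // i Ni /=.
by rewrite sub0r normrN ger0_norm ?(na_ge0 na) //; exact: HN.
Qed.

Lemma Cp_complete_tends : is_Cp v p -> forall u : nat -> C,
  (forall e, 0 < e -> exists N, forall i j, (N <= i)%N -> (N <= j)%N -> v (u i - u j) < e) ->
  exists l, tends v u l.
Proof.
move=> HC u cu; have [l ul] := Cp_complete HC cu; exists l.
by apply/vcvg_tends => //; exact: Cp_nonarch.
Qed.

End PadicComplexField.

Theorem theorem1p1 (p : nat) (pr_p : prime p) (n : nat) (n_gt0 : (0 < n)%N)
  (Psi : 'F_p -> algC) (HPsi : nontrivial_additive_character Psi)
  (R : realType) (C : closedFieldType) (v : C -> R) (HC : is_Cp v p)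
  (iota : {rmorphism algC -> C})
  (alpha0 : {poly 'F_p} -> algC)
  (Halpha0 : forall (f : {poly 'F_p}) (hf : closed_point_Gm f),
     is_kloosterman_unit_root v iota pr_p Psi n hf (alpha0 f))
  (k : int) :
  padic_meromorphic v (L_unit_root iota alpha0 k).
Proof.
have na := Cp_nonarch HC.
have [g [h [gz hz h0 gh]]] := unit_root_meromorphic na (Cp_normp HC) (Cp_complete_tends HC)
  HPsi Halpha0 k.
exists g, h; split=> //; last by exists 0%N; rewrite h0 oner_eq0.
- by move=> z; have [l gl] := gz z; exists l; apply/vcvg_tends.
- by move=> z; have [l hl] := hz z; exists l; apply/vcvg_tends.
Qed.
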